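(* Let $\omega\in\mathcal W$. (1) If $E$ is a complex topological vector space topologized by a family $(\mu_i)_{i\in I}$ of seminorms, then its $(\omega)$-Beurling–Colombeau generalization $\mathcal G^{(\omega)}[E]$, with its sharp topology, is a topological module over the topological ring $\tilde{\mathbb C}^{(\omega)}$ of generalized constants. (2) If moreover $E$ is a topological algebra, then $\mathcal G^{(\omega)}[E]$ is a topological algebra over $\tilde{\mathbb C}^{(\omega)}$. (3) Consequently, for every open $\Omega\subset\mathbb R^d$, $\mathcal G^{(\omega)}(\Omega)$ is a differential topological algebra over $\tilde{\mathbb C}^{(\omega)}$.
   Context: $\mathbb R^+=[0,\infty)$. $\mathcal W$ is the set of all nondecreasing continuous functions $\omega:\mathbb R^+\to\mathbb R^+$ such that $\omega(0)=0$; $\omega(x+y)\le\omega(x)+\omega(y)$ for all $x,y\ge 0$; $\int_1^\infty \frac{\omega(t)}{t^2}\,dt<\infty$; and $\lim_{t\to\infty}\frac{\omega(t)}{\log(1+t)}=\infty$. All $o(\cdot)$ are as $\varepsilon\to0^+$; nets are indexed by $\varepsilon\in(0,1)$. Generalization: for $E$ topologized by $(\mu_i)_{i\in I}$, a net $(g_\varepsilon)\in E^{(0,1)}$ is moderate if for all $i$ there is $k>0$ with $\mu_i(g_\varepsilon)=o(e^{k\omega(1/\varepsilon)})$, and negligible if for all $i$ and all $k>0$, $\mu_i(g_\varepsilon)=o(e^{-k\omega(1/\varepsilon)})$. $\mathcal G^{(\omega)}[E]$ is the quotient of the space of moderate nets by the space of negligible nets, with operations (sum, scalar multiplication by generalized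 constants, and product when $E$ is an algebra) defined componentwise on representatives. The sharp topology is the translation-invariant topology with fundamental system of neighbourhoods of $0$ given by the finite intersections of the sets $\{[(g_\varepsilon)]:\mu_i(g_\varepsilon)=o(e^{-l\omega(1/\varepsilon)})\}$, $i\in I$, $l>0$. $\tilde{\mathbb C}^{(\omega)}=\mathcal G^{(\omega)}[\mathbb C]$, where $\mathbb C$ has the seminorm $|\cdot|$. A topological algebra (or module) has jointly continuous operations. Beurling functions: for a compactly supported continuous $f$ on $\mathbb R^d$ and $l>0$, $\|f\|_l^\omega=\int|\hat f(\xi)|e^{l\omega(|\xi|)}d\xi$. $\mathcal D^{(\omega)}(\Omega)$ is the set of continuous $f$ with compact support in $\Omega$ and $\|f\|_l^\omega<\infty$ for all $l>0$. $\mathcal E^{(\omega)}(\Omega)$ is the set of smooth $f:\Omega\to\mathbb C$ with $\psi f\in\mathcal D^{(\omega)}(\Omega)$ for all $\psi\in\mathcal D^{(\omega)}(\Omega)$; it is topologized by $\|f\|_{K,l}^\omega=\inf\{\|\psi f\|_l^\omega:\psi\in\mathcal D^{(\omega)}(\Omega),\ \psi=1\text{ on }K\}$, $K\subset\Omega$ compact, $l>0$ (equivalently, by the seminorms $f\mapsto\|\psi f\|_l^\omega$, $\psi\in\mathcal D^{(\omega)}(\Omega)$, $l>0$). $\mathcal G^{(\omega)}(\Omega)=\mathcal G^{(\omega)}[\mathcal E^{(\omega)}(\Omega)]$. ''Differential topological algebra'' means a topological algebra on which the partial derivatives, defined componentwise on representatives, are well-defined continuous derivations. *)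

(* Defs.v *)
From HB Require Import structures.
From mathcomp Require Import all_boot all_order all_algebra.
From mathcomp Require Import all_classical all_reals all_analysis.
From mathcomp Require Import complex.

Set Implicit Arguments.
Unset Strict Implicit.
Unset Printing Implicit Defensive.

Import Order.TTheory GRing.Theory Num.Theory.
Import numFieldNormedType.Exports.

Local Open Scope classical_set_scope.
Local Open Scope complex_scope.
Local Open Scope ring_scope.

(* Functions omega on [0, +oo[ are total functions R -> R of which only the
   values at nonnegative arguments are ever used. *)
Definition weight (R : realType) (omega : R -> R) : Prop :=
  [/\ (forall x, 0 <= x -> 0 <= omega x),
      (forall x y, 0 <= x -> x <= y -> omega x <= omega y),
      {within `[0, +oo[, continuous omega} &
      omega 0 = 0] /\
  [/\ (forall x y, 0 <= x -> 0 <= y -> omega (x + y) <= omega x + omega y),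
      (\int[lebesgue_measure]_(t in `[1%R, +oo[) (omega t / t ^+ 2)%:E < +oo)%E
    & omega t / ln (1 + t) @[t --> +oo] --> +oo].

Record ring_ops (T : Type) := RingOps {
  rzero : T; rone : T; ropp : T -> T; radd : T -> T -> T; rmul : T -> T -> T }.

Record module_ops (S T : Type) := ModuleOps {
  mzero : T; mopp : T -> T; madd : T -> T -> T; mscale : S -> T -> T }.

Definition topological_group (T : topologicalType)
    (zero : T) (opp : T -> T) (add : T -> T -> T) : Prop :=
  [/\ associative add, commutative add, left_id zero add,
      left_inverse zero opp add &
      continuous opp /\ continuous (fun p : T * T => add p.1 p.2)].

Definition topological_comring (T : topologicalType) (r : ring_ops T) : Prop :=
  topological_group (rzero r) (ropp r) (radd r) /\
  [/\ associative (rmul r), commutative (rmul r), left_id (rone r) (rmul r),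
      left_distributive (rmul r) (radd r) &
      continuous (fun p : T * T => rmul r p.1 p.2)].

Definition topological_module (S T : topologicalType)
    (r : ring_ops S) (m : module_ops S T) : Prop :=
  topological_group (mzero m) (mopp m) (madd m) /\
  [/\ (forall a b x, mscale m a (mscale m b x) = mscale m (rmul r a b) x),
      left_id (rone r) (mscale m),
      right_distributive (mscale m) (madd m),
      (forall a b x,
         mscale m (radd r a b) x = madd m (mscale m a x) (mscale m b x)) &
      continuous (fun p : S * T => mscale m p.1 p.2)].

(* Associative algebras, not necessarily unital. *)
Definition topological_algebra (S T : topologicalType)
    (r : ring_ops S) (m : module_ops S T) (mul : T -> T -> T) : Prop :=
  topological_module r m /\
  [/\ associative mul, left_distributive mul (madd m),
      right_distributive mul (madd m),
      (forall a x y, mscale m a (mul x y) = mul (mscale m a x) y /\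
                     mscale m a (mul x y) = mul x (mscale m a y)) &
      continuous (fun p : T * T => mul p.1 p.2)].

Definition is_unit_for (T : Type) (mul : T -> T -> T) (u : T) : Prop :=
  left_id u mul /\ right_id u mul.

Definition continuous_derivation (S T : topologicalType)
    (m : module_ops S T) (mul : T -> T -> T) (D : T -> T) : Prop :=
  [/\ {morph D : x y / madd m x y},
      (forall a, {morph D : x / mscale m a x}),
      (forall x y, D (mul x y) = madd m (mul (D x) y) (mul x (D y))) &
      continuous D].

Section Seminorms.
Variables (R : realType) (I : Type).

Definition seminorm (V : lmodType R[i]) (p : V -> R) : Prop :=
  (forall x y, p (x + y) <= p x + p y) /\
  (forall c x, p (c *: x) = Normc.normc c * p x).

Definition topologized_by (E : topologicalLmodType R[i]) (mu : I -> E -> R) :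
    Prop :=
  (forall i, seminorm (mu i)) /\
  (forall U : set E, nbhs 0 U <->
    exists (F : set I) (r : R), [/\ finite_set F, 0 < r &
      [set x | forall i, F i -> mu i x < r] `<=` U]).

End Seminorms.

Definition algebra_product (R : realType) (E : topologicalLmodType R[i])
    (mul : E -> E -> E) : Prop :=
  [/\ associative mul, left_distributive mul +%R,
      right_distributive mul +%R,
      (forall (a : R[i]) x y,
         a *: mul x y = mul (a *: x) y /\ a *: mul x y = mul x (a *: y)) &
      continuous (fun p : E * E => mul p.1 p.2)].

Definition unit_itv (R : realType) : Type := {e : R | 0 < e < 1}.

(* e --> 0+ in the open interval (0, 1) *)
Definition eps0 (R : realType) : set_system (unit_itv R) :=
  [set U | \forall e \near 0^'+, forall he : 0 < e < 1, U (exist _ e he)].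

#[global] Instance eps0_filter (R : realType) : Filter (@eps0 R).
Proof.
split=> [|P Q FP FQ|P Q PQ FP]; rewrite /eps0/=.
- exact: filterE.
- near=> e => he; split.
    by move: he; near: e; exact: FP.
  by move: he; near: e; exact: FQ.
- by near=> e => he; apply: PQ; move: he; near: e; exact: FP.
Unshelve. all: end_near. Qed.

Canonical eps0_filter_on (R : realType) := FilterType (@eps0 R) (eps0_filter R).

Arguments eps0 {R}.

Section Generalization.
Variables (R : realType) (omega : R -> R).
(* The space to be generalized is the subspace A of V, with the family mu. *)
Variables (V : lmodType R[i]) (A : set V) (I : Type) (mu : I -> V -> R).

Definition net : Type := unit_itv R -> V.

Definition growth (k : R) (e : unit_itv R) : R :=
  expR (k * omega (sval e)^-1).

Definition moderate (g : net) : Prop :=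
  (forall e, A (g e)) /\
  forall i, exists2 k : R, 0 < k &
    (fun e => mu i (g e)) =o_ eps0 (growth k).

Definition negligible (g : net) : Prop :=
  (forall e, A (g e)) /\
  forall i (k : R), 0 < k ->
    (fun e => mu i (g e)) =o_ eps0 (growth (- k)).

(* The elements of the quotient are the cosets of the negligible nets in the
   moderate ones. *)
Definition net_class (g : net) : set net :=
  [set h | moderate h /\ negligible (fun e => h e - g e)].

Definition generalization : Type :=
  {C : set net | exists2 g, moderate g & C = net_class g}.

Definition represents (g : net) (x : generalization) : Prop := sval x g.

(* The translate by x of {[u] : mu i u = o(exp (- l omega (1/e)))}, for
   p = (i, l). *)
Definition sharp_ball (p : I * R) (x : generalization) : set generalization :=
  [set y | exists g h, [/\ represents g x, represents h y &
    (fun e => mu p.1 (h e - g e)) =o_ eps0 (growth (- p.2))]].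

Definition sharp_index (F : set (I * R)) : Prop :=
  finite_set F /\ forall p, F p -> 0 < p.2.

Definition sharp_nbhs (x : generalization) (U : set generalization) : Prop :=
  exists2 F, sharp_index F & \bigcap_(p in F) sharp_ball p x `<=` U.

Definition sharp_open (U : set generalization) : Prop :=
  forall x, U x -> sharp_nbhs x U.

HB.instance Definition _ := gen_eqMixin generalization.
HB.instance Definition _ := gen_choiceMixin generalization.

Lemma sharp_openT : sharp_open setT.
Proof. by move=> x _; exists set0; split. Qed.

Lemma sharp_openI : setI_closed sharp_open.
Proof.
move=> U W oU oW x [/oU[F [finF F0] FU] /oW[G [finG G0] GW]].
exists (F `|` G).
  by split; [rewrite finite_setU|move=> p [/F0|/G0]].
by move=> y FGy; split; [apply: FU|apply: GW] => p ?;
  apply: FGy; [left|right].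
Qed.

Lemma sharp_open_bigU (J : Type) (f : J -> set generalization) :
  (forall j, sharp_open (f j)) -> sharp_open (\bigcup_j f j).
Proof.
move=> of_ x [j _ fjx]; have [F idF FU] := of_ j x fjx.
by exists F => // y /FU ?; exists j.
Qed.

HB.instance Definition _ := isOpenTopological.Build generalization
  sharp_openT sharp_openI sharp_open_bigU.

End Generalization.

Arguments represents {R omega V A I mu}.

(* The neighbourhoods of x in the topology whose open sets are the sharply open
   ones are indeed those generated by the sharp balls. *)
Definition sharp_neighbourhoods (R : realType) (omega : R -> R)
    (V : lmodType R[i]) (A : set V) (I : Type) (mu : I -> V -> R) : Prop :=
  forall (x : generalization omega A mu) U, nbhs x U <-> sharp_nbhs x U.

Definition generalized_constants (R : realType) (omega : R -> R) : Type :=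
  generalization omega [set: R[i]^o]
    (fun (_ : unit) (z : R[i]^o) => Normc.normc z).

HB.instance Definition _ R omega :=
  Topological.on (@generalized_constants R omega).

Section Componentwise.
Variables (R : realType) (omega : R -> R).
Local Notation Ct := (generalized_constants omega).

(* Since every class has a representative, these conditions determine the
   operations ; that operations satisfying them exist means that the
   componentwise operations are well defined on classes. *)
Definition componentwise_ring (r : ring_ops Ct) : Prop :=
  [/\ represents (fun=> 0) (rzero r), represents (fun=> 1) (rone r),
      (forall x g, represents g x -> represents (fun e => - g e) (ropp r x)),
      (forall x y g h, represents g x -> represents h y ->
         represents (fun e => g e + h e) (radd r x y)) &
      (forall x y g h, represents g x -> represents h y ->
         represents (fun e => g e * h e) (rmul r x y))].

Variables (V : lmodType R[i]) (A : set V) (I : Type) (mu : I -> V -> R).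
Local Notation G := (generalization omega A mu).

Definition componentwise_module (m : module_ops Ct G) : Prop :=
  [/\ represents (fun=> 0) (mzero m),
      (forall x g, represents g x -> represents (fun e => - g e) (mopp m x)),
      (forall x y g h, represents g x -> represents h y ->
         represents (fun e => g e + h e) (madd m x y)) &
      (forall a x c g, represents c a -> represents g x ->
         represents (fun e => (c e : R[i]) *: g e) (mscale m a x))].

Definition componentwise1 (f : V -> V) (D : G -> G) : Prop :=
  forall x g, represents g x -> represents (fun e => f (g e)) (D x).

Definition componentwise2 (f : V -> V -> V) (mul : G -> G -> G) : Prop :=
  forall x y g h, represents g x -> represents h y ->
    represents (fun e => f (g e) (h e)) (mul x y).

End Componentwise.

Section lebesgue_tuple.
Variable R : realType.
Local Notation RT := (measurableTypeR R).

Definition cons_pair n (p : RT * n.-tuple RT) : n.+1.-tuple RT :=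
  [the n.+1.-tuple RT of p.1 :: p.2].

Let uncons n (t : n.+1.-tuple RT) : RT * n.-tuple RT :=
  (tnth t ord0, [tuple of behead t]).

Let cons_pair_measurable n : measurable_fun setT (@cons_pair n).
Proof. exact: measurable_cons. Qed.

HB.instance Definition _ n :=
  isMeasurableFun.Build _ _ _ _ (@cons_pair n) (@cons_pair_measurable n).

Let uncons_measurable n : measurable_fun setT (@uncons n).
Proof.
apply/measurable_fun_pairP; split; first exact: measurable_tnth.
exact: measurable_behead.
Qed.

Let cons_pairK n : cancel (@cons_pair n) (@uncons n).
Proof.
by move=> [x t]; congr (_, _); apply/val_inj.
Qed.

Section step.
Variables (n : nat) (m : {sigma_finite_measure set (n.-tuple RT) -> \bar R}).

(* The image of the product measure under (x, t) |-> x :: t. *)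
Definition lebesgue_cons : set (n.+1.-tuple RT) -> \bar R :=
  pushforward (lebesgue_measure \x m)%E (@cons_pair n).

Let lebesgue_cons0 : lebesgue_cons set0 = 0%E.
Proof. exact: measure0. Qed.

Let lebesgue_cons_ge0 A : (0 <= lebesgue_cons A)%E.
Proof. exact: measure_ge0. Qed.

Let lebesgue_cons_sigma_additive : semi_sigma_additive lebesgue_cons.
Proof. exact: measure_semi_sigma_additive. Qed.

HB.instance Definition _ := isMeasure.Build _ _ _ lebesgue_cons
  lebesgue_cons0 lebesgue_cons_ge0 lebesgue_cons_sigma_additive.

Let sigma_finite_lebesgue_cons : sigma_finite setT lebesgue_cons.
Proof.
have /sigma_finiteP[F [TF ndF Foo]] := sigma_finiteT
  (lebesgue_measure : {sigma_finite_measure set RT -> \bar R}).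
have /sigma_finiteP[G [TG ndG Goo]] := sigma_finiteT m.
exists (fun k => @uncons n @^-1` (F k `*` G k)).
  rewrite -preimage_bigcup -[LHS](preimage_setT (@uncons n)); congr preimage.
  apply/seteqP; split=> // -[x t] _.
  have [i _ Fix] : (\bigcup_i F i) x by rewrite -TF.
  have [j _ Gjt] : (\bigcup_i G i) t by rewrite -TG.
  exists (maxn i j) => //; split.
    by move: Fix; exact/subsetPset/ndF/leq_maxl.
  by move: Gjt; exact/subsetPset/ndG/leq_maxr.
move=> k; have [mF Fk] := Foo k; have [mG Gk] := Goo k; split.
  rewrite -[X in measurable X]setTI.
  by apply: uncons_measurable => //; exact: measurableX.
rewrite /lebesgue_cons /pushforward -comp_preimage.
rewrite (_ : _ \o _ = id) ?preimage_id; last first.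
  by apply/funext => p; exact: cons_pairK.
by rewrite product_measure1E// lte_mul_pinfty// ge0_fin_numE.
Qed.

HB.instance Definition _ := Measure_isSigmaFinite.Build _ _ _ lebesgue_cons
  sigma_finite_lebesgue_cons.
End step.

Fixpoint lebesgue_tuple (d : nat) :
    {sigma_finite_measure set (d.-tuple RT) -> \bar R} :=
  match d with
  | 0%N => dirac ([tuple] : 0.-tuple RT)
  | n.+1 => lebesgue_cons (lebesgue_tuple n)
  end.

End lebesgue_tuple.

Section Beurling.
Variables (R : realType) (omega : R -> R) (d : nat).
Local Notation Rd := 'rV[R]_d.
Local Notation C := (R[i]^o).
Local Notation Cfun := (Rd -> C).

(* \int_(R^d) f(x) dx *)
Definition integral_Rd (f : Rd -> R) : R :=
  \int[lebesgue_tuple R d]_t f (\row_j tnth t j).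

Definition dot (x y : Rd) : R := \sum_j x 0 j * y 0 j.

(* Euclidean norm; the library norm of 'rV[R]_d is the sup norm. *)
Definition euclid (x : Rd) : R := Num.sqrt (dot x x).

Definition cis (t : R) : C := cos t +i* sin t.

(* Normalization : \int f(x) exp(- i <x, xi>) dx. *)
Definition fourier (f : Cfun) (xi : Rd) : C :=
  integral_Rd (fun x => complex.Re (f x * cis (- dot x xi))) +i*
  integral_Rd (fun x => complex.Im (f x * cis (- dot x xi))).

Definition weighted_norm (l : R) (f : Cfun) : \bar R :=
  (\int[lebesgue_tuple R d]_t
     (let xi := \row_j tnth t j in
      Normc.normc (fourier f xi) * expR (l * omega (euclid xi)))%:E)%E.

Definition Re_fun (f : Cfun) : Rd -> R := fun x => complex.Re (f x).
Definition Im_fun (f : Cfun) : Rd -> R := fun x => complex.Im (f x).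

Definition test_function (Omega : set Rd) : set Cfun :=
  [set f | [/\ continuous (Re_fun f) /\ continuous (Im_fun f),
               compact (closure [set x | f x != 0]),
               closure [set x | f x != 0] `<=` Omega &
               forall l : R, 0 < l -> (weighted_norm l f < +oo)%E]].

Definition partial (j : 'I_d) (u : Rd -> R) : Rd -> R :=
  fun x => 'D_(delta_mx 0 j) u x.

(* For Omega open: all the iterated partial derivatives exist and are
   continuous at every point of Omega. *)
Definition smooth_on (Omega : set Rd) (u : Rd -> R) : Prop :=
  forall (s : seq 'I_d) (x : Rd), Omega x ->
    {for x, continuous (foldr partial u s)} /\
    forall j : 'I_d, derivable (foldr partial u s) x (delta_mx 0 j).

Variable Omega : set Rd.

(* A function on Omega is represented by its extension by 0 to R^d. *)
Definition ultradiff : set Cfun :=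
  [set f | [/\ (forall x, ~ Omega x -> f x = 0),
               smooth_on Omega (Re_fun f) /\ smooth_on Omega (Im_fun f) &
               forall psi, test_function Omega psi ->
                 test_function Omega (fun x => psi x * f x)]].

(* The indices (K, l). *)
Definition ultradiff_index : Type :=
  {p : set Rd * R | [/\ compact p.1, p.1 `<=` Omega & 0 < p.2]}.

(* The infimum of an empty set is +oo, which fine sends to 0. *)
Definition ultradiff_norm (i : ultradiff_index) (f : Cfun) : R :=
  let (K, l) := sval i in
  fine (ereal_inf [set weighted_norm l (fun x => psi x * f x) |
    psi in [set psi | test_function Omega psi /\
                      forall x, K x -> psi x = 1]]).

Definition generalized_ultradiff : Type :=
  generalization omega ultradiff ultradiff_norm.

Definition cmul (f g : Cfun) : Cfun := fun x => f x * g x.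

Definition cpartial (j : 'I_d) (f : Cfun) : Cfun :=
  fun x => if x \in Omega then partial j (Re_fun f) x +i* partial j (Im_fun f) x
           else 0.

End Beurling.

(* Main.v *)
From HB Require Import structures.
Require Import Defs.
From mathcomp Require Import all_boot all_order all_algebra.
From mathcomp Require Import all_classical all_reals all_analysis.
From mathcomp Require Import complex.
From mathcomp Require Import measurable_realfun ring lra.

(** A net only enters the quotient through the growth of its seminorms, measured
    by exp (k omega (1 / e)).  A map of two variables therefore descends to
    classes, and is jointly continuous there, as soon as it preserves moderate
    nets and the growth of its increments is controlled by finitely many
    seminorms of the increments of its arguments ([lift2]).  This holds for
    the addition by the triangle inequality, and for every bilinear map b with
    mu_i (b x y) <= C (\sum_j mu_j x) (\sum_k mu_k y), because
    b (x + u) (y + v) - b x y = b u v + b u y + b x v is a sum of products of a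
    small net and a moderate one ([lift_bilinear]).  The multiplication by
    generalized constants, the products and the maps (c, x) |-> c D x, with D a
    derivation, are all of the second kind; the algebraic identities hold on
    classes because they hold on representatives.  In a topological algebra the
    bound on the product is continuity at the origin, made homogeneous
    ([algebra_product_bound]).

    For the ultradifferentiable functions the seminorm |f|_(K, l) is an infimum
    of weighted norms |psi f|_l over cutoff functions psi of K.  Such an infimum
    is not visibly subadditive, and the abstract part only requires that a sum
    be controlled by some other seminorm of the family.  If psi is a cutoff of
    K then |f|_(K, l) <= |psi f|_l; conversely |psi f|_l <= C |f|_(supp psi, l),
    because psi f = psi (chi f) for every cutoff chi of supp psi and the norm
    |.|_l is submultiplicative up to a constant ([cutoff_norm]).  The triangle
    inequality, the bound on products (psi f g = (psi f) (chi g)) and the bound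
    on derivatives (psi D f = D (psi f) - (D psi) f) follow.

    The norm |.|_l is submultiplicative because the transform of a product is a
    multiple of the convolution of the transforms, while subadditivity of omega
    makes exp (l omega) submultiplicative ([wnorm_mul]).  A derivative of a test
    function f has transform i xi_j times the one of f, and |xi_j| is at most a
    multiple of exp (omega |xi|), since omega dominates the logarithm
    ([wnorm_dtest]).  Both facts rest on the Fourier inversion formula, proved
    for bounded continuous integrable functions with integrable transforms by
    inserting a dilated Laplace density, whose transform is a product of Cauchy
    densities ([fourier_inversion]).

    It remains that the compact sets involved have cutoffs.  If a nonempty K
    has one, then there is a nonzero test function, from which cutoffs of all
    compact subsets of Omega are built by modulation, convolution with the
    indicator of a cube, contraction, translation and finite union
    ([exists_cutoff]).  If K has no cutoff, or is empty, then |.|_(K, l)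
    vanishes identically and all its bounds are trivial
    ([unorm_dichotomy]). *)

Set Implicit Arguments.
Unset Strict Implicit.
Unset Printing Implicit Defensive.

Import Order.TTheory GRing.Theory Num.Theory.
Import numFieldNormedType.Exports.

Local Open Scope classical_set_scope.
Local Open Scope complex_scope.
Local Open Scope ring_scope.

(** * Complex numbers *)

Section ComplexNumbers.
Variable R : realType.
Implicit Types z w : R[i].
Local Notation normc := (@Normc.normc R).
Local Notation Re := (@complex.Re R).
Local Notation Im := (@complex.Im R).

Lemma Re_mul z w : Re (z * w) = Re z * Re w - Im z * Im w.
Proof. by case: z => a b; case: w. Qed.
Lemma Im_mul z w : Im (z * w) = Re z * Im w + Im z * Re w.
Proof. by case: z => a b; case: w => c d /=; rewrite [b * c]mulrC. Qed.
Lemma Re_add z w : Re (z + w) = Re z + Re w.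
Proof. by case: z => a b; case: w. Qed.
Lemma Im_add z w : Im (z + w) = Im z + Im w.
Proof. by case: z => a b; case: w. Qed.
Lemma Re_opp z : Re (- z) = - Re z. Proof. by case: z. Qed.
Lemma Im_opp z : Im (- z) = - Im z. Proof. by case: z. Qed.

(** Computes the real and imaginary parts of ring expressions, so that identities
    of complex numbers become pairs of real ones. *)
Definition ReIm_simp := (Re_mul, Im_mul, Re_add, Im_add, Re_opp, Im_opp).

Lemma complex_eqP z w : Re z = Re w -> Im z = Im w -> z = w.
Proof. by case: z => a b; case: w => c d /= -> ->. Qed.

Lemma normcE2 z : normc z = Num.sqrt (Re z ^+ 2 + Im z ^+ 2).
Proof. by case: z. Qed.
Lemma normc_ge0 z : 0 <= normc z.
Proof. by rewrite normcE2 sqrtr_ge0. Qed.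
Lemma normcRe z : `|Re z| <= normc z.
Proof. by rewrite normcE2 -sqrtr_sqr ler_wsqrtr// lerDl sqr_ge0. Qed.
Lemma normcIm z : `|Im z| <= normc z.
Proof. by rewrite normcE2 -sqrtr_sqr ler_wsqrtr// lerDr sqr_ge0. Qed.
Lemma normc_le_ReIm z : normc z <= `|Re z| + `|Im z|.
Proof.
rewrite normcE2 -[leRHS]ger0_norm ?addr_ge0// -sqrtr_sqr ler_wsqrtr//.
rewrite -(real_normK (num_real (Re z))) -(real_normK (num_real (Im z))).
by rewrite sqrrD lerD2r lerDl mulrn_wge0// mulr_ge0.
Qed.
Lemma normc_real (a : R) : normc a%:C = `|a|.
Proof. by rewrite normcE2 /= expr0n addr0 sqrtr_sqr. Qed.
Lemma normcD z w : normc (z + w) <= normc z + normc w.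
Proof. exact: le_normcD. Qed.
Lemma normc_opp z : normc (- z) = normc z.
Proof. exact: normcN. Qed.
Lemma normcB z w : normc (z - w) <= normc z + normc w.
Proof. by rewrite -[normc w]normc_opp normcD. Qed.
Lemma normc_0 : normc 0 = 0. Proof. exact: Normc.normc0. Qed.
Lemma normc_1 : normc 1 = 1. Proof. exact: Normc.normc1. Qed.
Lemma normc_mul z w : normc (z * w) = normc z * normc w.
Proof. exact: Normc.normcM. Qed.

Lemma cisD (a b : R) : cis (a + b) = cis a * cis b :> R[i].
Proof.
by apply: complex_eqP; rewrite !ReIm_simp /= ?cosD ?sinD//; ring.
Qed.
Lemma cis0 : cis (0 : R) = 1 :> R[i].
Proof. by rewrite /cis cos0 sin0. Qed.
Lemma normc_cis (a : R) : normc (cis a) = 1.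
Proof. by rewrite normcE2 /= cos2Dsin2 sqrtr1. Qed.

End ComplexNumbers.

(** * Integrals of complex-valued functions *)

Section ComplexIntegral.
Variable R : realType.
Context dT (T : measurableType dT).
Variable mu : {measure set T -> \bar R}.
Local Notation normc := (@Normc.normc R).
Local Notation Re := (@complex.Re R).
Local Notation Im := (@complex.Im R).
Implicit Types F G : T -> R[i].

Definition cmeas F :=
  measurable_fun setT (fun x => Re (F x)) /\
  measurable_fun setT (fun x => Im (F x)).

Definition L1 F := cmeas F /\ (\int[mu]_x (normc (F x))%:E < +oo)%E.

(** Defined componentwise, so that [fourier] is an instance by conversion. *)
Definition Cint F : R[i] :=
  (\int[mu]_x Re (F x)) +i* (\int[mu]_x Im (F x)).

Lemma cmeas_cst c : cmeas (fun=> c).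
Proof. by split; exact: measurable_cst. Qed.
Lemma cmeasD F G : cmeas F -> cmeas G -> cmeas (fun x => F x + G x).
Proof.
move=> [rF iF] [rG iG]; split.
  by under eq_fun do rewrite Re_add; exact: measurable_funD.
by under eq_fun do rewrite Im_add; exact: measurable_funD.
Qed.
Lemma cmeasM F G : cmeas F -> cmeas G -> cmeas (fun x => F x * G x).
Proof.
move=> [rF iF] [rG iG]; split.
  by under eq_fun do rewrite Re_mul; apply: measurable_funB; exact: measurable_funM.
by under eq_fun do rewrite Im_mul; apply: measurable_funD; exact: measurable_funM.
Qed.
Lemma cmeas_real (f : T -> R) : measurable_fun setT f -> cmeas (fun x => (f x)%:C).
Proof. by move=> mf; split=> //=; exact: measurable_cst. Qed.
Lemma cmeas_cis (f : T -> R) : measurable_fun setT f -> cmeas (fun x => cis (f x)).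
Proof.
by move=> mf; split=> /=; apply: measurableT_comp mf;
  apply: continuous_measurable_fun; [exact: continuous_cos|exact: continuous_sin].
Qed.

Lemma measurable_normc F : cmeas F -> measurable_fun setT (fun x => normc (F x)).
Proof.
move=> [rF iF]; under eq_fun do rewrite normcE2.
apply: (@measurableT_comp _ _ _ _ _ _ (@Num.sqrt R)).
  by apply: continuous_measurable_fun; exact: sqrt_continuous.
by apply: measurable_funD; exact: measurable_funX.
Qed.
Lemma measurable_normcE F : cmeas F ->
  measurable_fun setT (fun x => (normc (F x))%:E).
Proof. by move=> mF; apply/measurable_EFinP; exact: measurable_normc. Qed.

Lemma integrable_dom (f g : T -> R) : measurable_fun setT f ->
  mu.-integrable setT (EFin \o g) -> (forall x, `|f x| <= g x) ->
  mu.-integrable setT (EFin \o f).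
Proof.
move=> mf ig fg; apply: le_integrable ig => //; first exact/measurable_EFinP.
by move=> x _ /=; rewrite lee_fin (le_trans (fg x))// ler_norm.
Qed.

Lemma integrableZR (f : T -> R) r : mu.-integrable setT (EFin \o f) ->
  mu.-integrable setT (EFin \o (fun x => r * f x)).
Proof.
move=> fi; rewrite (_ : _ \o _ = (fun x => r%:E * (EFin \o f) x)%E)//.
exact: integrableZl.
Qed.

Lemma L1_normc F : L1 F -> mu.-integrable setT (fun x => (normc (F x))%:E).
Proof.
move=> [mF FX]; apply/integrableP; split; first exact: measurable_normcE.
by under eq_integral do rewrite /= ger0_norm ?normc_ge0//.
Qed.
Lemma L1_Re F : L1 F -> mu.-integrable setT (EFin \o (fun x => Re (F x))).
Proof.
move=> lF; apply: integrable_dom (L1_normc lF) _; first by case: lF => -[].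
by move=> x; exact: normcRe.
Qed.
Lemma L1_Im F : L1 F -> mu.-integrable setT (EFin \o (fun x => Im (F x))).
Proof.
move=> lF; apply: integrable_dom (L1_normc lF) _; first by case: lF => -[].
by move=> x; exact: normcIm.
Qed.

Lemma L1_dom F (g : T -> R) : cmeas F -> mu.-integrable setT (EFin \o g) ->
  (forall x, normc (F x) <= g x) -> L1 F.
Proof.
move=> mF ig Fg; split=> //.
have : mu.-integrable setT (EFin \o (fun x => normc (F x))).
  apply: integrable_dom ig _; first exact: measurable_normc.
  by move=> x; rewrite ger0_norm ?normc_ge0.
move=> /integrableP[_].
by under eq_integral do rewrite /= ger0_norm ?normc_ge0//.
Qed.

Lemma L1_mulb F G M : L1 F -> cmeas G -> (forall x, normc (G x) <= M) ->
  L1 (fun x => F x * G x).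
Proof.
move=> lF mG GM; apply: (@L1_dom _ (fun x => M * normc (F x))).
- by apply: cmeasM => //; case: lF.
- by apply: integrableZR; exact: L1_normc.
- by move=> x; rewrite normc_mul mulrC ler_wpM2r ?normc_ge0.
Qed.
Lemma L1_mulbl F G M : L1 F -> cmeas G -> (forall x, normc (G x) <= M) ->
  L1 (fun x => G x * F x).
Proof.
by move=> lF mG GM; under eq_fun do rewrite mulrC; exact: L1_mulb lF mG GM.
Qed.
Lemma L1Z F c : L1 F -> L1 (fun x => c * F x).
Proof. by move=> lF; apply: (L1_mulbl lF (cmeas_cst c)) => x; exact: lexx. Qed.
Lemma L1D F G : L1 F -> L1 G -> L1 (fun x => F x + G x).
Proof.
move=> lF lG; apply: (@L1_dom _ (fun x => normc (F x) + normc (G x))).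
- by apply: cmeasD; [case: lF|case: lG].
- rewrite (_ : _ \o _ = (fun x => (normc (F x))%:E + (normc (G x))%:E)%E)//.
  by apply: integrableD => //; exact: L1_normc.
- by move=> x; exact: normcD.
Qed.

Lemma L1_real (f : T -> R) : mu.-integrable setT (EFin \o f) ->
  L1 (fun x => (f x)%:C).
Proof.
move=> /[dup] fi /integrableP[mf foo]; split.
  by apply: cmeas_real; exact/measurable_EFinP.
by under eq_integral do rewrite normc_real.
Qed.

Lemma CintD F G : L1 F -> L1 G -> Cint (fun x => F x + G x) = Cint F + Cint G.
Proof.
move=> lF lG; rewrite /Cint; apply: complex_eqP => /=; rewrite -RintegralD//.
- by apply: eq_Rintegral => x _; rewrite Re_add.
- exact: L1_Re.
- exact: L1_Re.
- by apply: eq_Rintegral => x _; rewrite Im_add.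
- exact: L1_Im.
- exact: L1_Im.
Qed.
Lemma CintZ F c : L1 F -> Cint (fun x => c * F x) = c * Cint F.
Proof.
move=> lF; have lr := L1_Re lF; have li := L1_Im lF.
rewrite /Cint; apply: complex_eqP; rewrite !ReIm_simp /=.
  under eq_Rintegral do rewrite Re_mul.
  by rewrite RintegralB// ?RintegralZl//; exact: integrableZR.
under eq_Rintegral do rewrite Im_mul.
by rewrite RintegralD// ?RintegralZl//; exact: integrableZR.
Qed.
Lemma CintZr F c : L1 F -> Cint (fun x => F x * c) = Cint F * c.
Proof.
by move=> lF; rewrite mulrC -CintZ//; congr Cint; apply/funext => x; rewrite mulrC.
Qed.
Lemma CintB F G : L1 F -> L1 G -> Cint (fun x => F x - G x) = Cint F - Cint G.
Proof.
move=> lF lG; rewrite -mulN1r -CintZ// -CintD//; last exact: L1Z.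
by congr Cint; apply/funext => x; rewrite mulN1r.
Qed.
Lemma Cint_real (f : T -> R) : Cint (fun x => (f x)%:C) = (\int[mu]_x f x)%:C.
Proof. by rewrite /Cint /= Rintegral_cst ?mul0r. Qed.

Lemma eq_Cint F G : F =1 G -> Cint F = Cint G.
Proof. by move=> /funext ->. Qed.

(** Rotating the integral to the positive real axis reduces the estimate to
    real parts. *)
Lemma normc_Cint F : L1 F -> normc (Cint F) <= \int[mu]_x normc (F x).
Proof.
move=> lF; have [-> |I0] := eqVneq (Cint F) 0.
  by rewrite normc_0 Rintegral_ge0// => x _; exact: normc_ge0.
have n0 : 0 < normc (Cint F).
  rewrite lt_neqAle normc_ge0 andbT eq_sym; apply/eqP => /Normc.eq0_normc.
  exact/eqP.
pose u : R[i] := (normc (Cint F))%:C / Cint F.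
have u1 : normc u = 1.
  by rewrite normc_mul Normc.normcV normc_real ger0_norm ?normc_ge0// divff// gt_eqF.
have uI : u * Cint F = (normc (Cint F))%:C by rewrite /u mulfVK.
rewrite -CintZ// in uI.
have luF := L1Z u lF.
have -> : normc (Cint F) = \int[mu]_x Re (u * F x).
  by rewrite -[LHS]/(Re (normc (Cint F))%:C) -uI.
apply: le_Rintegral => //; first exact: L1_Re.
  exact: L1_normc.
move=> x _; rewrite -[leRHS]mul1r -u1 -normc_mul.
by rewrite (le_trans _ (normcRe _))// ler_norm.
Qed.

Lemma normc_CintE F : L1 F -> ((normc (Cint F))%:E <= \int[mu]_x (normc (F x))%:E)%E.
Proof.
move=> lF; apply: (@le_trans _ _ (\int[mu]_x normc (F x))%:E).
  by rewrite lee_fin; exact: normc_Cint.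
rewrite fineK//; have /integrableP[_ h] := L1_normc lF.
by rewrite ge0_fin_numE; [case: lF|apply: integral_ge0 => x _; rewrite lee_fin normc_ge0].
Qed.

(** Dominated convergence, stated with a modulus that tends to 0 so that no
    topology on the complex numbers is involved. *)
Lemma Cint_dominated (F_ : nat -> T -> R[i]) F (g : T -> R) :
  (forall n, cmeas (F_ n)) -> cmeas F ->
  (forall x, normc (F_ n x - F x) @[n --> \oo] --> (0 : R)) ->
  mu.-integrable setT (EFin \o g) ->
  (forall n x, normc (F_ n x) <= g x) -> (forall x, normc (F x) <= g x) ->
  normc (Cint (F_ n) - Cint F) @[n --> \oo] --> (0 : R).
Proof.
move=> mF_ mF cF ig F_g Fg.
have lF_ n : L1 (F_ n) by apply: L1_dom ig _.
have lF : L1 F by apply: L1_dom ig _.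
have lB n : L1 (fun x => F_ n x - F x).
  rewrite (_ : (fun _ => _) = (fun x => F_ n x + -1 * F x)).
    by apply: L1D => //; exact: L1Z.
  by apply/funext => x; rewrite mulN1r.
have [] := @dominated_convergence _ T R mu setT measurableT
  (fun n x => (normc (F_ n x - F x))%:E) (cst 0%E) (fun x => (2 * g x)%:E).
- by move=> n; apply: measurable_normcE; case: (lB n).
- exact: measurable_cst.
- by apply: aeW => x _ /=; apply/cvg_EFin; [exact: nearW|exact: cF].
- by rewrite (_ : (fun _ => _) = (fun x => 2%:E * (g x)%:E)%E)//; exact: integrableZl.
- apply: aeW => x n _ /=; rewrite lee_fin ger0_norm ?normc_ge0//.
  by rewrite (le_trans (normcB _ _))// mulr_natl mulr2n lerD.
move=> _ _; rewrite integral0 => /fine_cvgP[_].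
move=> h; apply: (squeeze_cvgr _ (cvg_cst 0) h); apply: nearW => n.
by apply/andP; split; [exact: normc_ge0|rewrite -CintB//; exact: normc_Cint].
Qed.

End ComplexIntegral.

Section ComplexFubini.
Variable R : realType.
Context d1 d2 (T1 : measurableType d1) (T2 : measurableType d2).
Variables (m1 : {sigma_finite_measure set T1 -> \bar R})
          (m2 : {sigma_finite_measure set T2 -> \bar R}).

Let fubini1 (f : T1 * T2 -> R) : (m1 \x m2)%E.-integrable setT (EFin \o f) ->
  \int[m1]_x (\int[m2]_y f (x, y)) = \int[(m1 \x m2)%E]_z f z.
Proof.
move=> fi; rewrite /Rintegral -(integral12_prod_meas1 fi); congr fine.
have mF := measurable_fubini_F fi.
apply: ae_eq_integral => //.
  by apply/measurable_EFinP; exact: (measurableT_comp _ mF).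
apply: filterS (ae_integrable1 fi) => x ix _ /=.
by rewrite fineK//; exact: integrable_fin_num ix.
Qed.

Let fubini2 (f : T1 * T2 -> R) : (m1 \x m2)%E.-integrable setT (EFin \o f) ->
  \int[m2]_y (\int[m1]_x f (x, y)) = \int[(m1 \x m2)%E]_z f z.
Proof.
move=> fi; rewrite /Rintegral -(integral21_prod_meas1 fi); congr fine.
have mF := measurable_fubini_G fi.
apply: ae_eq_integral => //.
  by apply/measurable_EFinP; exact: (measurableT_comp _ mF).
apply: filterS (ae_integrable2 fi) => x ix _ /=.
by rewrite fineK//; exact: integrable_fin_num ix.
Qed.

Variable F : T1 * T2 -> R[i].
Hypothesis lF : L1 (m1 \x m2)%E F.

Lemma Cint_fubini1 :
  Cint m1 (fun x => Cint m2 (fun y => F (x, y))) = Cint (m1 \x m2)%E F.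
Proof.
apply: complex_eqP => /=.
  exact: fubini1 (L1_Re lF).
exact: fubini1 (L1_Im lF).
Qed.

Lemma Cint_fubini2 :
  Cint m2 (fun y => Cint m1 (fun x => F (x, y))) = Cint (m1 \x m2)%E F.
Proof.
apply: complex_eqP => /=.
  exact: fubini2 (L1_Re lF).
exact: fubini2 (L1_Im lF).
Qed.

Lemma Cint_fubini : Cint m1 (fun x => Cint m2 (fun y => F (x, y))) =
  Cint m2 (fun y => Cint m1 (fun x => F (x, y))).
Proof. by rewrite Cint_fubini1 Cint_fubini2. Qed.

Lemma cmeas_Cint1 : cmeas (fun x => Cint m2 (fun y => F (x, y))).
Proof.
have mR := measurable_fubini_F (L1_Re lF).
have mI := measurable_fubini_F (L1_Im lF).
by split => /=; [exact: (measurableT_comp _ mR)|exact: (measurableT_comp _ mI)].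
Qed.

Lemma cmeas_Cint2 : cmeas (fun y => Cint m1 (fun x => F (x, y))).
Proof.
have mR := measurable_fubini_G (L1_Re lF).
have mI := measurable_fubini_G (L1_Im lF).
by split => /=; [exact: (measurableT_comp _ mR)|exact: (measurableT_comp _ mI)].
Qed.

End ComplexFubini.

(** Tonelli gives the integrability that Fubini requires. *)
Lemma L1_tonelli (R : realType) d1 d2 (T1 : measurableType d1)
    (T2 : measurableType d2) (m1 : {sigma_finite_measure set T1 -> \bar R})
    (m2 : {sigma_finite_measure set T2 -> \bar R}) (F : T1 * T2 -> R[i]) :
  cmeas F ->
  (\int[m1]_x \int[m2]_y (Normc.normc (F (x, y)))%:E < +oo)%E ->
  L1 (m1 \x m2)%E F.
Proof.
move=> mF foo; split=> //; rewrite fubini_tonelli1//.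
  exact: measurable_normcE.
by move=> z; rewrite lee_fin normc_ge0.
Qed.

Lemma cmeas_comp (R : realType) dS dT (S : measurableType dS) (T : measurableType dT)
    (F : T -> R[i]) (f : S -> T) :
  cmeas F -> measurable_fun setT f -> cmeas (fun x => F (f x)).
Proof.
move=> [mR mI] mf; split; first exact: (measurableT_comp mR mf).
exact: (measurableT_comp mI mf).
Qed.

(** The form in which Fubini is applied below: an oscillating or bounded factor
    times a product of integrable functions of one variable each. *)
Lemma L1_tensor (R : realType) d1 d2 (T1 : measurableType d1)
    (T2 : measurableType d2) (m1 : {sigma_finite_measure set T1 -> \bar R})
    (m2 : {sigma_finite_measure set T2 -> \bar R})
    (F : T1 -> R[i]) (G : T2 -> R[i]) (H : T1 * T2 -> R[i]) (M : R) :
  L1 m1 F -> L1 m2 G -> cmeas H -> 0 <= M -> (forall z, Normc.normc (H z) <= M) ->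
  L1 (m1 \x m2)%E (fun z => F z.1 * G z.2 * H z).
Proof.
move=> [mF Foo] [mG Goo] mH M0 HM.
have mFG : cmeas (fun z : T1 * T2 => F z.1 * G z.2).
  apply: cmeasM; first exact: (cmeas_comp mF measurable_fst).
  exact: (cmeas_comp mG measurable_snd).
suff lFG : L1 (m1 \x m2)%E (fun z : T1 * T2 => F z.1 * G z.2).
  exact: (L1_mulb lFG mH HM).
apply: L1_tonelli => //.
pose g := (\int[m2]_y (Normc.normc (G y))%:E)%E.
have g0 : (0 <= g)%E by apply: integral_ge0 => y _; rewrite lee_fin normc_ge0.
have gf : g \is a fin_num by rewrite ge0_fin_numE.
have E t : (\int[m2]_y (Normc.normc (F t * G y))%:E = (Normc.normc (F t))%:E * g)%E.
  rewrite -ge0_integralZl//.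
  - by apply: eq_integral => y _; rewrite normc_mul EFinM.
  - exact: measurable_normcE.
  - by move=> y _; rewrite lee_fin normc_ge0.
  - by rewrite lee_fin normc_ge0.
rewrite /= (eq_integral (fun t => (Normc.normc (F t))%:E * g)%E); last by move=> t _; rewrite E.
rewrite ge0_integralZr//.
- by rewrite muleC lte_mul_pinfty.
- exact: measurable_normcE.
- by move=> t _; rewrite lee_fin normc_ge0.
Qed.

Lemma integrableDR (R : realType) dT (T : measurableType dT)
    (mu : {measure set T -> \bar R}) (f g : T -> R) :
  mu.-integrable setT (EFin \o f) -> mu.-integrable setT (EFin \o g) ->
  mu.-integrable setT (EFin \o (fun x => f x + g x)).
Proof.
move=> fi gi; rewrite (_ : _ \o _ = (EFin \o f) \+ (EFin \o g))%E//.
exact: integrableD.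
Qed.

Lemma L1_Cint1 (R : realType) d1 d2 (T1 : measurableType d1)
    (T2 : measurableType d2) (m1 : {sigma_finite_measure set T1 -> \bar R})
    (m2 : {sigma_finite_measure set T2 -> \bar R}) (F : T1 * T2 -> R[i]) :
  L1 (m1 \x m2)%E F -> L1 m1 (fun x => Cint m2 (fun y => F (x, y))).
Proof.
move=> lF; have [mR mI] := cmeas_Cint1 lF.
have I (f : T1 * T2 -> R) : (m1 \x m2)%E.-integrable setT (EFin \o f) ->
    measurable_fun setT (fun x => \int[m2]_y f (x, y)) ->
    m1.-integrable setT (EFin \o (fun x => `|\int[m2]_y f (x, y)|)).
  move=> fi mf; have := integrable_fubini_F fi.
  apply: le_integrable => //; first by apply/measurable_EFinP; exact: measurableT_comp.
  move=> x _ /=; rewrite /Rintegral /fubini_F; set z := (\int[m2]_y _)%E.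
  by case: z => [r| |] /=; rewrite ?leey// lee_fin !normr_id.
apply: (L1_dom (g := fun x => `|complex.Re (Cint m2 (fun y => F (x, y)))| +
    `|complex.Im (Cint m2 (fun y => F (x, y)))|)).
- by [].
- apply: integrableDR.
    exact: (I _ (L1_Re lF)).
  exact: (I _ (L1_Im lF)).
- by move=> x; exact: normc_le_ReIm.
Qed.

(** * Lebesgue measure on tuples *)

Section TupleMeasurability.
Variables (R : realType) (d : nat).
Local Notation RT := (measurableTypeR R).
Local Notation Td := (d.-tuple RT).
Local Notation Rd := 'rV[R]_d.

Definition rowt (t : Td) : Rd := \row_j tnth t j.

(** The inverse of [rowt]; affine changes of variables of tuples are written
    through row vectors, where they are linear combinations. *)
Definition trow (x : Rd) : Td := [tuple x 0 j | j < d].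

Lemma trowK : cancel trow rowt.
Proof. by move=> x; apply/rowP => j; rewrite mxE tnth_mktuple. Qed.
Lemma rowtE t j : rowt t 0 j = tnth t j. Proof. by rewrite mxE. Qed.

Lemma rV_ballP (x y : Rd) e : 0 < e ->
  ball x e y <-> forall j, `|x 0 j - y 0 j| < e.
Proof.
move=> e0; split=> [[_ h] j|h]; first exact: h.
by split=> // i j; rewrite ord1; exact: h.
Qed.

Lemma coord_le_norm (x : Rd) j : `|x 0 j| <= `|x|.
Proof.
rewrite [leRHS]/Num.Def.normr /= mx_normrE.
by apply/bigmax_geP; right; exists (ord0, j).
Qed.

Lemma rV_norm_le (x : Rd) e : 0 <= e -> (forall j, `|x 0 j| <= e) -> `|x| <= e.
Proof.
move=> e0 h; rewrite [leLHS]/Num.Def.normr /= mx_normrE.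
by apply/bigmax_leP; split=> // -[i j] _ /=; rewrite ord1.
Qed.

(** An open set is the union of the rational cubes that it contains. *)
Lemma measurable_rowt_open (U : set Rd) : open U -> measurable (rowt @^-1` U).
Proof.
move=> oU.
pose c (p : {ffun 'I_d -> int} * nat) : Rd := \row_j ((p.1 j)%:~R / p.2.+1%:R).
pose B p : set Td := [set t | forall j, `|c p 0 j - tnth t j| < p.2.+1%:R^-1].
pose F (p : {ffun 'I_d -> int} * nat) : set Td :=
  if `[< ball (c p) p.2.+1%:R^-1 `<=` U >] then B p else set0.
suff -> : rowt @^-1` U = \bigcup_p F p.
  apply: countable_bigcupT_measurable.
    exact: countableP.
  move=> p; rewrite /F; case: asboolP => // _.
  have -> : B p = \bigcap_(j in [set: 'I_d])
      ((fun t : Td => tnth t j) @^-1`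
        [set y | `|c p 0 j - y| < p.2.+1%:R^-1]).
    by apply/seteqP; split=> t h j; [move=> _|]; exact: h.
  apply: fin_bigcap_measurable => // j _.
  rewrite -[X in measurable X]setTI; apply: measurable_tnth => //.
  exact: (measurable_ball (c p 0 j) p.2.+1%:R^-1).
apply/seteqP; split=> [t Ut|t [p _]]; last first.
  rewrite /F; case: asboolP => // sU Bt; apply: sU.
  by apply/rV_ballP => // j; rewrite rowtE; exact: Bt.
have /nbhs_ballP[e /= e0 sU] := open_nbhs_nbhs (conj oU Ut).
have [n n2] : exists n : nat, n.+1%:R^-1 < e / 2.
  have [n _ /(_ n (leqnn n))] : \forall n \near \oo, n.+1%:R^-1 < e / 2.
    by apply: near_infty_natSinv_lt (PosNum _); rewrite divr_gt0.
  by exists n.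
pose p : {ffun 'I_d -> int} * nat :=
  ([ffun j => Num.floor (n.+1%:R * tnth t j)], n).
have n0 : 0 < n.+1%:R :> R by [].
have cp j : `|c p 0 j - tnth t j| < n.+1%:R^-1.
  rewrite mxE ffunE -(ltr_pM2l n0) mulfV ?gt_eqF// -{1}(gtr0_norm n0) -normrM.
  rewrite mulrBr mulrCA mulfV ?gt_eqF// mulr1 distrC ger0_norm.
    rewrite ltrBlDl; have := floorD1_gt (n.+1%:R * tnth t j).
    by rewrite intrD.
  by rewrite subr_ge0 floor_le.
exists p => //; rewrite /F; case: asboolP => [_ j|]; first exact: cp.
case=> y /rV_ballP-/(_ _) h; apply: sU; apply/rV_ballP => // j.
rewrite rowtE (splitr e) -(subrKA (c p 0 j)).
rewrite (le_lt_trans (ler_normD _ _))// ltrD//.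
  by rewrite distrC (lt_trans (cp j)).
by rewrite (lt_trans _ n2)//; apply: h.
Qed.

(** Borel measurability for the product topology of row vectors, while tuples
    carry the product sigma-algebra: [measurable_rowt_open] is where the two
    meet. *)
Lemma measurable_rowt (f : Rd -> R) : continuous f ->
  measurable_fun setT (fun t => f (rowt t)).
Proof.
move=> /continuousP cf.
apply: (measurability _ (RGenOpens.measurableE R)).
move=> _ [_ [a [b ->]] <-]; rewrite setTI.
apply: (@measurable_rowt_open (f @^-1` `]a, b[%classic)).
by apply: cf; exact: interval_open.
Qed.

End TupleMeasurability.

Section ConsIntegral.
Variable R : realType.
Local Notation RT := (measurableTypeR R).
Local Notation leb := (@lebesgue_measure R).
Local Notation mu d := (lebesgue_tuple R d).

Lemma measurable_cons_pair n : measurable_fun setT (@cons_pair R n).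
Proof. exact: measurable_cons. Qed.

Lemma integral_tuple_cons n (f : n.+1.-tuple RT -> \bar R) :
  measurable_fun setT f -> (forall t, 0 <= f t)%E ->
  (\int[mu n.+1]_t f t = \int[leb]_x \int[mu n]_t f (cons_pair (x, t)))%E.
Proof.
move=> mf f0.
transitivity (\int[pushforward (leb \x mu n)%E (@cons_pair R n)]_t f t)%E.
  by apply: eq_measure_integral.
rewrite ge0_integral_pushforward//=.
- rewrite preimage_setT fubini_tonelli1//=.
    exact: measurableT_comp mf (@measurable_cons_pair n).
Qed.

Lemma integral_tuple0 (f : 0.-tuple RT -> \bar R) :
  (\int[mu 0]_t f t = f [tuple])%E.
Proof.
rewrite (_ : mu 0 = dirac ([tuple] : 0.-tuple RT) :> (set _ -> \bar R))//.
rewrite (_ : f = cst (f [tuple])); last by apply/funext => t; rewrite (tuple0 t).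
by rewrite integral_dirac// diracT mul1e.
Qed.

(** Uniqueness of Lebesgue measure: a multiple of its image under the affine map
    has the same values on intervals. *)
Lemma lebesgue_affine (a b : R) (f : RT -> \bar R) : a != 0 ->
  measurable_fun setT f -> (forall x, 0 <= f x)%E ->
  (\int[leb]_x f (a * x + b)%R = (`|a|^-1)%:E * \int[leb]_x f x)%E.
Proof.
move=> a0 mf f0.
have mphi : measurable_fun setT ((fun x => a * x + b) : RT -> RT).
  by apply: measurable_funD => //; apply: measurable_funM => //; exact: measurable_cst.
pose phi : RT -> RT := fun x => a * x + b.
have na0 : 0 < `|a| by rewrite normr_gt0.
pose nu' : {measure set RT -> \bar R} :=
  mscale (NngNum (ltW na0)) (pushforward leb phi).
pose nu := nu' mphi.
have E A : measurable A -> leb A = nu A.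
  apply: lebesgue_measure_unique => X [[u v] _ <-] /=.
  rewrite /nu /nu' /mscale /= /pushforward.
  have [a1|a1] : 0 < a \/ a < 0 by apply/orP; rewrite orbC -neq_lt.
    rewrite (_ : _ @^-1` _ = `](u - b) / a, (v - b) / a]%classic); last first.
      apply/seteqP; split=> x /=; rewrite !in_itv /=.
        by rewrite ltr_pdivrMr// ler_pdivlMr// ltrBlDr lerBrDr mulrC.
      by rewrite ltr_pdivrMr// ler_pdivlMr// ltrBlDr lerBrDr mulrC.
    rewrite !lebesgue_measure_itv/= !lte_fin ltr_pM2r ?invr_gt0// ltrD2r.
    case: ifP => uv; last by rewrite mule0.
    by rewrite -!EFinB -EFinM -mulrBl gtr0_norm//; congr EFin; field.
  rewrite (_ : _ @^-1` _ = `[(v - b) / a, (u - b) / a[%classic); last first.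
    apply/seteqP; split=> x /=; rewrite !in_itv /=.
      by rewrite ler_ndivrMr// ltr_ndivlMr// ltrBlDr lerBrDr andbC mulrC.
    by rewrite ler_ndivrMr// ltr_ndivlMr// ltrBlDr lerBrDr andbC mulrC.
  rewrite !lebesgue_measure_itv/= !lte_fin ltr_nM2r ?invr_lt0// ltrD2r.
  case: ifP => uv; last by rewrite mule0.
  by rewrite -!EFinB -EFinM -mulrBl ltr0_norm//; congr EFin; field.
transitivity (\int[pushforward leb phi]_x f x)%E.
  by rewrite ge0_integral_pushforward//= preimage_setT.
rewrite [in RHS](@eq_measure_integral _ _ _ _ nu)//; last first.
  by move=> A mA _; exact: E.
rewrite /nu /nu' ge0_integral_mscale//= muleA -EFinM mulVf ?mul1e//.
by rewrite gt_eqF.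
Qed.

End ConsIntegral.

Section TupleIntegral.
Variable R : realType.
Local Notation RT := (measurableTypeR R).
Local Notation leb := (@lebesgue_measure R).
Local Notation mu d := (lebesgue_tuple R d).

Lemma measurable_trow d dS (S : measurableType dS) (f : S -> 'rV[R]_d) :
  (forall j, measurable_fun setT (fun s => f s 0 j)) ->
  measurable_fun setT (fun s => trow (f s) : d.-tuple RT).
Proof.
move=> mf; apply/measurable_fun_tnthP => j.
rewrite (_ : _ \o _ = fun s => f s 0 j); first exact: mf.
by apply/funext => s /=; rewrite tnth_mktuple.
Qed.

Lemma measurable_coord d (j : 'I_d) :
  measurable_fun setT (fun t : d.-tuple RT => rowt t 0 j).
Proof. by under eq_fun do rewrite rowtE; exact: measurable_tnth. Qed.

Lemma trow_cons n (x : RT) (y : 'rV[R]_n.+1) :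
  cons_pair (y 0 ord0, trow (\row_j y 0 (lift ord0 j))) = trow y :> n.+1.-tuple RT.
Proof.
apply: eq_from_tnth => j; rewrite tnth_mktuple.
case: (unliftP ord0 j) => [i ->|->]; last by rewrite tnth0.
by rewrite tnthS tnth_mktuple mxE.
Qed.

Lemma rowt_cons0 n x (t : n.-tuple RT) : rowt (cons_pair (x, t)) 0 ord0 = x.
Proof. by rewrite rowtE tnth0. Qed.
Lemma rowt_consS n x (t : n.-tuple RT) j :
  rowt (cons_pair (x, t)) 0 (lift ord0 j) = rowt t 0 j.
Proof. by rewrite !rowtE tnthS. Qed.

(** Induction on the dimension, one coordinate at a time, from the
    one-dimensional change of variables. *)
Lemma integral_affine d (a : R) (b : 'rV[R]_d) (f : d.-tuple RT -> \bar R) :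
  a != 0 -> measurable_fun setT f -> (forall t, 0 <= f t)%E ->
  (\int[mu d]_t f (trow (a *: rowt t + b)%R) =
   (`|a| ^- d)%:E * \int[mu d]_t f t)%E.
Proof.
move=> a0; have maff n (c : 'rV[R]_n) :
    measurable_fun setT (fun t : n.-tuple RT => trow (a *: rowt t + c) : n.-tuple RT).
  apply: measurable_trow => j; under eq_fun do rewrite !mxE.
  apply: measurable_funD => //; apply: measurable_funM => //.
  exact: measurable_tnth.
elim: d b f => [|n IH] b f mf f0.
  rewrite !integral_tuple0 expr0 invr1 mul1e; congr f.
  exact: tuple0.
rewrite (integral_tuple_cons (f := fun t => f (trow (a *: rowt t + b))))//; last first.
  exact: (measurableT_comp mf (maff _ b)).
rewrite integral_tuple_cons//.
pose c : 'rV[R]_n := \row_j b 0 (lift ord0 j).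
have mcons x : measurable_fun setT (fun t => f (cons_pair (x, t))).
  by apply: (measurableT_comp mf); apply: (measurableT_comp (@measurable_cons_pair R n)).
transitivity (\int[leb]_x ((`|a| ^- n)%:E *
    \int[mu n]_t f (cons_pair ((a * x + b 0 ord0)%R, t))))%E.
  apply: eq_integral => x _.
  rewrite -(IH c (fun t => f (cons_pair (a * x + b 0 ord0, t))))//.
  apply: eq_integral => t _; congr f.
  rewrite -trow_cons//; congr cons_pair; congr pair.
    by rewrite !mxE tnth0.
  by congr trow; apply/rowP => j; rewrite !mxE tnthS.
pose g x := (\int[mu n]_t f (cons_pair (x, t)))%E.
have mg : measurable_fun setT g.
  apply: (@measurable_fun_fubini_tonelli_F _ _ _ _ _ (mu n)
    (fun z => f (cons_pair z))) => //.
  exact: measurableT_comp mf (@measurable_cons_pair R n).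
have g0 x : (0 <= g x)%E by apply: integral_ge0.
have mga : measurable_fun setT (fun x : RT => g (a * x + b 0 ord0)).
  apply: (measurableT_comp mg).
  by apply: measurable_funD => //; apply: measurable_funM => //; exact: measurable_cst.
have k0 : (0 <= (`|a| ^- n)%:E)%E by rewrite lee_fin invr_ge0 exprn_ge0.
rewrite (ge0_integralZl _ measurableT mga (fun x _ => g0 _) k0).
rewrite (lebesgue_affine _ a0 mg g0) muleA -EFinM.
by rewrite -invfM exprSr.
Qed.

Lemma integral_prod d (h : 'I_d -> R -> R) (I : 'I_d -> R) :
  (forall j, measurable_fun setT (h j : RT -> R)) -> (forall j x, 0 <= h j x) ->
  (forall j, \int[leb]_x (h j x)%:E = (I j)%:E)%E ->
  (\int[mu d]_t (\prod_j h j (rowt t 0 j))%:E = (\prod_j I j)%:E)%E.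
Proof.
elim: d h I => [|n IH] h I mh h0 hI.
  by rewrite integral_tuple0 !big_ord0.
have I0 j : 0 <= I j.
  by rewrite -lee_fin -hI; apply: integral_ge0 => x _; rewrite lee_fin.
rewrite integral_tuple_cons//; last 2 first.
- apply/measurable_EFinP; apply: measurable_prod => j _.
  exact: (measurableT_comp (mh j) (@measurable_coord _ j)).
- by move=> t; rewrite lee_fin prodr_ge0.
have mp : measurable_fun setT (fun t : n.-tuple RT =>
    (\prod_j h (lift ord0 j) (rowt t 0 j))%:E).
  apply/measurable_EFinP; apply: measurable_prod => j _.
  exact: (measurableT_comp (mh _) (@measurable_coord _ j)).
have p0 (t : n.-tuple RT) : (0 <= (\prod_j h (lift ord0 j) (rowt t 0 j))%:E)%E.
  by rewrite lee_fin prodr_ge0.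
have k0 x : (0 <= (h ord0 x)%:E)%E by rewrite lee_fin.
under eq_integral => x _.
  under eq_integral => t _.
    rewrite big_ord_recl rowt_cons0 EFinM.
    under eq_bigr do rewrite rowt_consS.
    over.
  rewrite (ge0_integralZl _ measurableT mp (fun t _ => p0 t) (k0 x)).
  rewrite (IH (fun j => h (lift ord0 j)) (fun j => I (lift ord0 j)))//.
  over.
rewrite ge0_integralZr//; first by rewrite hI -EFinM big_ord_recl.
  exact/measurable_EFinP.
by rewrite lee_fin prodr_ge0.
Qed.

Lemma Cint_cons n (F : n.+1.-tuple RT -> R[i]) : L1 (mu n.+1) F ->
  Cint (mu n.+1) F = Cint leb (fun x => Cint (mu n) (fun t => F (cons_pair (x, t)))).
Proof.
move=> [mF Foo].
have mc := @measurable_cons_pair R n.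
have mFc : cmeas (fun z => F (cons_pair z)).
  by case: mF => m1 m2; split;
    [exact: (measurableT_comp m1)|exact: (measurableT_comp m2)].
have lF : L1 (leb \x mu n)%E (fun z => F (cons_pair z)).
  apply: L1_tonelli => //.
  rewrite -(integral_tuple_cons (f := fun t => (Normc.normc (F t))%:E))//.
    exact: measurable_normcE.
  by move=> t; rewrite lee_fin normc_ge0.
rewrite (Cint_fubini1 lF).
have E (f : n.+1.-tuple RT -> R) : measurable_fun setT f ->
    (leb \x mu n)%E.-integrable setT (EFin \o (fun z => f (cons_pair z))) ->
    \int[mu n.+1]_t f t = \int[(leb \x mu n)%E]_z f (cons_pair z).
  move=> mf fi; rewrite /Rintegral; congr fine.
  transitivity (\int[pushforward (leb \x mu n)%E (@cons_pair R n)]_t (f t)%:E)%E.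
    by apply: eq_measure_integral.
  rewrite integral_pushforward ?preimage_setT//=.
  exact/measurable_EFinP.
case: mF => m1 m2; apply: complex_eqP => /=; rewrite E//; [exact: L1_Re|exact: L1_Im].
Qed.

End TupleIntegral.

(** * Laplace and Cauchy densities *)

Section PoissonKernel.
Variable R : realType.
Local Notation RT := (measurableTypeR R).
Local Notation leb := (@lebesgue_measure R).

Lemma integral_inv_oneDsqr : (\int[leb]_x ((1 + x ^+ 2)^-1)%:E = (pi : R)%:E)%E.
Proof.
have := @ge0_symfun_integralT R (fun x => (1 + x ^+ 2)^-1).
move=> -> //.
- rewrite -set_itvcy; have := @integral0y_oneDsqr R; rewrite /oneDsqr => ->.
  by rewrite -EFinM mulrCA divff ?mulr1.
- by move=> x; rewrite invr_ge0 addr_ge0// sqr_ge0.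
- exact: (@continuous_oneDsqrV R).
- by move=> x /=; rewrite sqrrN.
Qed.

(** An explicit primitive; for k = 1 / (1 + w ^+ 2) its derivative is
    exp (- x) (1 + cos (w x)). *)
Lemma is_derive_expN_trig (w k x : R) : is_derive x (1 : R)
  (fun x => expR (- x) * (k * w * sin (w * x) - k * cos (w * x) - 1))
  (expR (- x) * (1 + k * (1 + w ^+ 2) * cos (w * x))).
Proof.
have dw : is_derive x (1 : R) (fun y => w * y) w.
  have := @is_deriveZ _ _ _ id w x 1 1 (is_derive_id x 1).
  by rewrite scaler1 /GRing.scale/=.
have dE : is_derive x (1 : R) (fun y => expR (- y)) (expR (- x) * -1).
  exact: (is_derive1_comp (is_derive_expR (- x)) _).
have dS : is_derive x (1 : R) (fun y => sin (w * y)) (cos (w * x) * w).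
  exact: (is_derive1_comp (is_derive_sin (w * x)) dw).
have dC : is_derive x (1 : R) (fun y => cos (w * y)) (- sin (w * x) * w).
  exact: (is_derive1_comp (is_derive_cos (w * x)) dw).
have dG := is_deriveB (is_deriveB (is_deriveZ (k * w) dS) (is_deriveZ k dC))
  (is_derive_cst (1 : R) x (1 : R)).
have := is_deriveM dE dG.
set D := (X in is_derive _ _ _ X -> _) => h.
suff -> : expR (- x) * (1 + k * (1 + w ^+ 2) * cos (w * x)) = D by exact: h.
transitivity (expR (- x) * (k * w * (cos (w * x) * w) - k * (- sin (w * x) * w) - 0)
  + (k * w * sin (w * x) - k * cos (w * x) - 1) * (expR (- x) * -1)); last by [].
by ring.
Qed.

(** Adding the constant 1 makes the integrand nonnegative, so that the
    fundamental theorem of calculus applies on the unbounded interval. *)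
Let integral_1cos (w : R) :
  (\int[leb]_x (expR (- `|x|) * (1 + cos (w * x)))%:E =
   (2 + 2 / (1 + w ^+ 2))%:E)%E.
Proof.
have n0 : 1 + w ^+ 2 != 0 by rewrite gt_eqF// ltr_pwDl// sqr_ge0.
pose k := (1 + w ^+ 2)^-1.
pose f (x : R) := expR (- x) * (1 + cos (w * x)).
pose F (x : R) := expR (- x) * (k * w * sin (w * x) - k * cos (w * x) - 1).
have cosc : continuous (fun x : R => cos (w * x)).
  by move=> x; apply: continuous_comp; [exact: mulrl_continuous|exact: continuous_cos].
have f0 x : 0 <= expR (- x) * (1 + cos (w * x)).
  by rewrite mulr_ge0 ?expR_ge0// -lerBlDl sub0r cos_geN1.
have dF x : is_derive x (1 : R) F (f x).
  have := is_derive_expN_trig w k x.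
  by rewrite /k mulVf// mul1r.
rewrite (@ge0_symfun_integralT R (fun x => expR (- `|x|) * (1 + cos (w * x)))).
- rewrite -set_itvcy.
  transitivity (2%:E * \int[leb]_(x in `[0%R, +oo[) (f x)%:E)%E.
    congr (_ * _)%E; apply: eq_integral.
    by move=> x; rewrite inE /= in_itv /= andbT => x0; rewrite ger0_norm.
  rewrite (@ge0_continuous_FTC2y R f F 0 0).
  + rewrite /F oppr0 mulr0 sin0 cos0 expR0 mulr0 -EFinB -EFinM; congr EFin.
    by rewrite /k; field.
  + by move=> x _; exact: f0.
  + apply: continuous_subspaceT => x; apply: cvgM.
      by apply: continuous_comp; [exact: opp_continuous|exact: continuous_expR].
    by apply: cvgD; [exact: cvg_cst|exact: cosc].
  + apply/norm_cvg0P.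
    pose M := `|k * w| + `|k| + 1.
    have hM : M * expR (- x) @[x --> +oo] --> M * 0.
      by apply: cvgM; [exact: cvg_cst|exact: cvgr_expR].
    rewrite mulr0 in hM.
    apply: (squeeze_cvgr _ (cvg_cst 0) hM); apply: nearW => x.
    rewrite normr_ge0 normrM ger0_norm ?expR_ge0// mulrC ler_wpM2r ?expR_ge0//.
    rewrite (le_trans (ler_normB _ _))// normr1 lerD2r (le_trans (ler_normB _ _))//.
    rewrite (normrM (k * w) (sin _)) (normrM k (cos _)).
    apply: lerD; rewrite ler_piMr// ler_norml.
      by rewrite sin_geN1 sin_le1.
    by rewrite cos_geN1 cos_le1.
  + by move=> x _; exact: ex_derive.
  + have : derivable F 0 1 by exact: ex_derive.
    by move=> /derivable1_diffP/differentiable_continuous; exact: cvg_at_right_filter.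
  + by move=> x _; rewrite derive1E; exact: derive_val.
- by move=> x; rewrite mulr_ge0 ?expR_ge0// -lerBlDl sub0r cos_geN1.
- move=> x; apply: cvgM.
    apply: continuous_comp; last exact: continuous_expR.
    by apply: cvgN; exact: norm_continuous.
  by apply: cvgD; [exact: cvg_cst|exact: cosc].
- by move=> x /=; rewrite normrN mulrN cosN.
Qed.

Lemma integral_expNnorm : (\int[leb]_x (expR (- `|x|))%:E = 2%:E)%E.
Proof.
have := integral_1cos 0.
under eq_integral do rewrite mul0r cos0 mulrC EFinM.
rewrite ge0_integralZl//.
- rewrite expr0n addr0 divr1 => h.
  have : ((2 : R)^-1%:E * (2%:E * \int[leb]_x (expR (- `|x|))%:E) = 2^-1%:E * (2 + 2)%:E)%E.
    by rewrite h.
  by rewrite muleA -!EFinM mulVf// mul1e => ->; congr EFin; field.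
- apply/measurable_EFinP; apply: continuous_measurable_fun => x.
  apply: continuous_comp; last exact: continuous_expR.
  by apply: cvgN; exact: norm_continuous.
Qed.

Lemma continuous_expNnorm : continuous (fun x : R => expR (- `|x|)).
Proof.
move=> x; apply: continuous_comp; last exact: continuous_expR.
by apply: cvgN; exact: norm_continuous.
Qed.

Lemma measurable_expNnorm : measurable_fun setT (fun x : RT => expR (- `|x|)).
Proof. by apply: continuous_measurable_fun; exact: continuous_expNnorm. Qed.

Lemma integrable_expNnorm : leb.-integrable setT (EFin \o (fun x => expR (- `|x|))).
Proof.
apply/integrableP; split; first by apply/measurable_EFinP; exact: measurable_expNnorm.
under eq_integral do rewrite /= ger0_norm ?expR_ge0//.
by rewrite integral_expNnorm ltry.
Qed.

(** The cosine part comes from [integral_1cos]; the sine part vanishes by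
    parity. *)
Lemma Cint_cis_exp (w : R) :
  Cint leb (fun x => cis (w * x) * (expR (- `|x|))%:C) = (2 / (1 + w ^+ 2))%:C.
Proof.
have iE := integrable_expNnorm.
have mE := measurable_expNnorm.
have mw : measurable_fun setT (fun x : RT => w * x : RT).
  by apply: measurable_funM => //; exact: measurable_cst.
have mc : measurable_fun setT (fun x : RT => cos (w * x)).
  by apply: measurableT_comp mw; apply: continuous_measurable_fun; exact: continuous_cos.
have ms : measurable_fun setT (fun x : RT => sin (w * x)).
  by apply: measurableT_comp mw; apply: continuous_measurable_fun; exact: continuous_sin.
have ic : leb.-integrable setT (EFin \o (fun x => expR (- `|x|) * cos (w * x))).
  apply: integrable_dom iE _; first exact: measurable_funM.
  move=> x; rewrite normrM ger0_norm ?expR_ge0// ler_piMr ?expR_ge0//.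
  by rewrite ler_norml cos_geN1 cos_le1.
have is_ : leb.-integrable setT (EFin \o (fun x => expR (- `|x|) * sin (w * x))).
  apply: integrable_dom iE _; first exact: measurable_funM.
  by move=> x; rewrite normrM ger0_norm ?expR_ge0// ler_piMr ?expR_ge0// sin_max.
have I1 : \int[leb]_x expR (- `|x|) = 2 by rewrite /Rintegral integral_expNnorm.
apply: complex_eqP; rewrite /Cint /=.
- transitivity (\int[leb]_x (expR (- `|x|) * cos (w * x))).
    by apply: eq_Rintegral => x _; rewrite mulr0 subr0 mulrC.
  have : \int[leb]_x (expR (- `|x|) * (1 + cos (w * x))) = 2 + 2 / (1 + w ^+ 2).
    by rewrite /Rintegral integral_1cos.
  under eq_Rintegral do rewrite mulrDr mulr1.
  by rewrite RintegralD// I1 => /addrI.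
- transitivity (\int[leb]_x (expR (- `|x|) * sin (w * x))).
    by apply: eq_Rintegral => x _; rewrite mulr0 add0r mulrC.
  (* The nonnegative integrands with 1 + sin and 1 - sin are exchanged by the
     reflection x |-> - x. *)
  have E (s : R) :
      (\int[leb]_x (expR (- `|x|) * (1 + s * sin (w * x)))%:E =
       (2 + s * \int[leb]_x (expR (- `|x|) * sin (w * x)))%:E)%E.
    rewrite -I1 -RintegralZl// -RintegralD//; last exact: integrableZR.
    rewrite /Rintegral fineK.
      by apply: eq_integral => x _; rewrite mulrDr mulr1 mulrCA.
    apply: integrable_fin_num => //.
    apply: (integrableDR iE (g := fun x => s * _)); exact: integrableZR.
  have h1 := E 1; have h2 := E (-1).
  have m1 : measurable_fun setT
      (fun x : RT => (expR (- `|x|) * (1 + 1 * sin (w * x)))%:E).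
    apply/measurable_EFinP; apply: measurable_funM => //.
    apply: measurable_funD; first exact: measurable_cst.
    by apply: measurable_funM => //; exact: measurable_cst.
  have p1 (x : RT) : (0 <= (expR (- `|x|) * (1 + 1 * sin (w * x)))%:E)%E.
    by rewrite lee_fin mulr_ge0 ?expR_ge0// mul1r -lerBlDl sub0r sin_geN1.
  have n1 : (-1 : R) != 0 by rewrite oppr_eq0 oner_eq0.
  have := lebesgue_affine 0 n1 m1 p1; rewrite h1 normrN1 invr1 mul1e => h3.
  have : (\int[leb]_x (expR (- `|x|) * (1 + -1 * sin (w * x)))%:E =
     (2 + 1 * \int[leb]_x (expR (- `|x|) * sin (w * x)))%:E)%E.
    rewrite -h3; apply: eq_integral => x _; congr (EFin (_ * (1 + _))).
      by rewrite mulN1r addr0 normrN.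
    by rewrite mulN1r addr0 mul1r mulN1r mulrN sinN.
  by rewrite h2 => -[/addrI]; lra.
Qed.

End PoissonKernel.

Section ProductKernels.
Variable R : realType.
Local Notation RT := (measurableTypeR R).
Local Notation leb := (@lebesgue_measure R).
Local Notation mu d := (lebesgue_tuple R d).

Lemma cmeas_prod dS (S : measurableType dS) n (F : 'I_n -> S -> R[i]) :
  (forall j, cmeas (F j)) -> cmeas (fun x => \prod_j F j x).
Proof.
move=> mF; elim: n F mF => [|n IH] F mF.
  by under eq_fun do rewrite big_ord0; exact: cmeas_cst.
by under eq_fun do rewrite big_ord_recl; apply: cmeasM => //; exact: IH.
Qed.

Lemma normc_prod n (z : 'I_n -> R[i]) :
  Normc.normc (\prod_j z j) = \prod_j Normc.normc (z j).
Proof. by apply: (big_morph _ (@normc_mul R) (normc_1 R)). Qed.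

Lemma L1_prod d (g : 'I_d -> R -> R[i]) : (forall j, L1 leb (g j)) ->
  L1 (mu d) (fun t => \prod_j g j (rowt t 0 j)).
Proof.
move=> lg; have mg j : cmeas (g j : RT -> _) by case: (lg j).
split.
  by apply: cmeas_prod => j; apply: cmeas_comp (mg j) (@measurable_coord _ d j).
under eq_integral do rewrite normc_prod.
rewrite (integral_prod (h := fun j x => Normc.normc (g j x))
  (I := fun j => fine (\int[leb]_x (Normc.normc (g j x))%:E)%E)) ?ltry//.
- by move=> j; exact: measurable_normc.
- by move=> j x; exact: normc_ge0.
- move=> j; rewrite fineK// ge0_fin_numE; first by case: (lg j).
  by apply: integral_ge0 => x _; rewrite lee_fin normc_ge0.
Qed.

Lemma Cint_prod d (g : 'I_d -> R -> R[i]) : (forall j, L1 leb (g j)) ->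
  Cint (mu d) (fun t => \prod_j g j (rowt t 0 j)) = \prod_j Cint leb (g j).
Proof.
elim: d g => [|n IH] g lg.
  rewrite big_ord0 /Cint /Rintegral !integral_tuple0 /= big_ord0.
  by apply: complex_eqP.
rewrite Cint_cons; last exact: L1_prod.
under eq_Cint => x.
  rewrite (_ : (fun _ => _) = (fun t : n.-tuple RT => g ord0 x *
      \prod_j g (lift ord0 j) (rowt t 0 j))).
    rewrite CintZ; last exact: (L1_prod (g := fun j => g (lift ord0 j))).
    rewrite (IH (fun j => g (lift ord0 j)))//; over.
  apply/funext => t; rewrite big_ord_recl rowt_cons0; congr (_ * _).
  by apply: eq_bigr => j _; rewrite rowt_consS.
by rewrite CintZr// big_ord_recl.
Qed.

Variable d : nat.

(** It is integrable and bounded below on every cube, so that its multiples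
    dominate all the bounded functions with compact support. *)
Definition cauchy_density (x : 'rV[R]_d) : R := \prod_j (1 + x 0 j ^+ 2)^-1.
Definition laplace_density (x : 'rV[R]_d) : R := \prod_j expR (- `|x 0 j|).

Lemma cauchy_density_gt0 x : 0 < cauchy_density x.
Proof. by apply: prodr_gt0 => j _; rewrite invr_gt0 ltr_pwDl// sqr_ge0. Qed.

Let measurable_inv1 : measurable_fun setT (fun x : RT => (1 + x ^+ 2)^-1).
Proof. by apply: continuous_measurable_fun; exact: (@continuous_oneDsqrV R). Qed.

Lemma measurable_cauchy :
  measurable_fun setT (fun t : d.-tuple RT => cauchy_density (rowt t)).
Proof.
apply: measurable_prod => j _.
exact: (measurableT_comp measurable_inv1 (@measurable_coord _ d j)).
Qed.

Lemma integral_cauchy :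
  (\int[mu d]_t (cauchy_density (rowt t))%:E = (pi ^+ d)%:E)%E.
Proof.
rewrite (integral_prod (h := fun j x => (1 + x ^+ 2)^-1) (I := fun=> pi)).
- by rewrite prodr_const card_ord.
- by move=> j; exact: measurable_inv1.
- by move=> j x; rewrite invr_ge0 addr_ge0// sqr_ge0.
- by move=> j; exact: integral_inv_oneDsqr.
Qed.

Lemma integrable_cauchy :
  (mu d).-integrable setT (EFin \o (fun t => cauchy_density (rowt t))).
Proof.
apply/integrableP; split; first by apply/measurable_EFinP; exact: measurable_cauchy.
under eq_integral do rewrite /= gtr0_norm ?cauchy_density_gt0//.
by rewrite integral_cauchy ltry.
Qed.

Lemma laplace_density_gt0 x : 0 < laplace_density x.
Proof. by apply: prodr_gt0 => j _; exact: expR_gt0. Qed.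
Lemma laplace_density_le1 x : laplace_density x <= 1.
Proof.
by apply: prodr_ile1 => j _; rewrite expR_ge0 /= -expR0 ler_expR oppr_le0.
Qed.

Lemma measurable_laplace :
  measurable_fun setT (fun t : d.-tuple RT => laplace_density (rowt t)).
Proof.
apply: measurable_prod => j _.
exact: (measurableT_comp (@measurable_expNnorm R) (@measurable_coord _ d j)).
Qed.

Lemma integrable_laplace :
  (mu d).-integrable setT (EFin \o (fun t => laplace_density (rowt t))).
Proof.
apply/integrableP; split; first by apply/measurable_EFinP; exact: measurable_laplace.
under eq_integral do rewrite /= gtr0_norm ?laplace_density_gt0//.
rewrite (integral_prod (h := fun j x => expR (- `|x|)) (I := fun=> 2)) ?ltry//.
- by move=> j; exact: measurable_expNnorm.
- by move=> j; exact: integral_expNnorm.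
Qed.

Lemma cis_sum (a : 'I_d -> R) : cis (\sum_j a j) = \prod_j (cis (a j) : R[i]).
Proof. exact: (big_morph _ (@cisD R) (cis0 R)). Qed.

(** One-dimensional transforms multiply, [Cint_prod]. *)
Lemma Cint_cis_laplace (w : 'rV[R]_d) :
  Cint (mu d) (fun t => cis (dot w (rowt t)) * (laplace_density (rowt t))%:C) =
  (2 ^+ d * cauchy_density w)%:C.
Proof.
transitivity (Cint (mu d) (fun t => \prod_j
    (cis (w 0 j * rowt t 0 j) * (expR (- `|rowt t 0 j|))%:C) : R[i])).
  apply: eq_Cint => t; rewrite /dot cis_sum big_split /=; congr (_ * _).
  by rewrite /laplace_density rmorph_prod.
rewrite (Cint_prod (g := fun j x => cis (w 0 j * x) * (expR (- `|x|))%:C)).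
  under eq_bigr do rewrite Cint_cis_exp.
  rewrite -rmorph_prod big_split /= prodr_const card_ord.
  by congr (_%:C).
move=> j; apply: (@L1_mulbl _ _ _ _ _ _ 1).
- exact: L1_real (@integrable_expNnorm R).
- by apply: cmeas_cis; apply: measurable_funM => //; exact: measurable_cst.
- by move=> x; rewrite normc_cis.
Qed.

End ProductKernels.

(** * The Fourier transform and its inversion *)

Section RdIntegral.
Variables (R : realType) (d : nat).
Local Notation RT := (measurableTypeR R).
Local Notation Td := (d.-tuple RT).
Local Notation mu := (lebesgue_tuple R d).
Local Notation Rd := 'rV[R]_d.
Local Notation normc := (@Normc.normc R).
Implicit Types (f : Rd -> R[i]) (x xi b : Rd).

(** Functions on row vectors are integrated through their tuples of
    coordinates. *)
Definition rmeas f := cmeas (fun t : Td => f (rowt t)).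
Definition L1d f := L1 mu (fun t => f (rowt t)).
Definition CI f := Cint mu (fun t => f (rowt t)).

Lemma continuous_rmeas f : continuous (Re_fun f) -> continuous (Im_fun f) -> rmeas f.
Proof. by move=> cr ci; split; [exact: (measurable_rowt cr)|exact: (measurable_rowt ci)]. Qed.

Lemma measurable_affine (a : R) b :
  measurable_fun setT (fun t : Td => trow (a *: rowt t + b) : Td).
Proof.
apply: measurable_trow => j; under eq_fun do rewrite !mxE.
apply: measurable_funD => //; apply: measurable_funM => //.
exact: measurable_tnth.
Qed.

Lemma rmeas_affine f (a : R) b : rmeas f -> rmeas (fun x => f (a *: x + b)).
Proof.
move=> mf; rewrite /rmeas.
rewrite (_ : (fun _ => _) = fun t : Td => f (rowt (trow (a *: rowt t + b)))).
  exact: (cmeas_comp mf (@measurable_affine a b)).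
by apply/funext => t; rewrite trowK.
Qed.

Lemma integral_affineR (h : Rd -> R) (a : R) b : a != 0 ->
  measurable_fun setT (fun t : Td => h (rowt t)) -> (forall x, 0 <= h x) ->
  (\int[mu]_t (h (a *: rowt t + b))%:E =
   (`|a| ^- d)%:E * \int[mu]_t (h (rowt t))%:E)%E.
Proof.
move=> a0 mh h0; rewrite -(integral_affine b a0 (f := fun t => (h (rowt t))%:E)).
- by apply: eq_integral => t _; rewrite trowK.
- exact/measurable_EFinP.
- by move=> t; rewrite lee_fin.
Qed.

Lemma L1d_affine f (a : R) b : a != 0 -> L1d f -> L1d (fun x => f (a *: x + b)).
Proof.
move=> a0 [mf foo]; split; first exact: rmeas_affine.
rewrite (integral_affineR (h := fun x => normc (f x)) b a0); last 2 first.
- exact: measurable_normc.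
- by move=> x; exact: normc_ge0.
by rewrite lte_mul_pinfty// lee_fin invr_ge0 exprn_ge0.
Qed.

Let Rintegral_affine (g : Td -> R) (a : R) b : a != 0 ->
  mu.-integrable setT (EFin \o g) ->
  \int[mu]_t g (trow (a *: rowt t + b)) = `|a| ^- d * \int[mu]_t g t.
Proof.
move=> a0 gi; have mg : measurable_fun setT (EFin \o g) by case/integrableP: gi.
rewrite /Rintegral integralE [in RHS]integralE.
have E (h : Td -> \bar R) : measurable_fun setT h -> (forall t, 0 <= h t)%E ->
    (\int[mu]_t h (trow (a *: rowt t + b)) = (`|a| ^- d)%:E * \int[mu]_t h t)%E.
  by move=> mh h0; rewrite integral_affine.
have mp := measurable_funepos mg; have mn := measurable_funeneg mg.
pose G t := (g t)%:E.
have hp := E G^\+%E mp (fun t => funepos_ge0 _ t).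
have hn := E G^\-%E mn (fun t => funeneg_ge0 _ t).
have ip := integrable_pos_fin_num measurableT gi.
have iN := integrable_neg_fin_num measurableT gi.
rewrite -[X in X^\+%E]/(G \o (fun t => trow (a *: rowt t + b))).
rewrite -[X in X^\-%E]/(G \o (fun t => trow (a *: rowt t + b))).
rewrite funepos_comp funeneg_comp /comp.
rewrite hp hn -(fineK ip) -(fineK iN) -!EFinM -!EFinB.
by rewrite /= -mulrBr.
Qed.

Lemma CI_affine f (a : R) b : a != 0 -> L1d f ->
  CI (fun x => f (a *: x + b)) = (`|a| ^- d)%:C * CI f.
Proof.
move=> a0 lf; apply: complex_eqP; rewrite ReIm_simp /CI /Cint /= mul0r.
  rewrite subr0 -(Rintegral_affine b a0 (L1_Re lf)).
  by apply: eq_Rintegral => t _; rewrite trowK.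
rewrite addr0 -(Rintegral_affine b a0 (L1_Im lf)).
by apply: eq_Rintegral => t _; rewrite trowK.
Qed.

Lemma measurable_dot : measurable_fun setT (fun z : Td * Td => dot (rowt z.1) (rowt z.2)).
Proof.
apply: measurable_sum => j; apply: measurable_funM.
  exact: (measurableT_comp (@measurable_coord R d j) measurable_fst).
exact: (measurableT_comp (@measurable_coord R d j) measurable_snd).
Qed.

Lemma measurable_dotl x : measurable_fun setT (fun t : Td => dot x (rowt t)).
Proof.
apply: measurable_sum => j; apply: measurable_funM; first exact: measurable_cst.
exact: measurable_coord.
Qed.

Lemma dotC x y : dot x y = dot y x :> R.
Proof. by apply: eq_bigr => j _; rewrite mulrC. Qed.
Lemma dotDl x y z : dot (x + y) z = dot x z + dot y z :> R.
Proof. by rewrite -big_split /=; apply: eq_bigr => j _; rewrite mxE mulrDl. Qed.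
Lemma dotZl (a : R) x y : dot (a *: x) y = a * dot x y.
Proof. by rewrite big_distrr /=; apply: eq_bigr => j _; rewrite mxE mulrA. Qed.
Lemma dotNl x y : dot (- x) y = - dot x y :> R.
Proof. by rewrite -scaleN1r dotZl mulN1r. Qed.
Lemma dotBl x y z : dot (x - y) z = dot x z - dot y z :> R.
Proof. by rewrite dotDl dotNl. Qed.

Lemma measurable_dotr x : measurable_fun setT (fun t : Td => dot (rowt t) x).
Proof. by under eq_fun do rewrite dotC; exact: measurable_dotl. Qed.

(** Convertible to [fourier]; as an integral of a complex-valued function it is
    accessible to Fubini and to dominated convergence. *)
Definition ft f xi : R[i] := CI (fun x => f x * cis (- dot x xi)).

Lemma L1d_cis f xi : L1d f -> L1d (fun x => f x * cis (- dot x xi)).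
Proof.
move=> lf; apply: (L1_mulb (M := 1) lf).
  by apply: cmeas_cis; apply: measurableT_comp => //; exact: measurable_dotr.
by move=> t; rewrite normc_cis.
Qed.

Lemma normc_ft_le f xi : L1d f ->
  normc (ft f xi) <= \int[mu]_t normc (f (rowt t)).
Proof.
move=> lf; rewrite (le_trans (normc_Cint (L1d_cis xi lf)))//.
rewrite le_eqVlt; apply/orP; left; apply/eqP; apply: eq_Rintegral => t _.
by rewrite normc_mul normc_cis mulr1.
Qed.

(** A partial integral is measurable once the integrand is integrable on the
    product; the Cauchy density makes it so and is divided out afterwards. *)
Lemma rmeas_ft f : L1d f -> rmeas (ft f).
Proof.
move=> lf.
pose F (z : Td * Td) : R[i] :=
  f (rowt z.1) * cis (- dot (rowt z.1) (rowt z.2)) * (cauchy_density (rowt z.2))%:C.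
have lF : L1 (mu \x mu)%E F.
  rewrite (_ : F = fun z => f (rowt z.1) * (cauchy_density (rowt z.2))%:C *
      cis (- dot (rowt z.1) (rowt z.2))).
    apply: (L1_tensor (F := fun s => f (rowt s))
      (G := fun t => (cauchy_density (rowt t))%:C)
      (H := fun z => cis (- dot (rowt z.1) (rowt z.2))) (M := 1)) => //.
    - exact: L1_real (@integrable_cauchy R d).
    - by apply: cmeas_cis; apply: measurableT_comp => //; exact: measurable_dot.
    - by move=> z; rewrite normc_cis.
  by apply/funext => z; rewrite mulrAC.
have := cmeas_Cint2 lF.
move=> mG; rewrite /rmeas.
rewrite (_ : (fun _ => _) = fun t : Td => Cint mu (fun s => F (s, t)) *
    ((cauchy_density (rowt t))^-1)%:C).
  apply: cmeasM => //; apply: cmeas_real.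
  under eq_fun do rewrite /cauchy_density prodfV invrK.
  apply: measurable_prod => j _; apply: measurable_funD; first exact: measurable_cst.
  by apply: measurable_funX; exact: measurable_coord.
apply/funext => t; have -> : Cint mu (fun s : Td => F (s, t)) =
    ft f (rowt t) * (cauchy_density (rowt t))%:C.
  by rewrite -(CintZr (cauchy_density (rowt t))%:C (L1d_cis (rowt t) lf)).
rewrite -mulrA -rmorphM /=.
by rewrite divff ?gt_eqF ?cauchy_density_gt0// mulr1.
Qed.

End RdIntegral.

Section Inversion.
Variables (R : realType) (d : nat).
Local Notation RT := (measurableTypeR R).
Local Notation Td := (d.-tuple RT).
Local Notation mu := (lebesgue_tuple R d).
Local Notation Rd := 'rV[R]_d.
Local Notation normc := (@Normc.normc R).
Implicit Types (f : Rd -> R[i]) (x xi b : Rd).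

Lemma normc_cvg_unique (u : nat -> R[i]) (a b : R[i]) :
  normc (u n - a) @[n --> \oo] --> (0 : R) ->
  normc (u n - b) @[n --> \oo] --> (0 : R) -> a = b.
Proof.
move=> ua ub; apply/eqP; rewrite -subr_eq0; apply/eqP; apply: Normc.eq0_normc.
have h : normc (u n - a) + normc (u n - b) @[n --> \oo] --> (0 + 0 : R).
  exact: cvgD.
rewrite addr0 in h.
have c : cst (normc (a - b)) n @[n --> \oo] --> (0 : R).
  apply: (squeeze_cvgr _ (cvg_cst 0) h); apply: nearW => n; apply/andP; split.
    exact: normc_ge0.
  rewrite /cst (_ : a - b = (u n - b) - (u n - a)); last by ring.
  by rewrite (le_trans (normcB _ _))// addrC.
by have := cvg_unique _ c (cvg_cst _) => /(_ (@Rhausdorff R)) ->.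
Qed.

Lemma normc_cvg (u : nat -> R[i]) (a : R[i]) :
  complex.Re (u n) @[n --> \oo] --> complex.Re a ->
  complex.Im (u n) @[n --> \oo] --> complex.Im a ->
  normc (u n - a) @[n --> \oo] --> (0 : R).
Proof.
move=> ur ui.
have h : `|complex.Re (u n) - complex.Re a| + `|complex.Im (u n) - complex.Im a|
    @[n --> \oo] --> (0 + 0 : R).
  by apply: cvgD; apply/norm_cvg0P; apply/subr_cvg0.
rewrite addr0 in h.
apply: (squeeze_cvgr _ (cvg_cst 0) h); apply: nearW => n; apply/andP; split.
  exact: normc_ge0.
by rewrite (le_trans (normc_le_ReIm _))// !ReIm_simp.
Qed.

Lemma harmonic_scale_cvg x b : (n.+1%:R^-1 : R) *: x + b @[n --> \oo] --> b.
Proof.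
rewrite -[X in _ --> X]add0r; apply: cvgD; last exact: cvg_cst.
rewrite -(scale0r x); apply: cvgZr_tmp.
exact: (@cvg_harmonic R).
Qed.

Lemma continuous_normc_cvg f (u : nat -> Rd) x :
  continuous (Re_fun f) -> continuous (Im_fun f) -> u n @[n --> \oo] --> x ->
  normc (f (u n) - f x) @[n --> \oo] --> (0 : R).
Proof.
move=> cr ci ux; apply: normc_cvg.
  exact: (continuous_cvg _ (cr x) ux).
exact: (continuous_cvg _ (ci x) ux).
Qed.

Lemma laplaceE (x : Rd) : laplace_density x = expR (- \sum_j `|x 0 j|).
Proof. by rewrite /laplace_density -sumrN expR_sum. Qed.

Lemma laplace_scale_cvg x : laplace_density ((n.+1%:R^-1 : R) *: x) @[n --> \oo] --> (1 : R).
Proof.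
have -> : (fun n : nat => laplace_density ((n.+1%:R^-1 : R) *: x)) =
    (fun n : nat => expR (- (n.+1%:R^-1 * \sum_j `|x 0 j|))).
  apply/funext => n; rewrite laplaceE; congr (expR (- _)).
  rewrite big_distrr /=; apply: eq_bigr => j _.
  by rewrite mxE normrM ger0_norm.
have h : - (n.+1%:R^-1 * \sum_j `|x 0 j|) @[n --> \oo] --> - (0 * \sum_j `|x 0 j|).
  by apply: cvgN; apply: cvgM; [exact: (@cvg_harmonic R)|exact: cvg_cst].
rewrite mul0r oppr0 in h; rewrite -[X in _ --> X](@expR0 R).
by apply: continuous_cvg; [exact: continuous_expR|exact: h].
Qed.

Lemma cvg_normcM_real (z : R[i]) (a : nat -> R) : a n @[n --> \oo] --> (1 : R) ->
  normc (z * (a n)%:C - z) @[n --> \oo] --> (0 : R).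
Proof.
move=> a1; have h : normc z * `|a n - 1| @[n --> \oo] --> normc z * 0.
  apply: cvgM; first exact: cvg_cst.
  by apply/norm_cvg0P; exact/subr_cvg0.
rewrite mulr0 in h; apply: cvg_trans h; apply: near_eq_cvg; apply: nearW => n.
by rewrite -normc_real -normc_mul rmorphB rmorph1 mulrBr mulr1.
Qed.

(** The inverse transform is regularized by a dilated Laplace density, whose
    transform is an approximate identity made of Cauchy densities. *)
Let regularized f x (n : nat) :=
  CI (fun xi => ft f xi * cis (dot x xi) *
    (laplace_density ((n.+1%:R^-1 : R) *: xi))%:C).

(** Fubini and the transform of the Laplace density turn the regularized inverse
    transform into an average of translates of f against the Cauchy density. *)
Let regularizedE f x n : L1d f -> (exists M, forall y, normc (f y) <= M) ->
  regularized f x n =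
  CI (fun w => f (- (n.+1%:R^-1 : R) *: w + x) * (2 ^+ d * cauchy_density w)%:C).
Proof.
move=> lf [M fM]; set e : R := n.+1%:R^-1.
have e0 : e != 0 by rewrite invr_eq0 pnatr_eq0.
have egt0 : 0 < e by rewrite invr_gt0.
have M0 : 0 <= M by exact: le_trans (normc_ge0 _) (fM 0).
pose L xi := (laplace_density (e *: xi))%:C : R[i].
have lL : L1d L.
  have := @L1d_affine R d (fun x => (laplace_density x)%:C) e 0 e0
    (L1_real (@integrable_laplace R d)).
  by under eq_fun do rewrite addr0.
pose F (z : Td * Td) : R[i] :=
  f (rowt z.1) * L (rowt z.2) * cis (dot (x - rowt z.1) (rowt z.2)).
have mc : measurable_fun setT (fun z : Td * Td => dot (x - rowt z.1) (rowt z.2)).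
  under eq_fun do rewrite dotBl; apply: measurable_funB; last exact: measurable_dot.
  exact: (measurableT_comp (measurable_dotl x) measurable_snd).
have lF : L1 (mu \x mu)%E F.
  apply: (L1_tensor (F := fun s => f (rowt s)) (G := fun t => L (rowt t))
    (H := fun z => cis (dot (x - rowt z.1) (rowt z.2))) (M := 1)) => //.
  - by apply: cmeas_cis.
  - by move=> z; rewrite normc_cis.
have lcL y : L1d (fun xi => cis (dot y xi) * L xi).
  apply: (L1_mulbl (M := 1) lL); first by apply: cmeas_cis; exact: measurable_dotl.
  by move=> t; rewrite normc_cis.
pose H w : R[i] := f (- e *: w + x) * (2 ^+ d * cauchy_density w)%:C.
have lH : L1d H.
  apply: (L1_mulbl (M := M)).
  - apply: L1_real.
    exact: (integrableZR _ (@integrable_cauchy R d)).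
  - by apply: rmeas_affine; case: lf.
  - by move=> t; exact: fM.
have inner y : CI (fun xi => cis (dot (x - y) xi) * L xi) =
    (e ^- d * (2 ^+ d * cauchy_density (e^-1 *: (x - y))))%:C.
  pose G xi : R[i] := cis (dot (e^-1 *: (x - y)) xi) * (laplace_density xi)%:C.
  have lG : L1d G.
    apply: (L1_mulbl (M := 1) (L1_real (@integrable_laplace R d))).
      by apply: cmeas_cis; exact: measurable_dotl.
    by move=> t; rewrite normc_cis.
  transitivity (CI (fun xi => G (e *: xi + 0))).
    apply: eq_Cint => t; rewrite /G /L addr0; congr (cis _ * _).
    by rewrite dotZl [dot _ (e *: _)]dotC dotZl mulrA mulVf// mul1r dotC.
  have hG : CI G = (2 ^+ d * cauchy_density (e^-1 *: (x - y)))%:C.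
    exact: Cint_cis_laplace.
  by rewrite (CI_affine 0 e0 lG) hG -rmorphM /= gtr0_norm.
transitivity (Cint mu (fun t => Cint mu (fun s => F (s, t)))).
  apply: eq_Cint => t.
  rewrite -mulrA -CintZr; last exact: (L1d_cis (rowt t) lf).
  apply: eq_Cint => s; rewrite /F /= dotBl cisD /L; ring.
rewrite -(Cint_fubini lF).
transitivity (CI (fun y => (e ^- d)%:C * H (- e^-1 *: y + e^-1 *: x))).
  apply: eq_Cint => s.
  transitivity (f (rowt s) * CI (fun xi => cis (dot (x - rowt s) xi) * L xi)).
    rewrite /CI -(CintZ (f (rowt s)) (lcL (x - rowt s))).
    by apply: eq_Cint => t; rewrite /F /=; ring.
  rewrite inner /H.
  have -> : - e *: (- e^-1 *: rowt s + e^-1 *: x) + x = rowt s.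
    by apply/rowP => j; rewrite !mxE; field.
  have -> : - e^-1 *: rowt s + e^-1 *: x = e^-1 *: (x - rowt s).
    by apply/rowP => j; rewrite !mxE; ring.
  by rewrite [in LHS]rmorphM /=; ring.
have ei0 : - e^-1 != 0 by rewrite oppr_eq0 invr_eq0.
have hH := CI_affine (e^-1 *: x) ei0 lH.
transitivity ((e ^- d)%:C * CI (fun y => H (- e^-1 *: y + e^-1 *: x))).
  exact: CintZ _ (L1d_affine _ ei0 lH).
rewrite hH mulrA -rmorphM /= normrN gtr0_norm ?invr_gt0//.
by rewrite -invfM -exprMn mulfV// expr1n invr1 mul1r.
Qed.

(** Both sides are limits of the regularized inverse transform: the Laplace
    factor tends to 1, and the translates of f tend to f x. *)
Theorem fourier_inversion f x : continuous (Re_fun f) -> continuous (Im_fun f) ->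
  L1d f -> (exists M, forall y, normc (f y) <= M) -> L1d (ft f) ->
  CI (fun xi => ft f xi * cis (dot x xi)) = ((2 * pi) ^+ d)%:C * f x.
Proof.
move=> cr ci lf fM lff; have [M hM] := fM.
have mcis : cmeas (fun t : Td => cis (dot x (rowt t)) : R[i]).
  by apply: cmeas_cis; exact: measurable_dotl.
have <- : CI (fun w : Rd => f x * (2 ^+ d * cauchy_density w)%:C) =
    ((2 * pi) ^+ d)%:C * f x.
  rewrite /CI CintZ; last first.
    by apply: L1_real; exact: (integrableZR _ (@integrable_cauchy R d)).
  rewrite Cint_real RintegralZl//; last exact: integrable_cauchy.
  by rewrite /Rintegral integral_cauchy /= -exprMn mulrC.
apply: (@normc_cvg_unique (regularized f x)).
- apply: (Cint_dominated (g := fun t => normc (ft f (rowt t)))).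
  + move=> n; apply: cmeasM; first by apply: cmeasM => //; case: lff.
    apply: cmeas_real; rewrite (_ : (fun _ => _) =
      fun t : Td => laplace_density (rowt (trow ((n.+1%:R^-1 : R) *: rowt t + 0)))).
      exact: (measurableT_comp (@measurable_laplace R d) (measurable_affine _ _)).
    by apply/funext => t; rewrite trowK addr0.
  + by apply: cmeasM => //; case: lff.
  + by move=> t; apply: cvg_normcM_real; exact: laplace_scale_cvg.
  + exact: L1_normc.
  + move=> n t; rewrite !normc_mul normc_cis mulr1 normc_real.
    by rewrite gtr0_norm ?laplace_density_gt0// ler_piMr ?normc_ge0// laplace_density_le1.
  + by move=> t; rewrite normc_mul normc_cis mulr1.
- under eq_fun do rewrite (regularizedE x _ lf fM).
  apply: (Cint_dominated (g := fun t => M * (2 ^+ d * cauchy_density (rowt t)))).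
  + move=> n; apply: cmeasM; first by apply: rmeas_affine; case: lf.
    apply: cmeas_real; apply: measurable_funM; first exact: measurable_cst.
    exact: measurable_cauchy.
  + apply: cmeasM; first exact: cmeas_cst.
    apply: cmeas_real; apply: measurable_funM; first exact: measurable_cst.
    exact: measurable_cauchy.
  + move=> t.
    have h : normc (f (- (n.+1%:R^-1 : R) *: rowt t + x) - f x) *
        normc ((2 ^+ d * cauchy_density (rowt t))%:C) @[n --> \oo] --> (0 : R).
      rewrite -(mul0r (normc ((2 ^+ d * cauchy_density (rowt t))%:C))).
      apply: cvgM; last exact: cvg_cst.
      apply: continuous_normc_cvg => //.
      by under eq_fun do rewrite scaleNr -scalerN; exact: harmonic_scale_cvg.
    apply: cvg_trans h; apply: near_eq_cvg; apply: nearW => n.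
    by rewrite -normc_mul mulrBl.
  + by apply: integrableZR; apply: integrableZR; exact: integrable_cauchy.
  + move=> n t; rewrite normc_mul normc_real ger0_norm; last first.
      by rewrite mulr_ge0// ltW// cauchy_density_gt0.
    by rewrite ler_wpM2r// mulr_ge0// ltW// cauchy_density_gt0.
  + move=> t; rewrite normc_mul normc_real ger0_norm; last first.
      by rewrite mulr_ge0// ltW// cauchy_density_gt0.
    by rewrite ler_wpM2r// mulr_ge0// ltW// cauchy_density_gt0.
Qed.

End Inversion.

(** * Weights *)

Section Weight.
Variables (R : realType) (d : nat).
Local Notation RT := (measurableTypeR R).
Local Notation Td := (d.-tuple RT).
Local Notation Rd := 'rV[R]_d.
Implicit Types (x y xi : Rd).

Lemma dot_ge0 x : 0 <= dot x x.
Proof. by apply: sumr_ge0 => j _; rewrite -expr2 sqr_ge0. Qed.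
Lemma euclid_ge0 x : 0 <= euclid x. Proof. exact: sqrtr_ge0. Qed.
Lemma euclid_sqr x : euclid x ^+ 2 = dot x x.
Proof. by rewrite sqr_sqrtr// dot_ge0. Qed.
Lemma coord_le_euclid x j : `|x 0 j| <= euclid x.
Proof.
rewrite -sqrtr_sqr ler_wsqrtr// /dot (bigD1 j)//= expr2 lerDl.
by apply: sumr_ge0 => i _; rewrite -expr2 sqr_ge0.
Qed.
Lemma euclidZ (a : R) x : 0 <= a -> euclid (a *: x) = a * euclid x.
Proof.
move=> a0; rewrite /euclid dotZl dotC dotZl mulrA -expr2 sqrtrM ?sqr_ge0//.
by rewrite sqrtr_sqr ger0_norm.
Qed.

(** Cauchy-Schwarz, from the square of |y| x - |x| y. *)
Lemma dot_le_euclid x y : dot x y <= euclid x * euclid y.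
Proof.
have [/eqP x0|x0] := boolP (euclid x * euclid y == 0).
  rewrite x0 le_eqVlt; apply/orP; left; apply/eqP.
  have z (u : Rd) : euclid u = 0 -> u = 0.
    move=> u0; apply/rowP => j; rewrite mxE; apply/eqP; rewrite -normr_le0 -u0.
    exact: coord_le_euclid.
  move/eqP: x0; rewrite mulf_eq0 => /orP[/eqP/z ->|/eqP/z ->].
    by rewrite /dot big1// => j _; rewrite mxE mul0r.
  by rewrite /dot big1// => j _; rewrite mxE mulr0.
have p0 : 0 < euclid x * euclid y by rewrite lt_neqAle eq_sym x0 mulr_ge0 ?euclid_ge0.
rewrite -(ler_pM2l p0) -subr_ge0.
have h : 0 <= dot (euclid y *: x - euclid x *: y) (euclid y *: x - euclid x *: y).
  exact: dot_ge0.
rewrite dotBl ![dot _ (_ - _)]dotC !dotBl !dotZl ![dot _ (_ *: _)]dotC !dotZl in h.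
rewrite -!euclid_sqr [dot y x]dotC in h.
by move: h; set a := euclid x; set b := euclid y; set c := dot x y; nra.
Qed.

Lemma euclidD x y : euclid (x + y) <= euclid x + euclid y.
Proof.
rewrite -[leRHS]ger0_norm ?addr_ge0 ?euclid_ge0// -sqrtr_sqr ler_wsqrtr//.
rewrite dotDl ![dot _ (x + y)]dotC !dotDl -!euclid_sqr [dot y x]dotC.
have := dot_le_euclid x y.
by set a := euclid x; set b := euclid y; set c := dot x y; nra.
Qed.

Lemma measurable_euclid : measurable_fun setT (fun t : Td => euclid (rowt t)).
Proof.
apply: (@measurableT_comp _ _ _ _ _ _ (@Num.sqrt R)).
  by apply: continuous_measurable_fun; exact: sqrt_continuous.
by apply: measurable_sum => j; apply: measurable_funM; exact: measurable_coord.
Qed.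

Variable omega : R -> R.
Hypothesis womega : weight omega.

(** The weight in the integral of [weighted_norm]. *)
Definition wt l xi : R := expR (l * omega (euclid xi)).

Lemma omega_ge0 x : 0 <= omega (euclid x).
Proof. by case: womega => -[h _ _ _] _; apply: h; exact: euclid_ge0. Qed.

Lemma wt_gt0 l xi : 0 < wt l xi. Proof. exact: expR_gt0. Qed.

Lemma wt_ge1 l xi : 0 <= l -> 1 <= wt l xi.
Proof. by move=> l0; rewrite -expR0 ler_expR mulr_ge0// omega_ge0. Qed.

Lemma wtD l x y : 0 <= l -> wt l (x + y) <= wt l x * wt l y.
Proof.
case: womega => -[_ mono _ _] [sub _ _] l0.
rewrite /wt -expRD ler_expR -mulrDr ler_wpM2l//.
rewrite (le_trans _ (sub _ _ (euclid_ge0 _) (euclid_ge0 _)))//.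
by apply: mono; [exact: euclid_ge0|exact: euclidD].
Qed.

Lemma wtM l k xi : wt l xi * wt k xi = wt (l + k) xi.
Proof. by rewrite /wt -expRD mulrDl. Qed.

(** A monotone function is measurable; omega is monotone on the nonnegative reals
    only, so it is first made constant on the negative ones. *)
Lemma measurable_wt l : measurable_fun setT (fun t : Td => wt l (rowt t)).
Proof.
apply: measurableT_comp => //; apply: measurable_funM; first exact: measurable_cst.
have mm : measurable_fun setT (fun r : R => omega (Num.max 0 r)).
  apply: nondecreasing_measurable => // x y xy.
  case: womega => -[_ mono _ _] _; apply: mono; first by rewrite le_max lexx.
  by rewrite ge_max !le_max lexx xy orbT.
under eq_fun do rewrite -[euclid _](max_idPr (euclid_ge0 _)).
exact: (measurableT_comp mm measurable_euclid).
Qed.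

Lemma omega_natM n (t : R) : 0 <= t -> omega (n%:R * t) <= n%:R * omega t.
Proof.
case: womega => -[_ _ _ o0] [sub _ _] t0.
elim: n => [|n IH]; first by rewrite !mul0r o0.
rewrite -addn1 natrD !mulrDl !mul1r (le_trans (sub _ _ _ _))//.
  by rewrite mulr_ge0.
by rewrite lerD2r.
Qed.

Lemma wt_natZ n l xi : 0 <= l -> wt l (n%:R *: xi) <= wt (n%:R * l) xi.
Proof.
move=> l0; rewrite ler_expR euclidZ// [n%:R * l]mulrC -mulrA ler_wpM2l//.
by rewrite omega_natM// euclid_ge0.
Qed.

(** Since omega dominates the logarithm, its exponential dominates the Euclidean
    norm. *)
Lemma coord_le_wt : exists2 C : R, 0 < C & forall xi j, `|xi 0 j| <= C * wt 1 xi.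
Proof.
case: (womega) => _ [_ _ /cvgryPge/(_ 1)] [T [_ hT]].
pose A := `|T| + 1.
have A0 : 0 < A by rewrite ltr_wpDl.
have A1 : 1 <= A by rewrite lerDr.
exists A => // xi j; rewrite (le_trans (coord_le_euclid xi j))//.
have e0 := euclid_ge0 xi.
have [eA|Ae] := leP (euclid xi) A.
  by rewrite (le_trans eA)// ler_peMr ?(ltW A0)// wt_ge1.
have Te : T < euclid xi.
  by rewrite (le_lt_trans _ Ae)// (le_trans (ler_norm _))// lerDl.
have := hT _ Te; set s := euclid xi => h.
have l0 : 0 < ln (1 + s).
  by rewrite ln_gt0// ltrDl (lt_trans A0).
have h2 : ln (1 + s) <= omega s by move: h; rewrite ler_pdivlMr// mul1r.
have h3 : 1 + s <= wt 1 xi.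
  rewrite /wt mul1r -[leLHS]lnK ?ler_expR//.
  by rewrite posrE addr_gt0// (lt_trans A0).
rewrite (le_trans (_ : s <= wt 1 xi))//; first by rewrite (le_trans _ h3)// lerDr.
by rewrite ler_peMl// ltW// wt_gt0.
Qed.

End Weight.

(** * Weighted norms of Fourier transforms *)

Section WeightedNorm.
Variables (R : realType) (d : nat) (omega : R -> R).
Hypothesis womega : weight omega.
Local Notation RT := (measurableTypeR R).
Local Notation Td := (d.-tuple RT).
Local Notation mu := (lebesgue_tuple R d).
Local Notation Rd := 'rV[R]_d.
Local Notation normc := (@Normc.normc R).
Local Notation wnorm := (@weighted_norm R omega d).
Local Notation wt := (wt omega).
Implicit Types (f g : Rd -> R[i]) (x xi eta : Rd).

Definition Cc f := [/\ continuous (Re_fun f), continuous (Im_fun f) &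
  compact (closure [set x | f x != 0])].

Lemma Cc_support f : Cc f -> exists2 B : R, 0 < B &
  forall x, f x != 0 -> forall j, `|x 0 j| <= B.
Proof.
move=> [_ _ /compact_bounded/pinfty_ex_gt0[B B0 hB]].
exists B => // x fx j; rewrite (le_trans (coord_le_norm x j))//.
by apply: hB; exact: subset_closure.
Qed.

Lemma Cc_bounded f : Cc f -> exists2 M : R, 0 <= M & forall x, normc (f x) <= M.
Proof.
move=> [cr ci ck].
have b (u : Rd -> R) : continuous u -> exists2 M : R, 0 < M &
    forall x, closure [set x | f x != 0] x -> `|u x| <= M.
  move=> cu; have := continuous_compact (continuous_subspaceT cu) ck.
  move=> /compact_bounded/pinfty_ex_gt0[M M0 hM].
  by exists M => // x xs; apply: hM; exists x.
have [M1 M10 h1] := b _ cr; have [M2 M20 h2] := b _ ci.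
exists (M1 + M2) => [|x]; first by rewrite addr_ge0// ltW.
have [fx0|fx] := eqVneq (f x) 0.
  by rewrite fx0 normc_0 addr_ge0// ltW.
have xs : closure [set x | f x != 0] x by exact: subset_closure.
by rewrite (le_trans (normc_le_ReIm _))// lerD//; [exact: h1|exact: h2].
Qed.

Lemma cauchy_box (B : R) x : (forall j, `|x 0 j| <= B) ->
  1 <= (1 + B ^+ 2) ^+ d * cauchy_density x.
Proof.
move=> hB; have -> : (1 + B ^+ 2) ^+ d = \prod_(j < d) (1 + B ^+ 2).
  by rewrite prodr_const card_ord.
rewrite /cauchy_density -big_split /=.
apply: (big_ind (fun p => 1 <= p)) => // [p q|j _]; first exact: mulr_ege1.
have B0 : 0 <= B by exact: le_trans (normr_ge0 _) (hB j).
have p : 0 < 1 + x 0 j ^+ 2 by rewrite ltr_pwDl// sqr_ge0.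
rewrite ler_pdivlMr// mul1r lerD2l -[x 0 j ^+ 2]real_normK ?num_real//.
by apply: lerXn2r; rewrite ?nnegrE ?normr_ge0//; exact: hB.
Qed.

Lemma Cc_dominated f : Cc f -> exists2 C : R, 0 <= C &
  forall x, normc (f x) <= C * cauchy_density x.
Proof.
move=> cf; have [M M0 hM] := Cc_bounded cf; have [B B0 hB] := Cc_support cf.
exists (M * (1 + B ^+ 2) ^+ d) => [|x].
  by rewrite mulr_ge0// exprn_ge0// addr_ge0// sqr_ge0.
have [fx0|fx] := eqVneq (f x) 0.
  by rewrite fx0 normc_0 !mulr_ge0// ?exprn_ge0 ?addr_ge0 ?sqr_ge0 ?ltW ?cauchy_density_gt0.
rewrite (le_trans (hM x))// -mulrA ler_peMr//; apply: cauchy_box.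
exact: hB fx.
Qed.

Lemma Cc_L1 f : Cc f -> L1d f.
Proof.
move=> cf; have [C C0 hC] := Cc_dominated cf.
apply: (L1_dom (g := fun t => C * cauchy_density (rowt t))).
- by case: cf => cr ci _; exact: continuous_rmeas.
- by apply: integrableZR; exact: integrable_cauchy.
- by move=> t; exact: hC.
Qed.

Definition finite_norms f := forall l : R, 0 < l -> (wnorm l f < +oo)%E.

Lemma wnormE l f : wnorm l f =
  (\int[mu]_t (normc (ft f (rowt t)) * wt l (rowt t))%:E)%E.
Proof. by []. Qed.

Lemma wnorm_ge0 l f : (0 <= wnorm l f)%E.
Proof.
by apply: integral_ge0 => t _; rewrite lee_fin mulr_ge0 ?normc_ge0// expR_ge0.
Qed.

Lemma measurable_wft l f : L1d f ->
  measurable_fun setT (fun t : Td => normc (ft f (rowt t)) * wt l (rowt t)).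
Proof.
move=> lf; apply: measurable_funM; last exact: measurable_wt.
by apply: measurable_normc; exact: rmeas_ft.
Qed.

Lemma wft_ge0 l f (t : Td) : (0 <= (normc (ft f (rowt t)) * wt l (rowt t))%:E)%E.
Proof. by rewrite lee_fin mulr_ge0 ?normc_ge0// expR_ge0. Qed.

Lemma emeasurable_wft l f : L1d f ->
  measurable_fun setT (fun t : Td => (normc (ft f (rowt t)) * wt l (rowt t))%:E).
Proof. by move=> lf; apply/measurable_EFinP; exact: measurable_wft. Qed.

(** The weight is at least 1, so that a finite weighted norm makes the inversion
    formula available. *)
Lemma wnorm_L1ft l f : 0 <= l -> L1d f -> (wnorm l f < +oo)%E -> L1d (ft f).
Proof.
move=> l0 lf; rewrite wnormE => h; split; first exact: rmeas_ft.
apply: le_lt_trans h; apply: ge0_le_integral => //.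
- by move=> t _; rewrite lee_fin normc_ge0.
- by apply: measurable_normcE; exact: rmeas_ft.
- exact: emeasurable_wft.
- by move=> t _; rewrite lee_fin ler_peMr ?normc_ge0// wt_ge1.
Qed.

Lemma finite_norms_L1ft f : Cc f -> finite_norms f -> L1d (ft f).
Proof.
by move=> cf ff; apply: (@wnorm_L1ft 1) => //; [exact: Cc_L1|exact: ff].
Qed.

(** The constant of the inversion formula. *)
Definition inv2pi : R := ((2 * pi) ^+ d)^-1.
Lemma inv2pi_gt0 : 0 < inv2pi.
Proof. by rewrite invr_gt0 exprn_gt0// mulr_gt0// pi_gt0. Qed.

Lemma Cc_inversion f x : Cc f -> L1d (ft f) ->
  f x = inv2pi%:C * CI (fun xi => ft f xi * cis (dot x xi)).
Proof.
move=> cf lff; have [cr ci _] := cf.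
rewrite fourier_inversion//.
- by rewrite mulrA -rmorphM /= mulVf ?mul1r// expf_neq0// mulf_neq0// gt_eqF// pi_gt0.
- exact: Cc_L1.
- by have [M _ hM] := Cc_bounded cf; exists M.
Qed.

Lemma ftD f g xi : L1d f -> L1d g ->
  ft (fun x => f x + g x) xi = ft f xi + ft g xi.
Proof.
move=> lf lg; rewrite /ft /CI -(CintD (L1d_cis xi lf) (L1d_cis xi lg)).
by apply: eq_Cint => t; rewrite mulrDl.
Qed.

Lemma ftZ f (c : R[i]) xi : L1d f -> ft (fun x => c * f x) xi = c * ft f xi.
Proof.
move=> lf; rewrite /ft /CI -(CintZ c (L1d_cis xi lf)).
by apply: eq_Cint => t; rewrite mulrA.
Qed.

Lemma wnormD l f g : L1d f -> L1d g ->
  (wnorm l (fun x => f x + g x)%R <= wnorm l f + wnorm l g)%E.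
Proof.
move=> lf lg; have mf := emeasurable_wft l lf; have mg := emeasurable_wft l lg.
have mfg := @emeasurable_wft l (fun x => f x + g x) (L1D lf lg).
rewrite !wnormE -(ge0_integralD mu measurableT (fun t _ => wft_ge0 l f t) mf
  (fun t _ => wft_ge0 l g t) mg).
apply: ge0_le_integral => //.
- by move=> t _; exact: wft_ge0.
- exact: emeasurable_funD.
- by move=> t _; rewrite -EFinD lee_fin -mulrDl ler_wpM2r ?expR_ge0// ftD// normcD.
Qed.

Lemma wnormZ l f (c : R[i]) : L1d f ->
  (wnorm l (fun x => c * f x)%R = (normc c)%:E * wnorm l f)%E.
Proof.
move=> lf; have mf := emeasurable_wft l lf.
have c0 : (0 <= (normc c)%:E)%E by rewrite lee_fin normc_ge0.
rewrite !wnormE -(ge0_integralZl mu measurableT mf (fun t _ => wft_ge0 l f t) c0).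
by apply: eq_integral => t _; rewrite ftZ// normc_mul -mulrA EFinM.
Qed.

(** The inversion formula is substituted for f, and the integrals are exchanged. *)
Lemma ft_mul f g xi : Cc f -> L1d (ft f) -> L1d g ->
  ft (fun x => f x * g x) xi =
  inv2pi%:C * CI (fun eta => ft f eta * ft g (xi - eta)).
Proof.
move=> cf lff lg.
pose F (z : Td * Td) : R[i] := g (rowt z.1) * ft f (rowt z.2) *
  cis (dot (rowt z.1) (rowt z.2 - xi)).
have mdot : measurable_fun setT (fun z : Td * Td => dot (rowt z.1) (rowt z.2 - xi)).
  under eq_fun do rewrite dotC dotBl dotC [dot xi _]dotC.
  apply: measurable_funB; first exact: measurable_dot.
  exact: (measurableT_comp (measurable_dotr xi) measurable_fst).
have lF : L1 (mu \x mu)%E F.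
  apply: (L1_tensor (F := fun s => g (rowt s)) (G := fun t => ft f (rowt t))
    (H := fun z => cis (dot (rowt z.1) (rowt z.2 - xi))) (M := 1)) => //.
  - exact: cmeas_cis.
  - by move=> z; rewrite normc_cis.
have lfc x : L1d (fun eta => ft f eta * cis (dot x eta)).
  apply: (L1_mulb (M := 1) lff); first by apply: cmeas_cis; exact: measurable_dotl.
  by move=> t; rewrite normc_cis.
have lFt : L1 mu (fun s => Cint mu (fun t => F (s, t))).
  exact: L1_Cint1.
transitivity (Cint mu (fun s => inv2pi%:C * Cint mu (fun t => F (s, t)))).
  apply: eq_Cint => s; rewrite (Cc_inversion (rowt s) cf lff).
  rewrite -!mulrA; congr (_ * _).
  rewrite mulrC -(CintZ (g (rowt s) * cis (- dot (rowt s) xi)) (lfc (rowt s))).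
  apply: eq_Cint => t; rewrite /F /= [dot _ (_ - _)]dotC dotBl cisD.
  by rewrite [dot xi _]dotC [dot (rowt t) _]dotC; ring.
rewrite CintZ// (Cint_fubini lF); congr (_ * _).
apply: eq_Cint => t; rewrite /ft /CI -(CintZ (ft f (rowt t)) (L1d_cis _ lg)).
apply: eq_Cint => s; rewrite /F /= mulrCA mulrA; congr (_ * _ * cis _).
by rewrite -[xi - _]opprB [dot _ (- _)]dotC dotNl opprK dotC.
Qed.

(** Tonelli's theorem on the convolution formula [ft_mul], after splitting the
    weight at xi into the weights at eta and xi - eta by [wtD]. *)
Lemma wnorm_mul l f g : 0 <= l -> Cc f -> L1d (ft f) -> L1d g -> L1d (ft g) ->
  (wnorm l (fun x => f x * g x)%R <= inv2pi%:E * (wnorm l f * wnorm l g))%E.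
Proof.
move=> l0 cf lff lg lfg.
have lf := Cc_L1 cf.
have [M M0 hM] := Cc_bounded cf.
have lm : L1d (fun x => f x * g x) by apply: (L1_mulbl lg lf.1) => t; exact: hM.
pose a xi := normc (ft f xi) * wt l xi.
pose b xi := normc (ft g xi) * wt l xi.
have a0 xi : 0 <= a xi by rewrite mulr_ge0 ?normc_ge0// ltW// expR_gt0.
have b0 xi : 0 <= b xi by rewrite mulr_ge0 ?normc_ge0// ltW// expR_gt0.
have ma : measurable_fun setT (fun t : Td => a (rowt t)) by exact: measurable_wft.
have mb : measurable_fun setT (fun t : Td => b (rowt t)) by exact: measurable_wft.
have mab : measurable_fun setT
    (fun z : Td * Td => (a (rowt z.2) * b (rowt z.1 - rowt z.2))%:E).
  apply/measurable_EFinP; apply: measurable_funM.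
    exact: (measurableT_comp ma measurable_snd).
  have md : measurable_fun setT (fun z : Td * Td => trow (rowt z.1 - rowt z.2) : Td).
    apply: measurable_trow => j; under eq_fun do rewrite !mxE -!rowtE.
    apply: measurable_funB.
      exact: (measurableT_comp (@measurable_coord R d j) measurable_fst).
    exact: (measurableT_comp (@measurable_coord R d j) measurable_snd).
  have := measurableT_comp mb md.
  by rewrite (_ : _ \o _ = fun z : Td * Td => b (rowt z.1 - rowt z.2))//;
    apply/funext => z /=; rewrite trowK.
have ab0 (z : Td * Td) : (0 <= (a (rowt z.2) * b (rowt z.1 - rowt z.2))%:E)%E.
  by rewrite lee_fin mulr_ge0.
have k0 : (0 <= inv2pi%:E)%E by rewrite lee_fin ltW// inv2pi_gt0.
have mi := measurable_fun_fubini_tonelli_F (m2 := mu) _ mab ab0.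
have [Mg hMg] : exists M, forall xi, normc (ft g xi) <= M.
  by exists (\int[mu]_t normc (g (rowt t))) => xi; exact: normc_ft_le.
apply: (@le_trans _ _ (\int[mu]_t (inv2pi%:E *
    \int[mu]_s (a (rowt s) * b (rowt t - rowt s))%:E))%E).
  rewrite wnormE; apply: ge0_le_integral => //.
  - by move=> t _; exact: wft_ge0.
  - exact: emeasurable_wft.
  - exact: measurable_funeM.
  - move=> t _; have ml : L1d (fun eta => ft f eta * ft g (rowt t - eta)).
      apply: (L1_mulb lff (M := Mg)) => [|s]; last exact: hMg.
      have := rmeas_affine (-1) (rowt t) (rmeas_ft lg).
      by rewrite /rmeas; under eq_fun do rewrite scaleN1r addrC.
    have E1 : normc (ft (fun x => f x * g x) (rowt t)) = inv2pi *
        normc (CI (fun eta => ft f eta * ft g (rowt t - eta))).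
      have hft := ft_mul (rowt t) cf lff lg.
      by rewrite hft normc_mul normc_real gtr0_norm ?inv2pi_gt0.
    have mn := measurable_normcE ml.1.
    have w0 : (0 <= (wt l (rowt t))%:E)%E by rewrite lee_fin expR_ge0.
    have n0 (s : Td) : (0 <= (normc (ft f (rowt s) * ft g (rowt t - rowt s)))%:E)%E.
      by rewrite lee_fin normc_ge0.
    rewrite E1 -mulrA EFinM; apply: lee_wpmul2l => //; rewrite EFinM.
    apply: (le_trans (lee_wpmul2r w0 (normc_CintE ml))).
    rewrite -(ge0_integralZr mu measurableT mn (fun s _ => n0 s) w0).
    apply: ge0_le_integral => //.
    + by move=> s _; rewrite mule_ge0.
    + by apply: emeasurable_funM => //; exact: measurable_cst.
    + exact: (measurableT_comp mab (pair1_measurable t)).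
    + move=> s _; rewrite -EFinM lee_fin normc_mul /a /b mulrACA.
      rewrite ler_wpM2l ?mulr_ge0 ?normc_ge0//.
      have := wtD womega (rowt s) (rowt t - rowt s) l0.
      by rewrite addrC subrK.
rewrite (ge0_integralZl mu measurableT mi _ k0); last first.
  by move=> t _; apply: integral_ge0 => s _; exact: ab0 (t, s).
apply: lee_wpmul2l => //; rewrite /fubini_F (fubini_tonelli (m1 := mu) (m2 := mu) _ mab ab0) /=.
rewrite (eq_integral (fun s : Td => (a (rowt s))%:E * wnorm l g)%E).
  rewrite ge0_integralZr//.
  - exact/measurable_EFinP.
  - by move=> s _; rewrite lee_fin.
  - exact: wnorm_ge0.
move=> s _.
have mbs : measurable_fun setT (fun t : Td => (b (rowt t - rowt s))%:E).
  apply/measurable_EFinP.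
  have := measurableT_comp mb (measurable_affine 1 (- rowt s)).
  by rewrite (_ : _ \o _ = fun t : Td => b (rowt t - rowt s))//;
    apply/funext => t /=; rewrite trowK scale1r.
have bs0 (t : Td) : (0 <= (b (rowt t - rowt s))%:E)%E by rewrite lee_fin.
have as0 : (0 <= (a (rowt s))%:E)%E by rewrite lee_fin.
transitivity (\int[mu]_t ((a (rowt s))%:E * (b (rowt t - rowt s))%:E))%E.
  by apply: eq_integral => t _; rewrite EFinM.
have hb : (\int[mu]_t (b (rowt t - rowt s))%:E = wnorm l g)%E.
  have := integral_affineR (h := b) (- rowt s) (oner_neq0 R) mb b0.
  rewrite normr1 expr1n invr1 mul1e wnormE => <-.
  by apply: eq_integral => t _; rewrite scale1r.
by rewrite (ge0_integralZl mu measurableT mbs (fun t _ => bs0 t) as0) hb.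
Qed.

End WeightedNorm.

(** * The algebra of test functions *)

Section TestFunctions.
Variables (R : realType) (d : nat) (omega : R -> R).
Hypothesis womega : weight omega.
Local Notation mu := (lebesgue_tuple R d).
Local Notation Rd := 'rV[R]_d.
Implicit Types (f g : Rd -> R[i]) (x xi eta : Rd).

Lemma Cc_add f g : Cc f -> Cc g -> Cc (fun x => f x + g x).
Proof.
move=> [rf If kf] [rg Ig kg]; split.
- rewrite (_ : Re_fun _ = fun x => Re_fun f x + Re_fun g x).
    by move=> x; exact: cvgD (rf x) (rg x).
  by apply/funext => x; rewrite /Re_fun Re_add.
- rewrite (_ : Im_fun _ = fun x => Im_fun f x + Im_fun g x).
    by move=> x; exact: cvgD (If x) (Ig x).
  by apply/funext => x; rewrite /Im_fun Im_add.
- apply: (subclosed_compact (@closed_closure _ _) (compactU kf kg)).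
  rewrite -closureU; apply: closure_subset => x /= h.
  by apply/orP; rewrite -negb_and; apply: contra h => /andP[/eqP -> /eqP ->]; rewrite addr0.
Qed.

Lemma continuous_mul_ReIm f g : continuous (Re_fun f) -> continuous (Im_fun f) ->
  continuous (Re_fun g) -> continuous (Im_fun g) ->
  continuous (Re_fun (fun x => f x * g x)) /\ continuous (Im_fun (fun x => f x * g x)).
Proof.
move=> rf If rg Ig; split.
  rewrite (_ : Re_fun _ = fun x => Re_fun f x * Re_fun g x - Im_fun f x * Im_fun g x).
    by move=> x; exact: cvgB (cvgM (rf x) (rg x)) (cvgM (If x) (Ig x)).
  by apply/funext => x; rewrite /Re_fun Re_mul.
rewrite (_ : Im_fun _ = fun x => Re_fun f x * Im_fun g x + Im_fun f x * Re_fun g x).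
  by move=> x; exact: cvgD (cvgM (rf x) (Ig x)) (cvgM (If x) (rg x)).
by apply/funext => x; rewrite /Im_fun Im_mul.
Qed.

Lemma Cc_mul f g : Cc f -> continuous (Re_fun g) -> continuous (Im_fun g) ->
  Cc (fun x => f x * g x).
Proof.
move=> [rf If kf] rg Ig; have [cr ci] := continuous_mul_ReIm rf If rg Ig.
split=> //; apply: (subclosed_compact (@closed_closure _ _) kf).
apply: closure_subset => x /=; apply: contra => /eqP ->.
by rewrite mul0r.
Qed.

Lemma Cc_scale f c : Cc f -> Cc (fun x => c * f x).
Proof.
move=> cf; under eq_fun do rewrite mulrC.
apply: (@Cc_mul f (fun=> c)) => //.
  exact: (@cst_continuous Rd R (complex.Re c)).
exact: (@cst_continuous Rd R (complex.Im c)).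
Qed.

Variable Omega : set Rd.
Local Notation test := (@test_function R omega d Omega).

(** Separates the regularity, which is independent of the weight, from the
    support and from the norms. *)
Lemma testP f : test f <-> [/\ Cc f, closure [set x | f x != 0] `<=` Omega &
  finite_norms omega f].
Proof. by split=> [[[? ?] ? ? ?]|[[? ? ?] ? ?]]; split. Qed.

Lemma test_L1 f : test f -> L1d f. Proof. by move=> /testP[/Cc_L1]. Qed.
Lemma test_L1ft f : test f -> L1d (ft f).
Proof. by move=> /testP[cf _ ff]; exact: (finite_norms_L1ft womega cf ff). Qed.

Lemma test_add f g : test f -> test g -> test (fun x => f x + g x).
Proof.
move=> tf tg; have lf := test_L1 tf; have lg := test_L1 tg.
move: tf tg => /testP[cf sf ff] /testP[cg sg fg]; apply/testP; split.
- exact: Cc_add.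
- move=> x; have : closure [set x | f x + g x != 0] `<=`
      closure ([set x | f x != 0] `|` [set x | g x != 0]).
    apply: closure_subset => y /= h.
    by apply/orP; rewrite -negb_and; apply: contra h => /andP[/eqP -> /eqP ->]; rewrite addr0.
  by move=> /[apply]; rewrite closureU => -[/sf|/sg].
- move=> l l0; apply: (le_lt_trans (wnormD womega l lf lg)).
  by rewrite lte_add_pinfty//; [exact: ff|exact: fg].
Qed.

Lemma test_scale f c : test f -> test (fun x => c * f x).
Proof.
move=> tf; have lf := test_L1 tf; move: tf => /testP[cf sf ff]; apply/testP; split.
- exact: Cc_scale.
- apply: subset_trans sf; apply: closure_subset => x /=; apply: contra => /eqP ->.
  by rewrite mulr0.
- move=> l l0; rewrite (wnormZ womega l c lf) lte_mul_pinfty//.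
    by rewrite lee_fin normc_ge0.
  exact: ff.
Qed.

Lemma test_mul f g : test f -> test g -> test (fun x => f x * g x).
Proof.
move=> tf tg; have lf := test_L1ft tf; have lfg := test_L1ft tg.
have lg := test_L1 tg.
move: tf tg => /testP[cf sf ff] /testP[[rg ig kg] sg fg]; apply/testP; split.
- exact: Cc_mul.
- apply: subset_trans sf; apply: closure_subset => x /=; apply: contra => /eqP ->.
  by rewrite mul0r.
- move=> l l0; apply: (le_lt_trans (wnorm_mul womega (ltW l0) cf lf lg lfg)).
  rewrite lte_mul_pinfty//; first by rewrite lee_fin ltW// inv2pi_gt0.
  rewrite lte_mul_pinfty//; [exact: wnorm_ge0| |exact: fg].
  by rewrite ge0_fin_numE ?wnorm_ge0//; exact: ff.
Qed.

Lemma test0 : test (fun=> 0).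
Proof.
pose z : Rd -> R[i] := fun=> 0; rewrite -[X in test X]/z.
have E : [set x : Rd | z x != 0] = set0.
  by apply/seteqP; split=> x //=; rewrite eqxx.
have c0 : Cc z.
  split.
  - exact: (@cst_continuous Rd R (complex.Re (0 : R[i]))).
  - exact: (@cst_continuous Rd R (complex.Im (0 : R[i]))).
  - by rewrite E closure0; exact: compact0.
apply/testP; split=> //; first by rewrite E closure0.
move=> l l0; rewrite wnormE (eq_integral (cst 0%E)) ?integral0//.
move=> t _; rewrite (_ : ft _ _ = 0) ?normc_0 ?mul0r//.
rewrite /ft /CI -(_ : Cint mu (fun=> 0) = 0).
  by apply: eq_Cint => s; rewrite mul0r.
by rewrite /Cint /= Rintegral_cst// mul0r.
Qed.

End TestFunctions.

(** * Derivatives of test functions *)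

Section TrigBounds.
Variable R : realType.
Implicit Types t : R.

Let mvt_origin (f df : R -> R) t : (forall x, is_derive x (1 : R) f (df x)) ->
  exists2 c, `|c| <= `|t| & f t - f 0 = df c * t.
Proof.
move=> dfE.
have cf (A : set R) : {within A, continuous f}.
  apply: continuous_subspaceT => x.
  by apply/differentiable_continuous/derivable1_diffP; exact: ex_derive.
have [t0|t0] := leP 0 t.
  have [c /[!in_itv]/= /andP[c0 ct] E] := MVT_segment t0 (fun x _ => dfE x) (cf _).
  by exists c; [rewrite !ger0_norm|rewrite E subr0].
have [c /[!in_itv]/= /andP[c0 ct] E] := MVT_segment (ltW t0) (fun x _ => dfE x) (cf _).
exists c; first by rewrite !ler0_norm ?lerN2// ltW.
by rewrite -opprB E sub0r mulrN opprK.
Qed.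

Lemma norm_sin_le t : `|sin t| <= `|t|.
Proof.
have [c _] := @mvt_origin sin cos t (fun x => is_derive_sin x).
rewrite sin0 subr0 => ->; rewrite normrM ler_piMl//.
by rewrite ler_norml cos_geN1 cos_le1.
Qed.

Lemma norm_1cos_le t : `|cos t - 1| <= t ^+ 2.
Proof.
have [c ct] := @mvt_origin cos (fun x => - sin x) t (fun x => is_derive_cos x).
rewrite cos0 => ->; rewrite normrM normrN -real_normK ?num_real// expr2.
by rewrite ler_wpM2r// (le_trans (norm_sin_le c)).
Qed.

Lemma norm_1cos_le1 t : `|cos t - 1| <= `|t|.
Proof.
have [c ct] := @mvt_origin cos (fun x => - sin x) t (fun x => is_derive_cos x).
by rewrite cos0 => ->; rewrite normrM normrN ler_piMl// sin_max.
Qed.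

Lemma norm_sinB_le t : `|sin t - t| <= t ^+ 2.
Proof.
have d x : is_derive x (1 : R) (fun y => sin y - y) (cos x - 1).
  exact: (is_deriveB (is_derive_sin x) (is_derive_id x 1)).
have [c ct] := @mvt_origin _ _ t d; rewrite sin0 !subr0 => ->.
rewrite normrM -real_normK ?num_real// expr2 ler_wpM2r//.
by rewrite (le_trans (norm_1cos_le1 c)).
Qed.

Lemma normc_cisB (a b : R) : Normc.normc (cis a - cis b : R[i]) <= 2 * `|a - b|.
Proof.
have -> : cis a - cis b = cis b * (cis (a - b) - 1) :> R[i].
  by rewrite mulrBr mulr1 -cisD [b + _]addrC subrK.
rewrite normc_mul normc_cis mul1r (le_trans (normc_le_ReIm _))//.
rewrite mulr_natl mulr2n !ReIm_simp /= oppr0 addr0.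
by rewrite lerD ?norm_1cos_le1 ?norm_sin_le.
Qed.

Lemma normc_cis1B (t : R) :
  Normc.normc (cis t - 1 - (0 +i* t) : R[i]) <= 2 * t ^+ 2.
Proof.
rewrite (le_trans (normc_le_ReIm _))// mulr_natl mulr2n !ReIm_simp /= !oppr0 !addr0.
by rewrite lerD ?norm_1cos_le ?norm_sinB_le.
Qed.

End TrigBounds.

(** A quadratic remainder in one direction is all that is known of the inverse
    transform, and it suffices for a directional derivative. *)
Lemma is_derive_quadratic (R : realType) (V : normedModType R) (u : V -> R)
    (x e : V) (L C : R) : (forall s : R, `|u (s *: e + x) - u x - s * L| <= C * s ^+ 2) ->
  is_derive x e u L.
Proof.
move=> h.
have c : (fun s : R => s^-1 *: (u (s *: e + x) - u x)) @ 0^' --> L.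
  apply/cvgrPdist_le => eps e0.
  have C0 : 0 <= C.
    by have := h 1; rewrite expr1n mulr1; apply: le_trans.
  have p0 : 0 < eps / (C + 1) by rewrite divr_gt0// ltr_wpDl.
  near=> s.
  have s0 : s != 0 by near: s; exact: nbhs_dnbhs_neq.
  have sp : `|s| < eps / (C + 1).
    near: s; exact: dnbhs0_lt.
  rewrite distrC -(ler_pM2l (_ : 0 < `|s|)) ?normr_gt0//.
  rewrite -normrM /GRing.scale /= mulrBr mulrA mulfV// mul1r.
  rewrite (le_trans (h s))// -real_normK ?num_real// expr2 mulrCA ler_wpM2l//.
  move: sp; rewrite ltr_pdivlMr ?ltr_wpDl// => sp.
  by rewrite (le_trans _ (ltW sp))// mulrC ler_wpM2l// lerDl.
by split; [exact: cvgP c|exact: cvg_lim c].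
Unshelve. all: by end_near. Qed.

Section Moments.
Variables (R : realType) (d : nat) (omega : R -> R).
Hypothesis womega : weight omega.
Local Notation RT := (measurableTypeR R).
Local Notation Td := (d.-tuple RT).
Local Notation mu := (lebesgue_tuple R d).
Local Notation Rd := 'rV[R]_d.
Local Notation normc := (@Normc.normc R).
Local Notation wt := (wt omega).
Implicit Types (h p f : Rd -> R[i]) (x y xi : Rd) (l k : R).

(** Finiteness of the integral that defines [weighted_norm], for a function that
    need not be a transform. *)
Definition moment l h := rmeas h /\
  (\int[mu]_t (normc (h (rowt t)) * wt l (rowt t))%:E < +oo)%E.

Definition inv_ft h x : R[i] := CI (fun xi => h xi * cis (dot x xi)).

Lemma moment_integrable l h : moment l h ->
  mu.-integrable setT (EFin \o (fun t => normc (h (rowt t)) * wt l (rowt t))).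
Proof.
move=> [mh hoo]; apply/integrableP; split.
  apply/measurable_EFinP; apply: measurable_funM; first exact: measurable_normc.
  exact: measurable_wt.
by under eq_integral do rewrite /= ger0_norm ?mulr_ge0 ?normc_ge0 ?expR_ge0//.
Qed.

Lemma moment_L1 l h : 0 <= l -> moment l h -> L1d h.
Proof.
move=> l0 mh; apply: (L1_dom _ (moment_integrable mh)); first by case: mh.
by move=> t; rewrite ler_peMr ?normc_ge0// wt_ge1.
Qed.

Lemma moment_mul l k C h p : moment (l + k) h -> rmeas p ->
  (forall xi, normc (p xi) <= C * wt k xi) -> moment l (fun xi => h xi * p xi).
Proof.
move=> mh mp hp; have [rh _] := mh; split; first exact: cmeasM.
have : mu.-integrable setT (EFin \o (fun t =>
    normc (h (rowt t) * p (rowt t)) * wt l (rowt t))).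
  apply: (integrable_dom _ (integrableZR C (moment_integrable mh))).
    apply: measurable_funM; last exact: measurable_wt.
    by apply: measurable_normc; exact: cmeasM.
  move=> t; rewrite ger0_norm ?mulr_ge0 ?normc_ge0 ?expR_ge0// normc_mul -mulrA.
  rewrite [leRHS]mulrCA ler_wpM2l ?normc_ge0// -wtM [leRHS]mulrCA [leLHS]mulrC.
  by rewrite ler_wpM2l ?expR_ge0.
move=> /integrableP[_].
by under eq_integral do rewrite /= ger0_norm ?mulr_ge0 ?normc_ge0 ?expR_ge0//.
Qed.

Lemma L1d_inv h x : L1d h -> L1d (fun xi => h xi * cis (dot x xi)).
Proof.
move=> lh; apply: (L1_mulb (M := 1) lh); first by apply: cmeas_cis; exact: measurable_dotl.
by move=> t; rewrite normc_cis.
Qed.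

Lemma normc_CI_le l C h (F : Rd -> R[i]) : moment l h -> L1d F ->
  (forall xi, normc (F xi) <= C * (normc (h xi) * wt l xi)) ->
  normc (CI F) <= C * \int[mu]_t (normc (h (rowt t)) * wt l (rowt t)).
Proof.
move=> mh lF hF; rewrite (le_trans (normc_Cint lF))//.
rewrite -RintegralZl//; last exact: moment_integrable.
apply: le_Rintegral => //; first exact: L1_normc.
exact: integrableZR (moment_integrable mh).
Qed.

Lemma normc_dot_le A x xi : (forall j, `|xi 0 j| <= A) -> `|dot x xi| <= (d%:R * A) * `|x|.
Proof.
move=> hA; rewrite (le_trans (ler_norm_sum _ _ _))//.
rewrite (le_trans (ler_sum _ (_ : forall j, _ -> _ <= A * `|x|)))//.
  move=> j _; rewrite normrM mulrC ler_pM//; exact: coord_le_norm.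
by rewrite sumr_const card_ord -mulrA mulr_natl.
Qed.

(** Moments of h give smoothness of its inverse transform.  A coordinate xi_j
    costs one unit of the exponent of the weight, so one moment bounds the
    increments. *)
Lemma inv_ft_lipschitz h : moment 1 h -> exists2 L : R, 0 <= L &
  forall x y, normc (inv_ft h x - inv_ft h y) <= L * `|x - y|.
Proof.
move=> mh; have [A A0 hA] := coord_le_wt d womega.
have lh := moment_L1 ler01 mh.
set J := \int[mu]_t (normc (h (rowt t)) * wt 1 (rowt t)).
have J0 : 0 <= J.
  by apply: Rintegral_ge0 => t _; rewrite mulr_ge0 ?normc_ge0 ?expR_ge0.
exists (2 * (d%:R * A) * J) => [|x y].
  by rewrite mulr_ge0// mulr_ge0// mulr_ge0// ltW.
rewrite /inv_ft /CI -(CintB (L1d_inv x lh) (L1d_inv y lh)).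
have lF : L1d (fun xi => h xi * (cis (dot x xi) - cis (dot y xi))).
  apply: (L1_mulb (M := 1 + 1) lh).
    rewrite (_ : (fun _ => _) = fun t : Td =>
        cis (dot x (rowt t)) + (-1) * cis (dot y (rowt t)) : R[i]); last first.
      by apply/funext => t; rewrite mulN1r.
    apply: cmeasD; first by apply: cmeas_cis; exact: measurable_dotl.
    apply: cmeasM; first exact: cmeas_cst.
    by apply: cmeas_cis; exact: measurable_dotl.
  by move=> t; rewrite (le_trans (normcB _ _))// !normc_cis.
rewrite (_ : (fun _ => _) =
    fun t : Td => h (rowt t) * (cis (dot x (rowt t)) - cis (dot y (rowt t)))); last first.
  by apply/funext => t; rewrite mulrBr.
rewrite mulrAC; apply: (normc_CI_le mh lF) => xi.
rewrite normc_mul mulrCA ler_wpM2l ?normc_ge0//.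
rewrite (le_trans (normc_cisB _ _))// -dotBl -!mulrA ler_wpM2l//.
rewrite (le_trans (normc_dot_le _ (hA xi)))//.
by rewrite le_eqVlt; apply/orP; left; apply/eqP; ring.
Qed.

(** Two moments bound the second order remainder, by
    |exp (i t) - 1 - i t| <= 2 t ^+ 2. *)
Lemma inv_ft_taylor h (j : 'I_d) : moment 2 h -> exists C : R, forall x (s : R),
  normc (inv_ft h (s *: delta_mx 0 j + x) - inv_ft h x -
    s%:C * inv_ft (fun xi => h xi * (0 +i* xi 0 j)) x) <= C * s ^+ 2.
Proof.
move=> mh; have [A A0 hA] := coord_le_wt d womega.
have lh := moment_L1 (ler0n R 2) mh.
set J := \int[mu]_t (normc (h (rowt t)) * wt 2 (rowt t)).
exists (2 * A ^+ 2 * J) => x s.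
have rj : rmeas (fun xi : Rd => 0 +i* xi 0 j).
  by split => /=; [exact: measurable_cst|exact: measurable_coord].
have hp xi : normc (0 +i* xi 0 j) <= A * wt 1 xi.
  by rewrite normcE2 /= expr0n add0r sqrtr_sqr; exact: hA.
have mh11 : moment (1 + 1) h by [].
have lhj := moment_L1 ler01 (moment_mul mh11 rj hp).
have lj := L1d_inv x lhj.
pose F xi := h xi * cis (dot x xi) * (cis (s * xi 0 j) - 1 - (0 +i* (s * xi 0 j))).
have FE t : F (rowt t) = h (rowt t) * cis (dot (s *: delta_mx 0 j + x) (rowt t)) -
    h (rowt t) * cis (dot x (rowt t)) -
    s%:C * (h (rowt t) * (0 +i* rowt t 0 j) * cis (dot x (rowt t))).
  have -> : dot (s *: delta_mx 0 j + x) (rowt t) = s * rowt t 0 j + dot x (rowt t).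
    rewrite dotDl dotZl; congr (_ * _ + _); rewrite /dot (bigD1 j)//= mxE !eqxx mul1r.
    by rewrite big1 ?addr0// => i /negbTE ij; rewrite mxE ij andbF mul0r.
  rewrite /F cisD (_ : (0 +i* (s * rowt t 0 j)) = s%:C * (0 +i* rowt t 0 j)).
    ring.
  by apply: complex_eqP; rewrite ReIm_simp /= ?mul0r ?mulr0 ?subr0 ?addr0.
have lF1 := L1d_inv (s *: delta_mx 0 j + x) lh.
have lF2 := L1d_inv x lh.
have lF3 := L1Z s%:C lj.
have lF12 : L1 mu (fun t => h (rowt t) * cis (dot (s *: delta_mx 0 j + x) (rowt t)) -
    h (rowt t) * cis (dot x (rowt t))).
  rewrite (_ : (fun _ => _) = fun t : Td =>
      h (rowt t) * cis (dot (s *: delta_mx 0 j + x) (rowt t)) +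
      (-1) * (h (rowt t) * cis (dot x (rowt t)))); last first.
    by apply/funext => t; rewrite mulN1r.
  by apply: L1D => //; exact: L1Z.
have lF : L1d F.
  rewrite /L1d; under eq_fun do rewrite FE.
  rewrite (_ : (fun _ => _) = fun t : Td =>
      (h (rowt t) * cis (dot (s *: delta_mx 0 j + x) (rowt t)) -
      h (rowt t) * cis (dot x (rowt t))) +
      (-1) * (s%:C * (h (rowt t) * (0 +i* rowt t 0 j) * cis (dot x (rowt t))))); last first.
    by apply/funext => t; rewrite mulN1r.
  by apply: L1D => //; exact: L1Z.
have -> : inv_ft h (s *: delta_mx 0 j + x) - inv_ft h x -
    s%:C * inv_ft (fun xi => h xi * (0 +i* xi 0 j)) x = CI F.
  rewrite /inv_ft /CI -(CintZ _ lj) -(CintB lF1 lF2) -(CintB lF12 lF3).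
  by apply: eq_Cint => t; rewrite FE.
rewrite [leRHS]mulrAC; apply: (normc_CI_le mh lF) => xi.
rewrite !normc_mul normc_cis mulr1 [leRHS]mulrCA ler_wpM2l ?normc_ge0//.
rewrite (le_trans (normc_cis1B _))// exprMn.
have q : xi 0 j ^+ 2 <= A ^+ 2 * wt 2 xi.
  have -> : A ^+ 2 * wt 2 xi = (A * wt 1 xi) ^+ 2.
    by rewrite exprMn; congr (_ * _); rewrite expr2 wtM.
  rewrite -real_normK ?num_real//.
  by apply: lerXn2r; rewrite ?nnegrE ?normr_ge0 ?mulr_ge0 ?expR_ge0 ?(ltW A0)//; exact: hA.
by have := ler_wpM2l (sqr_ge0 s) q; lra.
Qed.

Lemma lipschitz_continuous f : (exists2 L : R, 0 <= L &
    forall x y, normc (f x - f y) <= L * `|x - y|) ->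
  continuous (Re_fun f) /\ continuous (Im_fun f).
Proof.
move=> [L L0 hL].
have K (u : Rd -> R) : (forall x y, `|u x - u y| <= L * `|x - y|) -> continuous u.
  move=> hu x; apply/(@cvgrPdist_le _ _ _ (nbhs x) (nbhs_filter x)) => e e0.
  have L1 : 0 < L + 1 by rewrite ltr_wpDl.
  near=> y; rewrite (le_trans (hu x y))//.
  have : `|x - y| <= e / (L + 1).
    by near: y; apply: cvgr_dist_le; [exact: cvg_id|rewrite divr_gt0].
  rewrite ler_pdivlMr// => h; rewrite (le_trans _ h)// mulrC ler_wpM2l//.
  by rewrite lerDl.
split; apply: K => x y; rewrite (le_trans _ (hL x y))//.
  by rewrite /Re_fun -Re_opp -Re_add normcRe.
by rewrite /Im_fun -Im_opp -Im_add normcIm.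
Unshelve. all: by end_near. Qed.

End Moments.

Lemma closure_subclosure (T : topologicalType) (A B : set T) :
  A `<=` closure B -> closure A `<=` closure B.
Proof.
move=> /closure_subset AB; have E : closure B = closure (closure B).
  by apply/closure_id; exact: closed_closure.
by rewrite E.
Qed.

Section Derivative.
Variables (R : realType) (d : nat) (omega : R -> R).
Hypothesis womega : weight omega.
Local Notation mu := (lebesgue_tuple R d).
Local Notation Rd := 'rV[R]_d.
Local Notation normc := (@Normc.normc R).
Local Notation wnorm := (@weighted_norm R omega d).
Local Notation wt := (wt omega).
Variable Omega : set Rd.
Local Notation test := (@test_function R omega d Omega).
Local Notation k := (inv2pi R d).
Implicit Types (f : Rd -> R[i]) (x xi : Rd) (j : 'I_d).

Lemma test_moment l f : 0 < l -> test f -> moment omega l (ft f).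
Proof.
move=> l0 tf; have lf := test_L1 tf; split; first exact: rmeas_ft.
by case/testP : tf => _ _ /(_ _ l0).
Qed.

Lemma test_inv_ft f x : test f -> f x = k%:C * inv_ft (ft f) x.
Proof.
move=> tf; have lft := test_L1ft womega tf.
by move: tf => /testP[cf _ _]; exact: Cc_inversion.
Qed.

(** Differentiation of the inversion formula under the integral.  [partial_dtest]
    identifies it with the partial derivative; the formula gives its continuity and its
    integrability without differentiating twice. *)
Definition dtest j f x : R[i] := k%:C * inv_ft (fun xi => ft f xi * (0 +i* xi 0 j)) x.

Let rj j : rmeas (fun xi : Rd => 0 +i* xi 0 j).
Proof. by split => /=; [exact: measurable_cst|exact: measurable_coord]. Qed.

Lemma dtest_taylor j f : test f -> exists C : R, forall x (s : R),
  normc (f (s *: delta_mx 0 j + x) - f x - s%:C * dtest j f x) <= C * s ^+ 2.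
Proof.
move=> tf; have [C hC] := inv_ft_taylor womega j (test_moment (ltr0n R 2) tf).
exists (k * C) => x s; rewrite !(test_inv_ft _ tf) /dtest mulrCA -!mulrBr normc_mul.
rewrite normc_real gtr0_norm ?inv2pi_gt0// -mulrA ler_wpM2l//.
by rewrite ltW// inv2pi_gt0.
Qed.

Lemma is_derive_dtest j f x : test f ->
  is_derive x (delta_mx 0 j) (Re_fun f) (complex.Re (dtest j f x)) /\
  is_derive x (delta_mx 0 j) (Im_fun f) (complex.Im (dtest j f x)).
Proof.
move=> /(dtest_taylor j)[C hC].
have K (a b c : R[i]) (s : R) :
    `|complex.Re a - complex.Re b - s * complex.Re c| <= normc (a - b - s%:C * c) /\
    `|complex.Im a - complex.Im b - s * complex.Im c| <= normc (a - b - s%:C * c).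
  split; [have := normcRe (a - b - s%:C * c)|have := normcIm (a - b - s%:C * c)].
    by rewrite !ReIm_simp /= mul0r subr0.
  by rewrite !ReIm_simp /= mul0r addr0.
by split; apply: (is_derive_quadratic (C := C)) => s;
  have [kr ki] := K (f (s *: delta_mx 0 j + x)) (f x) (dtest j f x) s;
  rewrite (le_trans _ (hC x s)).
Qed.

Lemma partial_dtest j f x : test f ->
  partial j (Re_fun f) x = complex.Re (dtest j f x) /\
  partial j (Im_fun f) x = complex.Im (dtest j f x).
Proof.
by move=> /(is_derive_dtest j x)[h1 h2]; split;
  [exact: (@derive_val _ _ _ _ _ _ _ h1)|exact: (@derive_val _ _ _ _ _ _ _ h2)].
Qed.

Lemma test_lipschitz f : test f -> exists2 L : R, 0 <= L &
  forall x y, normc (f x - f y) <= L * `|x - y|.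
Proof.
move=> tf; have [L L0 hL] := inv_ft_lipschitz womega (test_moment ltr01 tf).
have k0 : 0 <= k by rewrite ltW// inv2pi_gt0.
exists (k * L) => [|x y]; first exact: mulr_ge0.
rewrite !(test_inv_ft _ tf) -mulrBr normc_mul.
by rewrite normc_real ger0_norm// -mulrA ler_wpM2l.
Qed.

Lemma dtest_continuous j f : test f ->
  continuous (Re_fun (dtest j f)) /\ continuous (Im_fun (dtest j f)).
Proof.
move=> tf; apply: lipschitz_continuous.
have [A A0 hA] := coord_le_wt d womega.
have hp xi : normc (0 +i* xi 0 j) <= A * wt 1 xi.
  by rewrite normcE2 /= expr0n add0r sqrtr_sqr; exact: hA.
have m2 : moment omega (1 + 1) (ft f) by exact: test_moment.
have [L L0 hL] := inv_ft_lipschitz womega (moment_mul womega m2 (rj j) hp).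
have k0 : 0 <= k by rewrite ltW// inv2pi_gt0.
exists (k * L) => [|x y]; first exact: mulr_ge0.
by rewrite /dtest -mulrBr normc_mul normc_real ger0_norm// -mulrA ler_wpM2l.
Qed.

(** The derivative is local, which is not visible on the Fourier side. *)
Lemma dtest_support j f : test f ->
  [set x | dtest j f x != 0] `<=` closure [set x | f x != 0].
Proof.
move=> tf x /=; apply: contraNP => nx.
have near0 : \near x, f x = 0.
  have : nbhs x (~` closure [set x | f x != 0]).
    by apply: open_nbhs_nbhs; split=> //; apply: closed_openC; exact: closed_closure.
  apply: filterS => y ny; have [//|fy] := eqVneq (f y) 0.
  by case: ny; exact: subset_closure.
have [hR hI] := partial_dtest j x tf.
apply/eqP; apply: complex_eqP; rewrite -?hR -?hI /partial.
  rewrite (near_eq_derive (g := cst 0)); first by rewrite derive_cst.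
  by apply: filterS near0 => y fy; rewrite /Re_fun fy.
rewrite (near_eq_derive (g := cst 0)); first by rewrite derive_cst.
by apply: filterS near0 => y fy; rewrite /Im_fun fy.
Qed.

Lemma Cc_dtest j f : test f -> Cc (dtest j f).
Proof.
move=> tf; have [cr ci] := dtest_continuous j tf.
split=> //; case/testP: (tf) => -[_ _ kf] _ _.
apply: (subclosed_compact (@closed_closure _ _) kf).
exact: closure_subclosure (dtest_support (j := j) tf).
Qed.

Lemma ft_translate f (a xi : Rd) : L1d f ->
  ft (fun x => f (x + a)) xi = cis (dot a xi) * ft f xi.
Proof.
move=> lf; have lc := L1d_cis xi lf.
have h := CI_affine a (oner_neq0 R) lc.
rewrite normr1 expr1n invr1 mul1r in h; rewrite {2}/ft -h.
have lh := L1d_affine a (oner_neq0 R) lc.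
rewrite /ft /CI -(CintZ _ lh); apply: eq_Cint => t.
rewrite scale1r mulrCA; congr (_ * _).
by rewrite -cisD dotDl; congr cis; ring.
Qed.

(** The difference quotient of step 1 / n multiplies the transform of f by
    n (exp (i xi_j / n) - 1); these quotients converge to the derivative, and
    have a common bound and a common compact support because f is Lipschitz. *)
Lemma ft_dtest j f xi : test f ->
  ft (dtest j f) xi = (0 +i* xi 0 j) * ft f xi.
Proof.
move=> tf; have lf := test_L1 tf.
have [cf _ _] := (testP _ _ _).1 tf.
pose e n : R := n.+1%:R^-1.
have en0 n : 0 < e n by rewrite invr_gt0.
have en1 n : e n <= 1 by rewrite invf_le1// ler1n.
pose q n x : R[i] := (n.+1%:R)%:C * (f (x + e n *: delta_mx 0 j) - f x).
have Ec n : ((n.+1%:R)%:C * (e n)%:C = 1 :> R[i]).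
  by rewrite -rmorphM /= mulfV.
have lfs n : L1d (fun x => f (x + e n *: delta_mx 0 j)).
  have := L1d_affine (e n *: delta_mx 0 j) (oner_neq0 R) lf.
  by under eq_fun do rewrite scale1r.
have lN : L1d (fun x => -1 * f x) by exact: L1Z.
have lq n : L1d (q n).
  apply: L1Z; have := L1D (lfs n) lN.
  by under eq_fun do rewrite mulN1r.
have ftq n : ft (q n) xi = (n.+1%:R)%:C * (cis (e n * xi 0 j) - 1) * ft f xi.
  have E : L1d (fun x => f (x + e n *: delta_mx 0 j) - f x).
    by have := L1D (lfs n) lN; under eq_fun do rewrite mulN1r.
  rewrite /q (ftZ _ _ E) -mulrA; congr (_ * _).
  have := ftD xi (lfs n) lN; rewrite (ftZ _ _ lf) mulN1r (ft_translate _ _ lf).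
  have -> : dot (e n *: delta_mx 0 j) xi = e n * xi 0 j.
    rewrite dotZl; congr (_ * _); rewrite /dot (bigD1 j)//= mxE !eqxx mul1r.
    by rewrite big1 ?addr0// => i /negbTE ij; rewrite mxE ij andbF mul0r.
  by move=> h; rewrite mulrBl mul1r -h; congr (ft _ _); apply/funext => x; rewrite mulN1r.
have cvg1 : normc (ft (q n) xi - (0 +i* xi 0 j) * ft f xi) @[n --> \oo] --> (0 : R).
  have h : e n * (2 * xi 0 j ^+ 2 * normc (ft f xi)) @[n --> \oo] -->
      0 * (2 * xi 0 j ^+ 2 * normc (ft f xi)).
    by apply: cvgM; [exact: (@cvg_harmonic R)|exact: cvg_cst].
  rewrite mul0r in h.
  apply: (squeeze_cvgr _ (cvg_cst 0) h); apply: nearW => n; apply/andP; split.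
    exact: normc_ge0.
  rewrite ftq -mulrBl normc_mul mulrA ler_wpM2r ?normc_ge0//.
  have -> : (n.+1%:R)%:C * (cis (e n * xi 0 j) - 1) - (0 +i* xi 0 j) =
      (n.+1%:R)%:C * (cis (e n * xi 0 j) - 1 - (0 +i* (e n * xi 0 j))) :> R[i].
    rewrite [in RHS]mulrBr; congr (_ - _).
    have -> : (0 +i* (e n * xi 0 j)) = (e n)%:C * (0 +i* xi 0 j).
      by apply: complex_eqP; rewrite ReIm_simp /= ?mul0r ?mulr0 ?subr0 ?addr0.
    by rewrite mulrA Ec mul1r.
  rewrite normc_mul normc_real gtr0_norm//.
  rewrite (le_trans (ler_wpM2l _ (normc_cis1B _)))// exprMn.
  by rewrite le_eqVlt; apply/orP; left; apply/eqP; rewrite /e; field.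
have [C hC] := dtest_taylor j tf.
have [L L0 hL] := test_lipschitz tf.
have [M M0 hM] := Cc_bounded (Cc_dtest j tf).
have [B B0 hB] := Cc_support cf.
have [B' B'0 hB'] := Cc_support (Cc_dtest j tf).
pose N := Num.max L M; pose S := Num.max (B + 1) B'.
have S0 : 0 <= S by rewrite le_max (ltW B'0) orbT.
have N0 : 0 <= N by rewrite le_max L0.
pose g x := N * ((1 + S ^+ 2) ^+ d * cauchy_density x).
have box x (z : R[i]) : (z != 0 -> forall i, `|x 0 i| <= S) -> normc z <= N ->
    normc z <= g x.
  move=> zS zN; have [->|z0] := eqVneq z 0.
    rewrite normc_0 /g mulr_ge0// mulr_ge0//.
      by rewrite exprn_ge0// addr_ge0// sqr_ge0.
    by rewrite ltW// cauchy_density_gt0.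
  by rewrite (le_trans zN)// /g ler_peMr//; apply: cauchy_box; exact: zS.
have dE n i : `|(e n *: delta_mx 0 j : Rd) 0 i| <= e n.
  rewrite !mxE eqxx /= normrM gtr0_norm// ler_piMr ?(ltW (en0 n))// normr_nat.
  by case: (i == j) => /=.
have normd n : `|(e n *: delta_mx 0 j : Rd)| <= e n.
  by apply: rV_norm_le; [exact: ltW|exact: dE].
have qN n x : normc (q n x) <= N.
  rewrite /q normc_mul normc_real gtr0_norm//.
  rewrite (le_trans (ler_wpM2l _ (hL _ _)))// addrAC subrr add0r.
  rewrite (@le_trans _ _ (n.+1%:R * (L * e n)))//.
    by rewrite ler_wpM2l// ler_wpM2l//; exact: normd.
  by rewrite mulrCA /e mulfV// mulr1 le_max lexx.
apply: normc_cvg_unique cvg1.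
apply: (Cint_dominated (g := fun t => g (rowt t))).
- move=> n; have := (L1d_cis xi (lq n)).1; exact.
- by have := (L1d_cis xi (Cc_L1 (Cc_dtest j tf))).1.
- move=> t; have h : e n * C @[n --> \oo] --> 0 * C.
    by apply: cvgM; [exact: (@cvg_harmonic R)|exact: cvg_cst].
  rewrite mul0r in h.
  apply: (squeeze_cvgr _ (cvg_cst 0) h); apply: nearW => n; apply/andP; split.
    exact: normc_ge0.
  rewrite -mulrBl normc_mul normc_cis mulr1.
  have -> : q n (rowt t) - dtest j f (rowt t) = (n.+1%:R)%:C *
      (f (e n *: delta_mx 0 j + rowt t) - f (rowt t) - (e n)%:C * dtest j f (rowt t)).
    rewrite /q [rowt t + _]addrC; move: (dtest j f (rowt t)) => z.
    by rewrite [in RHS]mulrBr [(n.+1%:R)%:C * ((e n)%:C * z)]mulrA Ec mul1r.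
  rewrite normc_mul normc_real gtr0_norm// (le_trans (ler_wpM2l _ (hC _ _)))//.
  by rewrite le_eqVlt; apply/orP; left; apply/eqP; rewrite /e; field.
- by apply: integrableZR; apply: integrableZR; exact: integrable_cauchy.
- move=> n t; rewrite normc_mul normc_cis mulr1; apply: box => // q0 i.
  rewrite le_max; apply/orP; left.
  have [ft0|ft0] := eqVneq (f (rowt t)) 0; last first.
    by rewrite (le_trans (hB _ ft0 i))// lerDl.
  have fs : f (rowt t + e n *: delta_mx 0 j) != 0.
    by apply: contra q0 => /eqP h; rewrite /q h ft0 subrr mulr0.
  have := hB _ fs i; rewrite [X in `|X|]mxE => h.
  rewrite -[rowt t 0 i](addrK ((e n *: delta_mx 0 j : Rd) 0 i)).
  rewrite (le_trans (ler_normB _ _))// lerD// (le_trans (dE n i))//.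
- move=> t; rewrite normc_mul normc_cis mulr1; apply: box => [q0 i|].
    by rewrite le_max (hB' _ q0 i) orbT.
  by rewrite le_max hM orbT.
Qed.

(** The factor xi_j is absorbed by one more unit of weight, [coord_le_wt]. *)
Lemma wnorm_dtest j : exists2 A : R, 0 < A & forall f, test f ->
  forall l, 0 < l -> (wnorm l (dtest j f) <= A%:E * wnorm (l + 1) f)%E.
Proof.
have [A A0 hA] := coord_le_wt d womega; exists A => // f tf l l0.
have lf := test_L1 tf; have ld := Cc_L1 (Cc_dtest j tf).
have mf := emeasurable_wft womega (l + 1) lf.
have A0' : (0 <= A%:E)%E by rewrite lee_fin ltW.
rewrite !wnormE.
rewrite -(ge0_integralZl mu measurableT mf (fun t _ => wft_ge0 omega (l + 1) f t) A0').
apply: ge0_le_integral => //.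
- by move=> t _; exact: wft_ge0.
- exact: emeasurable_wft.
- exact: measurable_funeM.
- move=> t _; rewrite -EFinM lee_fin ft_dtest// normc_mul -wtM.
  rewrite normcE2 /= expr0n add0r sqrtr_sqr.
  have := hA (rowt t) j; have := normc_ge0 (ft f (rowt t)).
  have : 0 < wt l (rowt t) by exact: expR_gt0.
  set a := `|_|; set b := wt 1 _; set c := normc _; set e := wt l _ => e0 c0 ab.
  have -> : A * (c * (e * b)) = (A * b) * c * e by ring.
  by rewrite ler_wpM2r ?(ltW e0)// ler_wpM2r.
Qed.

Lemma test_dtest j f : test f -> test (dtest j f).
Proof.
move=> tf; apply/testP; split; first exact: Cc_dtest.
  have := closure_subclosure (dtest_support (j := j) tf).
  by case/testP : tf => _ sf _ /subset_trans; apply.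
have [A A0 hA] := wnorm_dtest j.
move=> l l0; apply: (le_lt_trans (hA _ tf _ l0)).
rewrite lte_mul_pinfty ?lee_fin ?(ltW A0)//.
by case/testP : tf => _ _; apply; rewrite addr_gt0.
Qed.

End Derivative.

(** * Cutoff functions *)

Section Modulation.
Variables (R : realType) (d : nat) (omega : R -> R).
Hypothesis womega : weight omega.
Local Notation RT := (measurableTypeR R).
Local Notation Td := (d.-tuple RT).
Local Notation mu := (lebesgue_tuple R d).
Local Notation Rd := 'rV[R]_d.
Local Notation normc := (@Normc.normc R).
Local Notation wnorm := (@weighted_norm R omega d).
Local Notation wt := (wt omega).
Local Notation test := (@test_function R omega d).
Implicit Types (f phi chi : Rd -> R[i]) (x y z a xi : Rd) (j : 'I_d).

Lemma cube_compact a (S : R) : compact [set x : Rd | forall j, `|x 0 j - a 0 j| <= S].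
Proof.
have := @rV_compact R d (fun j => `[a 0 j - S, a 0 j + S]%classic)
  (fun j => @segment_compact R _ _).
by congr compact; apply/seteqP; split=> x /= h j; have := h j;
  rewrite /= in_itv/= ler_distl.
Qed.

Lemma support_cube f a (S : R) : (forall x, f x != 0 -> forall j, `|x 0 j - a 0 j| <= S) ->
  compact (closure [set x | f x != 0]) /\
  closure [set x | f x != 0] `<=` [set x : Rd | forall j, `|x 0 j - a 0 j| <= S].
Proof.
move=> hf; have cK := @cube_compact a S.
have clK := compact_closed (@norm_hausdorff _ _) cK.
have sub : closure [set x | f x != 0] `<=` [set x : Rd | forall j, `|x 0 j - a 0 j| <= S].
  rewrite [X in _ `<=` X](closure_id _).1//.
  by apply: closure_subset => x; exact: hf.
split=> //; exact: (subclosed_compact (@closed_closure _ _) cK).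
Qed.

Lemma cis_dot_continuous xi : continuous (Re_fun (fun x => cis (- dot x xi) : R[i])) /\
  continuous (Im_fun (fun x => cis (- dot x xi) : R[i])).
Proof.
apply: lipschitz_continuous; exists (2 * (d%:R * `|xi|)) => [|x y].
  by rewrite mulr_ge0// mulr_ge0.
rewrite (le_trans (normc_cisB _ _))// -mulrA ler_wpM2l//.
rewrite -opprD normrN -dotBl; apply: normc_dot_le => j.
exact: coord_le_norm.
Qed.

Lemma CI0 : CI (fun _ : Rd => 0) = 0 :> R[i].
Proof. by rewrite /CI /Cint /= !Rintegral_cst// !mul0r. Qed.

(** By the inversion formula the transform of f does not vanish somewhere;
    modulation moves such a point to the origin, and translates the transform by
    a fixed vector, which the weight tolerates. *)
Lemma exists_nonzero_integral (U : set Rd) f x : test U f -> f x != 0 ->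
  exists2 phi, test setT phi & CI phi != 0.
Proof.
move=> tf fx; have lf := test_L1 tf.
have [xi fxi] : exists xi, ft f xi != 0.
  apply: contrapT => /forallNP h; move/eqP: fx; apply.
  have h0 xi : ft f xi = 0 by apply/eqP; apply: contraT => /h.
  rewrite (test_inv_ft womega _ tf) /inv_ft.
  have -> : CI (fun xi => ft f xi * cis (dot x xi)) = CI (fun _ : Rd => 0).
    by apply: eq_Cint => t; rewrite h0 mul0r.
  by rewrite CI0 mulr0.
(* The integral of the modulated function is the transform of f at xi. *)
exists (fun y => f y * cis (- dot y xi)); last exact: fxi.
have [cf _ ff] := (testP _ _ _).1 tf.
have [cr ci] := cis_dot_continuous xi.
have cphi : Cc (fun y => f y * cis (- dot y xi)) := Cc_mul cf cr ci.
apply/testP; split; [exact: cphi|by move=> y _|].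
move=> l l0; apply: le_lt_trans (_ : ((wt l (- xi))%:E * wnorm l f < +oo)%E); last first.
  by rewrite lte_mul_pinfty ?lee_fin ?expR_ge0//; exact: ff.
have mf := measurable_wft womega l lf.
pose h y := normc (ft f y) * wt l y.
have h0 y : 0 <= h y by rewrite mulr_ge0 ?normc_ge0 ?expR_ge0.
have := integral_affineR (h := h) xi (oner_neq0 R) mf h0.
rewrite normr1 expr1n invr1 mul1e !wnormE => <-.
have mfs : measurable_fun setT (fun t : Td => (h (1 *: rowt t + xi))%:E).
  apply/measurable_EFinP; have := measurableT_comp mf (measurable_affine 1 xi).
  by rewrite (_ : _ \o _ = fun t : Td => h (1 *: rowt t + xi))//;
    apply/funext => t /=; rewrite trowK.
have w0 : (0 <= (wt l (- xi))%:E)%E by rewrite lee_fin expR_ge0.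
have hs0 (t : Td) : (0 <= (h (1 *: rowt t + xi))%:E)%E by rewrite lee_fin.
rewrite -(ge0_integralZl mu measurableT mfs (fun t _ => hs0 t) w0).
apply: ge0_le_integral => //.
- by move=> t _; exact: wft_ge0.
- exact: (emeasurable_wft womega l (Cc_L1 cphi)).
- exact: measurable_funeM.
- move=> t _; rewrite -EFinM lee_fin scale1r /h.
  have -> : ft (fun y => f y * cis (- dot y xi)) (rowt t) = ft f (rowt t + xi).
    apply: eq_Cint => s; rewrite -mulrA -cisD [dot _ (_ + _)]dotC dotDl.
    by rewrite [dot (rowt t) _]dotC [dot xi _]dotC; congr (_ * cis _); ring.
  rewrite mulrCA ler_wpM2l ?normc_ge0//.
  by have := wtD womega (- xi) (rowt t + xi) (ltW l0); rewrite addrCA addNr addr0.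
Qed.

Definition cube_indic (N : R) x : R := \1_[set y : Rd | forall j, `|y 0 j| <= N] x.

Lemma cube_indic_ge0 N x : 0 <= cube_indic N x.
Proof. by rewrite /cube_indic indicE. Qed.
Lemma cube_indic1 N x : (forall j, `|x 0 j| <= N) -> cube_indic N x = 1.
Proof. by move=> h; rewrite /cube_indic indicE mem_set. Qed.
Lemma cube_indic_neq0 N x : cube_indic N x != 0 -> forall j, `|x 0 j| <= N.
Proof.
by rewrite /cube_indic indicE; case: (asboolP (forall j, `|x 0 j| <= N)) => // h;
  rewrite memNset// eqxx.
Qed.

Lemma L1d_cube N : 0 <= N -> L1d (fun x => (cube_indic N x)%:C).
Proof.
move=> N0; apply: (L1_dom (g := fun t => (1 + N ^+ 2) ^+ d * cauchy_density (rowt t))).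
- apply: cmeas_real.
  rewrite (_ : (fun _ => _) = \1_(\bigcap_(j in [set: 'I_d])
      ((fun t : Td => tnth t j) @^-1` [set r | `|r| <= N]))).
    apply: measurable_indic; apply: fin_bigcap_measurable => // j _.
    rewrite -[X in measurable X]setTI; apply: measurable_tnth => //.
    rewrite (_ : [set r | _] = `[- N, N]%classic)//.
    by apply/seteqP; split=> r /=; rewrite in_itv/= ler_norml.
  apply/funext => t; rewrite /cube_indic !indicE; congr (_%:R); congr nat_of_bool.
  by apply/asboolP/asboolP => h j; have := h j; rewrite ?rowtE//; apply.
- by apply: integrableZR; exact: integrable_cauchy.
- move=> t; rewrite normc_real ger0_norm ?cube_indic_ge0//.
  have [->|h] := eqVneq (cube_indic N (rowt t)) 0.
    by rewrite mulr_ge0 ?exprn_ge0 ?addr_ge0 ?sqr_ge0 ?ltW ?cauchy_density_gt0.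
  have hc := cube_indic_neq0 h; rewrite cube_indic1//; exact: cauchy_box.
Qed.

End Modulation.

Section Plateau.
Variables (R : realType) (d : nat) (omega : R -> R).
Hypothesis womega : weight omega.
Local Notation RT := (measurableTypeR R).
Local Notation Td := (d.-tuple RT).
Local Notation mu := (lebesgue_tuple R d).
Local Notation Rd := 'rV[R]_d.
Local Notation normc := (@Normc.normc R).
Local Notation wnorm := (@weighted_norm R omega d).
Local Notation test := (@test_function R omega d).
Implicit Types (f phi chi : Rd -> R[i]) (x y z a xi : Rd) (j : 'I_d).

(** The convolution of phi with the indicator of a cube that contains all small
    translates of its support is constant near the origin, equal to the integral
    of phi.  Its
    transform is a bounded multiple of the one of phi. *)
Lemma exists_plateau phi : test setT phi -> CI phi != 0 ->
  exists2 chi, test setT chi & forall x, (forall j, `|x 0 j| <= 1) -> chi x = 1.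
Proof.
move=> tphi Iphi; have lphi := test_L1 tphi.
have [cphi _ fphi] := (testP _ _ _).1 tphi.
have [B B0 hB] := Cc_support cphi.
have [M M0 hM] := Cc_bounded cphi.
have [L L0 hL] := test_lipschitz womega tphi.
pose N := B + 1; pose S := N + B.
have N0 : 0 <= N by rewrite addr_ge0// ltW.
have S0 : 0 <= S by rewrite addr_ge0// ltW.
pose b x : R[i] := (cube_indic N x)%:C.
have lb : L1d b by exact: L1d_cube.
pose J := \int[mu]_t normc (b (rowt t)).
have J0 : 0 <= J by apply: Rintegral_ge0 => t _; exact: normc_ge0.
pose chi x := CI (fun y => phi (x - y) * b y).
have mneg x : rmeas (fun y => phi (x - y)).
  have := rmeas_affine (-1) x lphi.1.
  by rewrite /rmeas; under eq_fun do rewrite scaleN1r addrC.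
have lchi x : L1d (fun y => phi (x - y) * b y).
  exact: (L1_mulbl (M := M) lb (mneg x) (fun t => hM _)).
have chi_lip : exists2 L' : R, 0 <= L' & forall x y, normc (chi x - chi y) <= L' * `|x - y|.
  exists (L * J) => [|x y]; first exact: mulr_ge0.
  rewrite /chi /CI -(CintB (lchi x) (lchi y)).
  have lF : L1d (fun z => (phi (x - z) - phi (y - z)) * b z).
    have := L1D (lchi x) (L1Z (-1) (lchi y)).
    by under eq_fun do rewrite mulN1r -mulrBl.
  rewrite (_ : (fun _ => _) = fun t : Td =>
      (phi (x - rowt t) - phi (y - rowt t)) * b (rowt t)); last first.
    by apply/funext => t; rewrite mulrBl.
  rewrite (le_trans (normc_Cint lF))// mulrAC.
  rewrite -RintegralZl//; last exact: L1_normc.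
  apply: le_Rintegral => //.
  - exact: L1_normc.
  - by apply: integrableZR; exact: L1_normc.
  - move=> t _; rewrite normc_mul ler_wpM2r ?normc_ge0//.
    by rewrite (le_trans (hL _ _))// opprB addrA subrK.
have chi_supp x : chi x != 0 -> forall j, `|x 0 j - (0 : Rd) 0 j| <= S.
  move=> cx j; rewrite mxE subr0 leNgt; apply: contra cx => hS.
  have -> : chi x = CI (fun _ : Rd => 0).
    apply: eq_Cint => t; have [->|p0] := eqVneq (phi (x - rowt t)) 0.
      by rewrite mul0r.
    have [b0|b0] := eqVneq (cube_indic N (rowt t)) 0.
      by rewrite /b b0 mulr0.
    exfalso; have := hB _ p0 j; have := cube_indic_neq0 b0 j.
    rewrite [X in _ -> `|X| <= _ -> _]mxE [X in _ -> `|_ + X| <= _ -> _]mxE => h1 h2.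
    move: hS; rewrite ltNge -[x 0 j](subrK (rowt t 0 j)) /S addrC.
    by rewrite (le_trans (ler_normD _ _) (lerD h1 h2)).
  by rewrite CI0.
have [kchi _] := support_cube chi_supp.
have [rchi ichi] := lipschitz_continuous chi_lip.
have cchi : Cc chi by [].
have ftchi xi : ft chi xi = ft phi xi * ft b xi.
  pose H (w : Td * Td) : R[i] := phi (rowt w.1 - rowt w.2) * cis (- dot (rowt w.1) xi).
  have mH : cmeas H.
    apply: cmeasM.
      have md : measurable_fun setT (fun w : Td * Td => trow (rowt w.1 - rowt w.2) : Td).
        apply: measurable_trow => j; under eq_fun do rewrite !mxE -!rowtE.
        apply: measurable_funB.
          exact: (measurableT_comp (@measurable_coord R d j) measurable_fst).
        exact: (measurableT_comp (@measurable_coord R d j) measurable_snd).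
      have := cmeas_comp lphi.1 md.
      by under eq_fun do rewrite trowK.
    apply: cmeas_cis; apply: measurableT_comp => //.
    exact: (measurableT_comp (measurable_dotr xi) measurable_fst).
  have hH w : normc (H w) <= M by rewrite normc_mul normc_cis mulr1.
  pose bS x : R[i] := (cube_indic S x)%:C.
  have lbS : L1d bS by exact: L1d_cube.
  have lF := L1_tensor (F := fun s => bS (rowt s)) (G := fun t => b (rowt t))
    lbS lb mH M0 hH.
  have FE (w : Td * Td) : bS (rowt w.1) * b (rowt w.2) * H w =
      phi (rowt w.1 - rowt w.2) * b (rowt w.2) * cis (- dot (rowt w.1) xi).
    rewrite /H; have [->|p0] := eqVneq (phi (rowt w.1 - rowt w.2)) 0.
      by rewrite !mul0r mulr0.
    have [b0|b0] := eqVneq (cube_indic N (rowt w.2)) 0.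
      by rewrite /b b0 !(mulr0, mul0r).
    rewrite /bS cube_indic1; first by ring.
    move=> j; have := hB _ p0 j; have := cube_indic_neq0 b0 j.
    rewrite [X in _ -> `|X| <= _ -> _]mxE [X in _ -> `|_ + X| <= _ -> _]mxE => h1 h2.
    rewrite -[rowt w.1 0 j](subrK (rowt w.2 0 j)) /S addrC.
    by rewrite (le_trans (ler_normD _ _) (lerD h1 h2)).
  transitivity (Cint mu (fun s => Cint mu (fun t => bS (rowt s) * b (rowt t) * H (s, t)))).
    apply: eq_Cint => s; rewrite /chi /CI -(CintZr _ (lchi (rowt s))).
    by apply: eq_Cint => t; rewrite (FE (s, t)).
  rewrite (Cint_fubini lF) /=.
  transitivity (Cint mu (fun t => ft phi xi * (b (rowt t) * cis (- dot (rowt t) xi)))).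
    apply: eq_Cint => t.
    have lsh : L1d (fun x => phi (x - rowt t)).
      have := L1d_affine (- rowt t) (oner_neq0 R) lphi.
      by under eq_fun do rewrite scale1r.
    transitivity (b (rowt t) * ft (fun x => phi (x - rowt t)) xi).
      rewrite /ft /CI -(CintZ _ (L1d_cis xi lsh)); apply: eq_Cint => s.
      by rewrite (FE (s, t)) /=; ring.
    by rewrite ft_translate// dotNl; ring.
  by rewrite (CintZ _ (L1d_cis xi lb)).
pose c := CI phi.
have tchi : test setT chi.
  apply/testP; split; [exact: cchi|by move=> y _|].
  have lc := Cc_L1 cchi.
  move=> l l0; apply: le_lt_trans (_ : (J%:E * wnorm l phi < +oo)%E); last first.
    by rewrite lte_mul_pinfty//; exact: fphi.
  have mphi := emeasurable_wft womega l lphi.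
  have J0' : (0 <= J%:E)%E by rewrite lee_fin.
  rewrite !wnormE.
  rewrite -(ge0_integralZl mu measurableT mphi (fun t _ => wft_ge0 omega l phi t) J0').
  apply: ge0_le_integral => //.
  - by move=> t _; exact: wft_ge0.
  - exact: emeasurable_wft.
  - exact: measurable_funeM.
  - move=> t _; rewrite -EFinM lee_fin ftchi normc_mul mulrA ler_wpM2r ?expR_ge0//.
    by rewrite mulrC ler_wpM2r ?normc_ge0//; exact: normc_ft_le.
exists (fun x => c^-1 * chi x); first exact: test_scale.
move=> x hx; suff -> : chi x = c by rewrite mulVf.
have lH : L1d (fun y => phi (x - y) * b y) by exact: lchi.
have n1 : (-1 : R) != 0 by rewrite oppr_eq0 oner_eq0.
have := CI_affine x n1 lH; rewrite normrN normr1 expr1n invr1 mul1r -/(chi x) => <-.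
apply: eq_Cint => t; rewrite scaleN1r opprD opprK addrCA subrr addr0.
have [->|p0] := eqVneq (phi (rowt t)) 0; first by rewrite mul0r.
rewrite /b cube_indic1 ?mulr1// => j; rewrite !mxE -rowtE addrC.
by rewrite (le_trans (ler_normB _ _))// addrC /N lerD//; exact: hB.
Qed.

End Plateau.

Section Cutoff.
Variables (R : realType) (d : nat) (omega : R -> R).
Hypothesis womega : weight omega.
Local Notation RT := (measurableTypeR R).
Local Notation Td := (d.-tuple RT).
Local Notation mu := (lebesgue_tuple R d).
Local Notation Rd := 'rV[R]_d.
Local Notation normc := (@Normc.normc R).
Local Notation wnorm := (@weighted_norm R omega d).
Local Notation wt := (wt omega).
Local Notation test := (@test_function R omega d).
Implicit Types (f phi chi : Rd -> R[i]) (x y z a xi : Rd) (j : 'I_d).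

(** The transform is dilated by n + 1; subadditivity bounds the weight at
    (n + 1) xi by the weight at xi with exponent (n + 1) l. *)
Lemma test_dilation chi (n : nat) a : test setT chi ->
  test setT (fun x => chi (n.+1%:R *: x + a)).
Proof.
move=> tchi; have lchi := test_L1 tchi.
have [cchi _ fchi] := (testP _ _ _).1 tchi.
have n0 : n.+1%:R != 0 :> R by rewrite pnatr_eq0.
have np : 0 < n.+1%:R :> R by [].
have [B B0 hB] := Cc_support cchi.
have cphi : Cc (fun x => chi (n.+1%:R *: x + a)).
  have caff : continuous (fun x : Rd => n.+1%:R *: x + a).
    move=> x; apply: (@cvgD _ _ _ (nbhs x) (nbhs_filter x)
      (fun y : Rd => n.+1%:R *: y) (fun=> a)).
      exact: scaler_continuous.
    exact: cvg_cst.
  have [cr ci _] := cchi; split.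
  - move=> x; apply: (@continuous_comp _ _ _ (fun y : Rd => n.+1%:R *: y + a)
      (Re_fun chi) x (caff x)); exact: cr.
  - move=> x; apply: (@continuous_comp _ _ _ (fun y : Rd => n.+1%:R *: y + a)
      (Im_fun chi) x (caff x)); exact: ci.
  have h x : chi (n.+1%:R *: x + a) != 0 ->
      forall j, `|x 0 j - (- n.+1%:R^-1 *: a) 0 j| <= n.+1%:R^-1 * B.
    move=> cx j; have := hB _ cx j; rewrite !mxE => h.
    rewrite -(ler_pM2l np) mulrA mulfV// mul1r -{1}(gtr0_norm np) -normrM.
    rewrite (_ : _ * _ = n.+1%:R * x 0 j + a 0 j)//.
    by rewrite mulrBr mulNr mulrN opprK mulrA mulfV// mul1r.
  by have [] := support_cube h.
apply/testP; split; [exact: cphi|by move=> y _|] => l l0.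
set k : R := n.+1%:R in n0 np cphi *.
have ftphi xi : normc (ft (fun x => chi (k *: x + a)) xi) =
    k ^- d * normc (ft chi (k^-1 *: xi)).
  pose G y : R[i] := cis (dot (k^-1 *: a) xi) * (chi y * cis (- dot y (k^-1 *: xi))).
  have lG : L1d G by apply: L1Z; exact: L1d_cis.
  have -> : ft (fun x => chi (k *: x + a)) xi = CI (fun x => G (k *: x + a)).
    apply: eq_Cint => t; rewrite /G mulrCA; congr (_ * _).
    rewrite -cisD; congr cis.
    rewrite dotDl !dotZl ![dot _ (k^-1 *: xi)]dotC !dotZl [dot xi _]dotC [dot xi a]dotC.
    by field.
  rewrite (CI_affine a n0 lG) normc_mul normc_real gtr0_norm//; last first.
    by rewrite invr_gt0 exprn_gt0// normr_gt0.
  rewrite gtr0_norm//; congr (_ * _).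
  by rewrite /CI (CintZ _ (L1d_cis _ lchi)) normc_mul normc_cis mul1r.
pose h eta := normc (ft chi eta) * wt l (k *: eta).
have h0 eta : 0 <= h eta by rewrite mulr_ge0 ?normc_ge0 ?expR_ge0.
have mwk : measurable_fun setT (fun t : Td => wt l (k *: rowt t)).
  have := measurableT_comp (@measurable_wt R d omega womega l) (@measurable_affine R d k 0).
  by rewrite (_ : _ \o _ = fun t : Td => wt l (k *: rowt t))//;
    apply/funext => t /=; rewrite trowK addr0.
have mh : measurable_fun setT (fun t : Td => h (rowt t)).
  by apply: measurable_funM => //; apply: measurable_normc; exact: rmeas_ft.
have kV0 : k^-1 != 0 by rewrite invr_eq0.
have := integral_affineR (h := h) 0 kV0 mh h0.
rewrite gtr0_norm ?invr_gt0// => hh.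
have E : (wnorm l (fun x => chi (k *: x + a)%R) = \int[mu]_t (h (rowt t))%:E)%E.
  transitivity ((k ^- d)%:E * \int[mu]_t (h (k^-1 *: rowt t + 0)%R)%:E)%E; last first.
    by rewrite hh muleA -EFinM -invfM -exprMn mulfV// expr1n invr1 mul1e.
  have mh' : measurable_fun setT (fun t : Td => (h (k^-1 *: rowt t + 0))%:E).
    apply/measurable_EFinP; have hm := measurableT_comp mh (measurable_affine k^-1 0).
    suff -> : (fun t : Td => h (k^-1 *: rowt t + 0)) = (fun t : Td => h (rowt t)) \o
        (fun t : Td => trow (k^-1 *: rowt t + 0)) by exact: hm.
    by apply/funext => t /=; rewrite trowK.
  have h0' (t : Td) : (0 <= (h (k^-1 *: rowt t + 0))%:E)%E by rewrite lee_fin.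
  have kd0 : (0 <= (k ^- d)%:E)%E by rewrite lee_fin invr_ge0 exprn_ge0// ltW.
  rewrite -(ge0_integralZl mu measurableT mh' (fun t _ => h0' t) kd0) wnormE.
  apply: eq_integral => t _; rewrite -EFinM ftphi /h addr0 scalerA mulfV// scale1r.
  by rewrite mulrA.
rewrite E; apply: le_lt_trans (fchi (k * l) (mulr_gt0 np l0)); rewrite wnormE.
have h0E (t : Td) : (0 <= (h (rowt t))%:E)%E by rewrite lee_fin.
have mhE : measurable_fun setT (fun t : Td => (h (rowt t))%:E).
  exact/measurable_EFinP.
have mw := emeasurable_wft womega (k * l) lchi.
apply: (ge0_le_integral mu measurableT (fun t _ => h0E t) mhE mw) => t _.
rewrite lee_fin.
exact: (ler_wpM2l (normc_ge0 _) (wt_natZ womega n.+1 (rowt t) (ltW l0))).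
Qed.

(** A contraction about a of a function with a plateau has small support but
    still a plateau around a. *)
Lemma local_cutoff chi (U : set Rd) a : test setT chi ->
  (forall x, (forall j, `|x 0 j| <= 1) -> chi x = 1) -> open U -> U a ->
  exists2 psi, test U psi & \near a, psi a = 1.
Proof.
move=> tchi chi1 oU Ua; have [cchi _ _] := (testP _ _ _).1 tchi.
have [B B0 hB] := Cc_support cchi.
have /nbhs_ballP[r /= r0 rU] := open_nbhs_nbhs (conj oU Ua).
have [n nr] : exists n : nat, n.+1%:R^-1 < r / B.
  have [n _ /(_ n (leqnn n))] : \forall n \near \oo, n.+1%:R^-1 < r / B.
    by apply: near_infty_natSinv_lt (PosNum _); rewrite divr_gt0.
  by exists n.
set k : R := n.+1%:R in nr.
have k0 : 0 < k by [].
have affE x j : (k *: x + - (k *: a)) 0 j = k * (x 0 j - a 0 j).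
  by rewrite !mxE mulrBr.
exists (fun x => chi (k *: x + - (k *: a))).
  have /testP[c1 _ f1] := test_dilation n (- (k *: a)) tchi.
  apply/testP; split=> //.
  have h x : chi (k *: x + - (k *: a)) != 0 -> forall j, `|x 0 j - a 0 j| <= k^-1 * B.
    move=> cx j; have := hB _ cx j; rewrite affE normrM gtr0_norm// => h.
    by rewrite -(ler_pM2l k0) mulrA mulfV ?gt_eqF// mul1r.
  have [_] := support_cube h.
  move=> /subset_trans; apply => x hx; apply: rU; apply/rV_ballP => // j.
  rewrite distrC (le_lt_trans (hx j))//.
  by move: nr; rewrite ltr_pdivlMr.
near=> x; apply: chi1 => j; rewrite affE normrM gtr0_norm//.
have : ball a k^-1 x by near: x; apply: nbhsx_ballx; rewrite invr_gt0.
move=> /rV_ballP-/(_ _)/(_ j); rewrite invr_gt0 => /(_ k0) h.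
by rewrite -ler_pdivlMl// mulr1 distrC ltW.
Unshelve. all: by end_near. Qed.

(** Inclusion-exclusion: 1 - (1 - psi1) (1 - psi2) stays in the algebra. *)
Lemma cutoff_union (U : set Rd) psi1 psi2 : test U psi1 -> test U psi2 ->
  exists2 psi, test U psi & forall x, psi1 x = 1 \/ psi2 x = 1 -> psi x = 1.
Proof.
move=> t1 t2; exists (fun x => psi1 x + psi2 x + (-1) * (psi1 x * psi2 x)).
  exact: (test_add womega (test_add womega t1 t2)
    (test_scale womega (-1) (test_mul womega t1 t2))).
by move=> x [->|->]; ring.
Qed.

(** Local cutoffs are glued along a finite cover.  They exist around every point
    of U because test functions are stable under modulation, convolution,
    contraction and translation, starting from the nonzero one. *)
Lemma exists_cutoff (U K : set Rd) f x : open U -> test U f -> f x != 0 ->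
  compact K -> K `<=` U -> exists2 psi, test U psi & forall y, K y -> psi y = 1.
Proof.
move=> oU tf fx cK KU.
have [phi tphi Iphi] := exists_nonzero_integral womega tf fx.
have [chi tchi chi1] := exists_plateau womega tphi Iphi.
have H a : exists p : Rd -> R[i], U a -> test U p /\ \near a, p a = 1.
  have [Ua|nUa] := pselect (U a); last by exists (fun=> 0).
  by have [p tp pa] := local_cutoff tchi chi1 oU Ua; exists p.
have {H}[P hP] := choice H.
move: cK; rewrite compact_cover => /(_ Rd K (fun a => [set y | P a y = 1]°)).
case.
- by move=> a _; exact: open_interior.
- by move=> a Ka; exists a => //; have [_] := hP a (KU _ Ka).
move=> D DK cov.
suff [psi tpsi hpsi] : exists2 psi, test U psi &
    forall y, (exists2 a, a \in finmap.enum_fset D & P a y = 1) -> psi y = 1.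
  exists psi => // y Ky; apply: hpsi; have [a Da ya] := cov _ Ky.
  by exists a => //; exact: interior_subset ya.
have : forall a, a \in finmap.enum_fset D -> U a.
  by move=> a aD; apply: KU; have := DK a aD; rewrite inE.
elim: (finmap.enum_fset D) => [_|a s IH hs].
  by exists (fun=> 0) => [|y []//]; exact: test0.
have [|psi tpsi hpsi] := IH; first by move=> b bs; apply: hs; rewrite inE bs orbT.
have [ta _] := hP a (hs a (mem_head _ _)).
have [psi' tpsi' h'] := cutoff_union ta tpsi.
exists psi' => // y [b]; rewrite inE => /orP[/eqP -> py|bs py]; apply: h'.
  by left.
by right; apply: hpsi; exists b.
Qed.

End Cutoff.

(** * Growth of nets *)

Section Growth.
Variables (R : realType) (omega : R -> R).
Hypothesis womega : weight omega.
Local Notation itv := (unit_itv R).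
Local Notation growth := (growth omega).
Implicit Types (u v : itv -> R) (k l : R).

(** The relation of [moderate] and [negligible] for a real net and a real
    exponent k of any sign. *)
Definition small u k := (fun e => u e) =o_ (@eps0 R) (growth k).

Lemma growth_gt0 k (e : itv) : 0 < growth k e. Proof. exact: expR_gt0. Qed.
Lemma growth_ge0 k (e : itv) : 0 <= growth k e. Proof. exact: expR_ge0. Qed.

Lemma growthD k l (e : itv) : growth (k + l) e = growth k e * growth l e.
Proof. by rewrite /Defs.growth mulrDl expRD. Qed.

Lemma growth_le k l (e : itv) : k <= l -> growth k e <= growth l e.
Proof.
move=> kl; rewrite ler_expR ler_wpM2r//; case: womega => -[w0 _ _ _] _; apply: w0.
by rewrite invr_ge0; case: e => e /= /andP[/ltW].
Qed.

Lemma smallP u k : small u k <->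
  forall c, 0 < c -> \forall e \near @eps0 R, `|u e| <= c * growth k e.
Proof.
split=> [/eqoP h c c0|h].
  by apply: filterS (h _ c0) => e; rewrite (gtr0_norm (growth_gt0 k e)).
apply/eqoP => c c0; apply: filterS (h _ c0) => e.
by rewrite (gtr0_norm (growth_gt0 k e)).
Qed.

Lemma omega_cvgy : omega t @[t --> +oo] --> +oo.
Proof.
case: (womega) => -[w0 _ _ _] [_ _ h].
apply/cvgryPge => A; have /cvgryPge/(_ `|A|) hA := h.
near=> t; have t1 : expR 1 <= t by near: t; exact: nbhs_pinfty_ge.
have l1 : 1 <= ln (1 + t).
  rewrite -[leLHS](expRK 1) ler_ln ?posrE ?expR_gt0//.
    by rewrite (le_trans t1)// lerDr.
  by rewrite addr_gt0// (lt_le_trans _ t1)// expR_gt0.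
have l0 : 0 < ln (1 + t) by exact: lt_le_trans l1.
have : `|A| <= omega t / ln (1 + t) by near: t; exact: hA.
rewrite ler_pdivlMr// => /(le_trans _); apply.
by rewrite (le_trans (ler_norm A))// ler_peMr.
Unshelve. all: by end_near. Qed.

(** Domination of the logarithm makes omega unbounded, which is what separates
    the exponents of the scale [growth]. *)
Lemma growth_large k (C : R) : 0 < k -> \forall e \near @eps0 R, C <= growth k e.
Proof.
move=> k0.
have /cvgryPge/(_ (C / k)) h := omega_cvgy.
have h2 : \forall e \near 0^'+, C / k <= omega e^-1.
  have : (x : R)^-1 @[x --> 0^'+] --> +oo.
    by apply/(@cvgrVy _ _ (0^'+ : set_system R) _ id);
      [exact: nbhs_right_gt|exact: (@cvg_within _ (nbhs (0 : R)))].
  exact: (fun c => c _ h).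
suff : \forall e \near (0 : R)^'+, forall he : 0 < e < 1,
    C <= growth k (exist _ e he) by [].
apply: filterS h2 => e h2 he; rewrite /Defs.growth /=; move: h2.
rewrite ler_pdivrMr// mulrC => Cw; rewrite (le_trans Cw)//.
by rewrite (le_trans _ (expR_ge1Dx _))// lerDr.
Qed.

Lemma small_bound u k : small u k -> \forall e \near @eps0 R, `|u e| <= growth k e.
Proof. by move=> /smallP/(_ 1 ltr01); apply: filterS => e; rewrite mul1r. Qed.

Lemma bound_small u k l (C : R) : k < l ->
  (\forall e \near @eps0 R, `|u e| <= C * growth k e) -> small u l.
Proof.
move=> kl hu; apply/smallP => c c0.
have lk : 0 < l - k by rewrite subr_gt0.
apply: filterS2 hu (growth_large (C / c) lk) => e ue Ce.
rewrite (le_trans ue)// -{1}(subrKC k l) growthD.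
by rewrite [growth k e * _]mulrC mulrA ler_wpM2r ?growth_ge0// -ler_pdivrMl// mulrC.
Qed.

Lemma small_le u v k : small v k -> (\forall e \near @eps0 R, `|u e| <= `|v e|) -> small u k.
Proof.
move=> /smallP hv uv; apply/smallP => c c0.
by apply: filterS2 uv (hv c c0) => e; exact: le_trans.
Qed.

Lemma smallD u v k : small u k -> small v k -> small (fun e => u e + v e) k.
Proof.
move=> /smallP hu /smallP hv; apply/smallP => c c0.
have c2 : 0 < c / 2 by rewrite divr_gt0.
apply: filterS2 (hu _ c2) (hv _ c2) => e ue ve.
rewrite (le_trans (ler_normD _ _))// (le_trans (lerD ue ve))//.
by rewrite -mulrDl -splitr.
Qed.

Lemma smallZ u k (C : R) : small u k -> small (fun e => C * u e) k.
Proof.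
move=> /smallP hu; apply/smallP => c c0.
have p : 0 < c / (`|C| + 1) by rewrite divr_gt0// ltr_wpDl.
apply: filterS (hu _ p) => e ue; rewrite normrM.
have -> : c * growth k e = (`|C| + 1) * (c / (`|C| + 1) * growth k e).
  by rewrite mulrA mulrC mulrCA mulfV ?mulr1 1?mulrC// gt_eqF// ltr_wpDl.
by rewrite ler_pM// lerDl.
Qed.

Lemma small_mono u k l : k <= l -> small u k -> small u l.
Proof.
move=> kl /smallP hu; apply/smallP => c c0; apply: filterS (hu c c0) => e ue.
by rewrite (le_trans ue)// ler_wpM2l ?growth_le// ltW.
Qed.

Lemma small0 k : small (fun=> 0) k.
Proof.
by apply/smallP => c c0; apply: nearW => e; rewrite normr0 mulr_ge0 ?growth_ge0// ltW.
Qed.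

Lemma small_cst k (C : R) : 0 < k -> small (fun=> C) k.
Proof.
move=> k0; apply: (@bound_small _ 0 _ `|C|) => //; apply: nearW => e.
by rewrite /Defs.growth mul0r expR0 mulr1.
Qed.

Lemma smallM u v k l : small u k -> small v l ->
  small (fun e => u e * v e) (k + l).
Proof.
move=> /small_bound hu /smallP hv; apply/smallP => c c0.
apply: filterS2 hu (hv _ c0) => e ue ve; rewrite normrM growthD mulrCA.
by rewrite ler_pM.
Qed.

End Growth.

(** Lists are used instead of finite sets of indices, on a type without
    decidable equality, to sum seminorms. *)
Lemma finite_set_list (T : Type) (F : set T) : finite_set F ->
  exists s : seq T, forall i, F i <-> List.In i s.
Proof.
move=> /(@finite_seqP {classic T})[s Fs]; exists s => i; rewrite Fs /=.
elim: s {Fs} => [|a s IH]; first by split.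
rewrite inE; split=> [/orP[/eqP ->|/IH]|[->|/IH h]].
- by left.
- by right.
- by rewrite eqxx.
- by rewrite h orbT.
Qed.

(** * Lifting maps to classes of nets *)

Section Quotient.
Variables (R : realType) (omega : R -> R).
Hypothesis womega : weight omega.

(** Nonnegative subhomogeneous functions on the subspace A, such that a sum is
    controlled by another member of the family.  Seminorms satisfy this
    with j = i; the infima [ultradiff_norm] do with j <> i.  Three terms are
    required at once because increments of bilinear maps have three terms. *)
Definition quasi_seminorms (V : lmodType R[i]) (A : set V) I (mu : I -> V -> R) :=
  [/\ A 0, (forall x y, A x -> A y -> A (x + y)) & (forall (c : R[i]) x, A x -> A (c *: x))] /\
  [/\ (forall i x, A x -> 0 <= mu i x),
      (forall i (c : R[i]) x, A x -> mu i (c *: x) <= Normc.normc c * mu i x) &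
      (forall i, exists j C, forall x y z, A x -> A y -> A z ->
         mu i (x + y + z) <= C * (mu j x + mu j y + mu j z))].

Section Space.
Variables (V : lmodType R[i]) (A : set V) (I : Type) (mu : I -> V -> R).
Hypothesis ss : quasi_seminorms A mu.
Local Notation G := (generalization omega A mu).
Local Notation small := (small omega).
Local Notation moderate := (moderate omega A mu).
Local Notation negligible := (Defs.negligible omega A mu).
Implicit Types (g h : net V) (x y z : G).

Lemma subspaceN v : A v -> A (- v).
Proof. by case: ss => -[_ _ h] _ Av; rewrite -scaleN1r; exact: h. Qed.

Lemma subspaceD v w : A v -> A w -> A (v + w).
Proof. by case: ss => -[_ h _] _; exact: h. Qed.

Lemma subspaceB v w : A v -> A w -> A (v - w).
Proof. by move=> Av Aw; apply: subspaceD => //; exact: subspaceN. Qed.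

Lemma small_opp i g k : (forall e, A (g e)) -> small (fun e => mu i (g e)) k ->
  small (fun e => mu i (- g e)) k.
Proof.
case: ss => _ [p h _] Ag sg; apply: small_le sg _; apply: nearW => e.
rewrite !ger0_norm ?p//; last exact: subspaceN.
by rewrite -scaleN1r (le_trans (h _ _ _ (Ag e)))// normc_opp normc_1 mul1r.
Qed.

Lemma small_index0 i k : small (fun=> mu i 0) k.
Proof.
case: ss => -[A0 _ _] [p h _]; rewrite (_ : mu i 0 = 0); first exact: small0.
apply/eqP; rewrite eq_le p// andbT -[X in mu i X](scale0r 0).
by rewrite (le_trans (h _ _ _ A0))// normc_0 mul0r.
Qed.

Lemma small_add3 i : exists j, forall (u v w : net V) k,
  (forall e, A (u e)) -> (forall e, A (v e)) -> (forall e, A (w e)) ->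
  small (fun e => mu j (u e)) k -> small (fun e => mu j (v e)) k ->
  small (fun e => mu j (w e)) k -> small (fun e => mu i (u e + v e + w e)) k.
Proof.
case: ss => _ [p _ /(_ i)[j [C hC]]]; exists j => u v w k Au Av Aw su sv sw.
apply: (small_le (smallZ C (smallD (smallD su sv) sw))); apply: nearW => e /=.
rewrite ger0_norm ?p//; last by apply: subspaceD => //; exact: subspaceD.
exact: le_trans (hC _ _ _ (Au e) (Av e) (Aw e)) (ler_norm _).
Qed.

Lemma small_add2 i : exists j, forall (u v : net V) k,
  (forall e, A (u e)) -> (forall e, A (v e)) ->
  small (fun e => mu j (u e)) k -> small (fun e => mu j (v e)) k ->
  small (fun e => mu i (u e + v e)) k.
Proof.
have [j hj] := small_add3 i; exists j => u v k Au Av su sv.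
rewrite (_ : (fun e => _) = (fun e => mu i (u e + v e + 0))); last first.
  by apply/funext => e; rewrite addr0.
by apply: (hj u v (fun=> 0)) => //; [case: ss => -[]|exact: small_index0].
Qed.

Lemma negligible0 : negligible (fun=> 0).
Proof. by split=> [_|i k _]; [case: ss => -[]|exact: small_index0]. Qed.

Lemma negligibleD g h : negligible g -> negligible h ->
  negligible (fun e => g e + h e).
Proof.
move=> [Ag sg] [Ah sh]; split=> [e|i k k0]; first exact: subspaceD.
by have [j hj] := small_add2 i; apply: (hj g h); [| |exact: sg|exact: sh].
Qed.

Lemma negligibleN g : negligible g -> negligible (fun e => - g e).
Proof.
move=> [Ag sg]; split=> [e|i k k0]; first exact: subspaceN.
by apply: small_opp => //; exact: sg.
Qed.

Lemma negligibleB g h : negligible g -> negligible h ->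
  negligible (fun e => g e - h e).
Proof. by move=> ng nh; apply: negligibleD => //; exact: negligibleN. Qed.

Lemma moderateD g h : moderate g -> moderate h -> moderate (fun e => g e + h e).
Proof.
move=> [Ag sg] [Ah sh]; split=> [e|i]; first exact: subspaceD.
have [j hj] := small_add2 i; have [k k0 gk] := sg j; have [l l0 hl] := sh j.
exists (Num.max k l); first by rewrite lt_max k0.
by apply: hj => //; [apply: small_mono gk|apply: small_mono hl];
  rewrite // le_max lexx ?orbT.
Qed.

Lemma moderate_cst (v : V) : A v -> moderate (fun=> v).
Proof. by move=> Av; split=> // i; exists 1 => //; exact: small_cst. Qed.

Lemma class_of_moderate g : moderate g -> exists x, represents g x.
Proof.
move=> mg; exists (exist _ (net_class omega A mu g) (ex_intro2 _ _ g mg erefl)).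
by split=> //; rewrite (_ : (fun e => _) = fun=> 0) ?subrr//;
  [exact: negligible0|apply/funext => e; rewrite subrr].
Qed.

Lemma representsE x : exists2 g, moderate g & sval x = net_class omega A mu g.
Proof. by case: x. Qed.

Lemma represents_moderate g x : represents g x -> moderate g.
Proof. by have [g0 _ xg0] := representsE x; rewrite /represents xg0 => -[]. Qed.

Lemma represented x : exists g, represents g x.
Proof.
have [g mg xg] := representsE x; exists g; rewrite /represents xg; split => //.
by rewrite (_ : (fun e => _) = fun=> 0); [exact: negligible0|
  apply/funext => e; rewrite subrr].
Qed.

Lemma represents_diff g h x : represents g x -> represents h x ->
  negligible (fun e => g e - h e).
Proof.
have [g0 mg0 xg] := representsE x; rewrite /represents xg => -[_ ng] [_ nh].
rewrite (_ : (fun e => _) = fun e => (g e - g0 e) - (h e - g0 e)).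
  exact: negligibleB.
by apply/funext => e; rewrite opprB addrA subrK.
Qed.

Lemma represents_negligible g h x : represents g x -> moderate h ->
  negligible (fun e => h e - g e) -> represents h x.
Proof.
have [g0 mg0 xg] := representsE x; rewrite /represents xg => -[_ ng] mh nhg; split=> //.
rewrite (_ : (fun e => _) = fun e => (h e - g e) + (g e - g0 e)).
  exact: negligibleD.
by apply/funext => e; rewrite addrA subrK.
Qed.

Lemma represents_inj g x y : represents g x -> represents g y -> x = y.
Proof.
move=> gx gy; suff xy : sval x = sval y.
  by case: x y xy {gx gy} => [C ?] [D ?] /= CD; exact: eq_exist.
by apply/seteqP; split=> h hh; [apply: (represents_negligible gy)|
  apply: (represents_negligible gx)];
  rewrite ?(represents_moderate hh)//; [exact: (@represents_moderate h x)|
  exact: (@represents_diff h g x)|exact: (@represents_moderate h y)|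
  exact: (@represents_diff h g y)].
Qed.

(** The relation of [sharp_ball] for all the representatives instead of some. *)
Definition close i l x y := forall g h, represents g x -> represents h y ->
  small (fun e => mu i (h e - g e)) (- l).

Lemma close_ball i l x y : close i l x y -> sharp_ball (i, l) x y.
Proof.
have [g gx] := represented x; have [h hy] := represented y.
by move=> /(_ g h gx hy) c; exists g, h.
Qed.

Lemma ball_refl i l x : 0 < l -> sharp_ball (i, l) x x.
Proof.
move=> l0; apply: close_ball => g h gx hx.
by have [_] := represents_diff hx gx; exact.
Qed.

(** Two representatives differ by a negligible net, which costs one use of the
    triangle inequality, hence a change of index. *)
Lemma ball_close i : exists j, forall l x y, 0 < l ->
  sharp_ball (j, l) x y -> close i l x y.
Proof.
have [j hj] := small_add2 i; exists j => l x y l0.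
move=> [g0 [h0 [gx0 hy0 s0]]] g h gx hy.
have [Ah nh] := represents_diff hy hy0; have [Ag ng] := represents_diff gx gx0.
have [Agh ngh] := negligibleB (represents_diff hy hy0) (represents_diff gx gx0).
rewrite (_ : (fun e => _) = fun e => mu i ((h0 e - g0 e) + ((h e - h0 e) - (g e - g0 e)))).
  apply: hj => // [e|]; last exact: ngh.
  by apply: subspaceB; [case: (represents_moderate hy0)|case: (represents_moderate gx0)].
apply/funext => e; congr (mu i _).
by rewrite addrCA opprB [h0 e - g0 e + _]addrA subrK addrA subrK.
Qed.

Lemma ball_trans i : exists j, forall l x y z, 0 < l ->
  sharp_ball (j, l) x y -> sharp_ball (j, l) y z -> sharp_ball (i, l) x z.
Proof.
have [j hj] := small_add3 i; exists j => l x y z l0.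
move=> [g [h [gx hy s1]]] [h' [k [hy' kz s2]]]; exists g, k; split=> //.
have [Ah nh] := represents_diff hy' hy.
have [mg _] := represents_moderate gx; have [mh _] := represents_moderate hy.
have [mh' _] := represents_moderate hy'; have [mk _] := represents_moderate kz.
rewrite (_ : (fun e => _) = fun e => mu i ((h e - g e) + (h' e - h e) + (k e - h' e))).
  apply: (hj (fun e => h e - g e) (fun e => h' e - h e) (fun e => k e - h' e)) => //.
  - by move=> e; exact: subspaceB.
  - by move=> e; exact: subspaceB.
  - exact: nh.
apply/funext => e; congr (mu i _).
by rewrite [RHS]addrC [_ + (h' e - h e)]addrC [_ + (h e - g e)]addrA subrK addrA subrK.
Qed.

(** The points of which U is a sharp neighbourhood form a sharply open set:
    around each of them a smaller ball has its own balls inside the given ones,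
    by [ball_trans]. *)
Lemma sharp_neighbourhoodsP : sharp_neighbourhoods omega A mu.
Proof.
move=> x U; rewrite nbhsE /=; split=> [[W [oW Wx] WU]|[F iF FU]].
  by have [F iF FW] := oW x Wx; exists F => // y /FW /WU.
exists [set y | sharp_nbhs y U]; last first.
  move=> y [H [_ H0] HU]; apply: HU => -[i l] /H0 /= l0; exact: ball_refl.
split; last by exists F.
move=> y [H [fH H0] HU].
have [k hk] := choice ball_trans.
pose H' := (fun p => (k p.1, p.2)) @` H.
have iH' : sharp_index H'.
  by split; [exact: finite_image|move=> _ [p Hp <-]; exact: (H0 _ Hp)].
exists H' => // z Hz; exists H' => // w Hw; apply: HU => -[i l] Hil.
have l0 : 0 < l := H0 _ Hil.
by apply: (hk i l y z w l0); [apply: Hz|apply: Hw]; exists (i, l).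
Qed.

Lemma nbhs_close i l x : 0 < l -> nbhs x [set y | close i l x y].
Proof.
move=> l0; apply/sharp_neighbourhoodsP; have [j hj] := ball_close i.
exists [set (j, l)]; first by split; [exact: finite_set1|move=> _ ->].
by move=> y /(_ (j, l) erefl); exact: hj.
Qed.

End Space.

Lemma filter_list (T J : Type) (F : set_system T) {FF : Filter F} (s : seq J)
  (P : J -> set T) : (forall j, List.In j s -> F (P j)) ->
  F [set x | forall j, List.In j s -> P j x].
Proof.
elim: s => [_|a s IH h]; first by apply: filterE => x j [].
have Fa : F (P a) by apply: h; left.
have Fs := IH (fun j js => h j (or_intror js)).
by apply: filterS2 Fa Fs => x Pa Ps j [<-|] //; exact: Ps.
Qed.

Lemma small_sum (V : lmodType R[i]) I (mu : I -> V -> R) (s : seq I) (g : net V) k :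
  (forall j, List.In j s -> small omega (fun e => mu j (g e)) k) ->
  small omega (fun e => \sum_(j <- s) mu j (g e)) k.
Proof.
elim: s => [_|a s IH h].
  by under [X in small _ X _]eq_fun do rewrite big_nil; exact: small0.
under [X in small _ X _]eq_fun do rewrite big_cons.
by apply: smallD; [apply: h; left|apply: IH => j js; apply: h; right].
Qed.

(** A single exponent bounds finitely many seminorms of a moderate net. *)
Lemma moderate_sum (V : lmodType R[i]) (A : set V) I (mu : I -> V -> R) (s : seq I)
    (g : net V) : moderate omega A mu g ->
  exists2 k, 0 < k & small omega (fun e => \sum_(j <- s) mu j (g e)) k.
Proof.
move=> [_ mg]; elim: s => [|a s [k k0 IH]].
  exists 1 => //; under [X in small _ X _]eq_fun do rewrite big_nil.
  exact: small0.
have [l l0 hl] := mg a; exists (Num.max k l); first by rewrite lt_max k0.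
under [X in small _ X _]eq_fun do rewrite big_cons.
by apply: smallD; [apply: small_mono hl|apply: small_mono IH];
  rewrite // le_max lexx ?orbT.
Qed.

Section TwoVariables.
Variables (V1 V2 V3 : lmodType R[i]) (A1 : set V1) (A2 : set V2) (A3 : set V3).
Variables (I1 I2 I3 : Type).
Variables (mu1 : I1 -> V1 -> R) (mu2 : I2 -> V2 -> R) (mu3 : I3 -> V3 -> R).
Hypotheses (ss1 : quasi_seminorms A1 mu1) (ss2 : quasi_seminorms A2 mu2)
  (ss3 : quasi_seminorms A3 mu3).
Local Notation G1 := (generalization omega A1 mu1).
Local Notation G2 := (generalization omega A2 mu2).
Local Notation G3 := (generalization omega A3 mu3).
Local Notation small := (small omega).

(** The same estimate gives both conclusions.  Negligible increments satisfy it
    for every l, so the class of f (g e) (h e) depends on the classes of g and h only;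
    increments of order exp (- m omega (1 / e)) give continuity. *)
Lemma lift2 (f : V1 -> V2 -> V3) :
  (forall g h, moderate omega A1 mu1 g -> moderate omega A2 mu2 h ->
     moderate omega A3 mu3 (fun e => f (g e) (h e))) ->
  (forall g h, moderate omega A1 mu1 g -> moderate omega A2 mu2 h ->
     forall i l, 0 < l -> exists s t m, 0 < m /\
       forall g' h', moderate omega A1 mu1 g' -> moderate omega A2 mu2 h' ->
         (forall j, List.In j s -> small (fun e => mu1 j (g' e - g e)) (- m)) ->
         (forall j, List.In j t -> small (fun e => mu2 j (h' e - h e)) (- m)) ->
         small (fun e => mu3 i (f (g' e) (h' e) - f (g e) (h e))) (- l)) ->
  exists F : G1 -> G2 -> G3,
    (forall x y g h, represents g x -> represents h y ->
       represents (fun e => f (g e) (h e)) (F x y)) /\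
    continuous (fun p : G1 * G2 => F p.1 p.2).
Proof.
move=> mf lf.
have wd (p : G1 * G2) : exists z : G3, forall g h,
    represents g p.1 -> represents h p.2 -> represents (fun e => f (g e) (h e)) z.
  case: p => x y /=; have [g gx] := represented ss1 x.
  have [h hy] := represented ss2 y.
  have [mg mh] := (represents_moderate gx, represents_moderate hy).
  have [z zr] := class_of_moderate ss3 (mf _ _ mg mh).
  exists z => g' h' gx' hy'.
  have [mg' mh'] := (represents_moderate gx', represents_moderate hy').
  have mfg := mf _ _ mg mh; have mfg' := mf _ _ mg' mh'.
  apply: (represents_negligible ss3 zr) => //; split=> [e|i l l0].
    by apply: (subspaceB ss3); [case: mfg'|case: mfg].
  have [s [t [m [m0]]]] := lf _ _ mg mh i l l0.
  apply=> // j _.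
    by have [_] := represents_diff ss1 gx' gx; exact.
  by have [_] := represents_diff ss2 hy' hy; exact.
have [F hF] := choice wd; exists (fun x y => F (x, y)); split=> [x y g h gx hy|].
  exact: (hF (x, y)).
move=> [x y] /= U /(sharp_neighbourhoodsP ss3)[P [fP P0] PU].
have [ps psP] := finite_set_list fP.
have : nbhs (x, y) [set q | forall p, List.In p ps ->
    sharp_ball p (F (x, y)) (F (q.1, q.2))].
  apply: filter_list => -[i l] /psP Pil; have l0 : 0 < l := P0 _ Pil.
  have [g gx] := represented ss1 x; have [h hy] := represented ss2 y.
  have [mg mh] := (represents_moderate gx, represents_moderate hy).
  have [s [t [m [m0 st]]]] := lf _ _ mg mh i l l0.
  exists ([set x' | forall j, List.In j s -> close j m x x'],
          [set y' | forall j, List.In j t -> close j m y y']).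
    by split; apply: filter_list => j _; [exact: (nbhs_close ss1)|exact: (nbhs_close ss2)].
  move=> [x' y'] [/= sx ty].
  have [g' gx'] := represented ss1 x'; have [h' hy'] := represented ss2 y'.
  have [mg' mh'] := (represents_moderate gx', represents_moderate hy').
  exists (fun e => f (g e) (h e)), (fun e => f (g' e) (h' e)); split.
  - exact: (hF (x, y)).
  - exact: (hF (x', y')).
  - by apply: st => // j js; [exact: sx|exact: ty].
apply: filterS => q hq; apply: PU => p Pp; rewrite /=; apply: hq.
by apply/psP.
Qed.

(** Sums over lists of indices replace maxima: they are the continuous seminorms
    that dominate finite families. *)
Definition bounded_bilinear (b : V1 -> V2 -> V3) :=
  [/\ forall x y, A1 x -> A2 y -> A3 (b x y),
      forall x x' y, A1 x -> A1 x' -> A2 y -> b (x + x') y = b x y + b x' y,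
      forall x y y', A1 x -> A2 y -> A2 y' -> b x (y + y') = b x y + b x y' &
      forall i, exists s t C, forall x y, A1 x -> A2 y ->
        mu3 i (b x y) <= C * ((\sum_(j <- s) mu1 j x) * \sum_(j <- t) mu2 j y)].

Lemma lift_bilinear (b : V1 -> V2 -> V3) : bounded_bilinear b ->
  exists F : G1 -> G2 -> G3,
    (forall x y g h, represents g x -> represents h y ->
       represents (fun e => b (g e) (h e)) (F x y)) /\
    continuous (fun p : G1 * G2 => F p.1 p.2).
Proof.
move=> [bA bl br bb]; have mu3_ge0 := ss3.2.
have bsmall i : exists s t, forall g h k l, (forall e, A1 (g e)) -> (forall e, A2 (h e)) ->
    small (fun e => \sum_(j <- s) mu1 j (g e)) k ->
    small (fun e => \sum_(j <- t) mu2 j (h e)) l ->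
    small (fun e => mu3 i (b (g e) (h e))) (k + l).
  have [s [t [C hC]]] := bb i; exists s, t => g h k l Ag Ah gk hl.
  apply: (small_le (smallZ C (smallM gk hl))); apply: nearW => e /=.
  case: mu3_ge0 => p _ _; rewrite ger0_norm ?p//; last exact: bA.
  exact: le_trans (hC _ _ (Ag e) (Ah e)) (ler_norm _).
apply: lift2 => [g h mg mh|g h mg mh i l l0].
  split=> [e|i]; first by apply: bA; [case: mg|case: mh].
  have [s [t hst]] := bsmall i.
  have [k k0 gk] := moderate_sum s mg.
  have [l l0 hl] := moderate_sum t mh.
  exists (k + l); first exact: addr_gt0.
  by apply: hst; [case: mg|case: mh| |].
have [j hj] := small_add3 ss3 i; have [s [t hst]] := bsmall j.
have [k k0 gk] := moderate_sum s mg.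
have [k' k'0 hk'] := moderate_sum t mh.
exists s, t, (l + k + k'); split; first by rewrite !addr_gt0.
move=> g' h' mg' mh' gs ht.
have Ag : forall e, A1 (g e) by case: mg.
have Ah : forall e, A2 (h e) by case: mh.
have Au e : A1 (g' e - g e) by apply: (subspaceB ss1) => //; case: mg'.
have Av e : A2 (h' e - h e) by apply: (subspaceB ss2) => //; case: mh'.
have us := small_sum gs; have vt := small_sum ht.
rewrite (_ : (fun e => _) = (fun e => mu3 i (b (g' e - g e) (h' e - h e) +
    b (g' e - g e) (h e) + b (g e) (h' e - h e)))).
  apply: hj => [e|e|e|||]; try by apply: bA.
  - by apply: small_mono (hst _ _ _ _ Au Av us vt) => //; lra.
  - by apply: small_mono (hst _ _ _ _ Au Ah us hk') => //; lra.
  - by apply: small_mono (hst _ _ _ _ Ag Av gk vt) => //; lra.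
apply/funext => e; congr (mu3 i _).
rewrite -[in LHS](subrK (g e) (g' e)) -[in LHS](subrK (h e) (h' e)).
have Ah' : A2 (h' e - h e + h e) by rewrite subrK; case: mh'.
rewrite (bl _ _ _ (Au e) (Ag e) Ah') (br _ _ _ (Au e) (Av e) (Ah e)).
by rewrite (br _ _ _ (Ag e) (Av e) (Ah e)) addrA addrK.
Qed.

End TwoVariables.

End Quotient.

(** * Rings, modules and algebras of classes *)

Lemma continuous_slice (T1 T2 T3 : topologicalType) (F : T1 -> T2 -> T3) (a : T1) :
  continuous (fun p : T1 * T2 => F p.1 p.2) -> continuous (F a).
Proof.
move=> cF x U /(cF (a, x))[[P Q] /= [Pa Qx] PQU].
apply: filterS Qx => y Qy; apply: (PQU (a, y)); split=> //=; exact: nbhs_singleton.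
Qed.

Section Lifts.
Variables (R : realType) (omega : R -> R).
Hypothesis womega : weight omega.
Local Notation Ct := (generalized_constants omega).

Lemma lift_add (V : lmodType R[i]) (A : set V) (I : Type) (mu : I -> V -> R) :
  quasi_seminorms A mu ->
  exists F : generalization omega A mu -> generalization omega A mu ->
             generalization omega A mu,
    (forall x y g h, represents g x -> represents h y ->
       represents (fun e => g e + h e) (F x y)) /\
    continuous (fun p : generalization omega A mu * generalization omega A mu => F p.1 p.2).
Proof.
move=> ss; apply: (lift2 ss ss ss (f := +%R)) => [g h|g h mg mh i l l0].
  exact: moderateD.
have [j hj] := small_add2 omega ss i; exists [:: j], [:: j], l; split=> //.
move=> g' h' mg' mh' gs ht.
rewrite (_ : (fun e => _) = (fun e => mu i ((g' e - g e) + (h' e - h e)))); last first.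
  by apply/funext => e; rewrite opprD addrACA.
apply: hj => [e|e||]; [apply: (subspaceB ss)|apply: (subspaceB ss)|apply: gs|apply: ht];
  by [case: mg'|case: mg|case: mh'|case: mh|left].
Qed.

Lemma complex_quasi_seminorms :
  quasi_seminorms [set: R[i]^o] (fun (_ : unit) (z : R[i]^o) => Normc.normc z).
Proof.
split; first by [].
split=> [_ z _|_ c z _|_]; [exact: normc_ge0|by rewrite normc_mul|].
exists tt, 1 => x y z _ _ _; rewrite mul1r.
by rewrite (le_trans (normcD _ _))// lerD2r normcD.
Qed.

Section Space.
Variables (V : lmodType R[i]) (A : set V) (I : Type) (mu : I -> V -> R).
Hypothesis ss : quasi_seminorms A mu.
Local Notation G := (generalization omega A mu).

Lemma represents_eq (x y : G) g h : represents g x -> represents h y ->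
  (forall e, g e = h e) -> x = y.
Proof. by move=> gx hy /funext gh; apply: (represents_inj ss gx); rewrite gh. Qed.

Lemma lift_scale : exists F : Ct -> G -> G,
    (forall a x c g, represents c a -> represents g x ->
       represents (fun e => (c e : R[i]) *: g e) (F a x)) /\
    continuous (fun p : Ct * G => F p.1 p.2).
Proof.
apply: (lift_bilinear womega (b := fun (c : R[i]^o) v => (c : R[i]) *: v)
  complex_quasi_seminorms ss ss).
case: (ss) => -[_ _ AZ] [_ hZ _]; split.
- by move=> c v _; exact: AZ.
- by move=> c c' v _ _ _; rewrite scalerDl.
- by move=> c v v' _ _ _; rewrite scalerDr.
by move=> i; exists [:: tt], [:: i], 1 => c v _ Av; rewrite !big_seq1 mul1r; exact: hZ.
Qed.

Lemma represents_cst (v : V) : A v -> exists x : G, represents (fun=> v) x.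
Proof. by move=> Av; apply: (class_of_moderate ss); exact: moderate_cst. Qed.

(** The opposite is the multiplication by the class of -1, which makes its
    continuity a case of [lift_scale]. *)
Lemma exists_group : exists (zero : G) (opp : G -> G) (add : G -> G -> G),
  [/\ represents (fun=> 0) zero,
      (forall x g, represents g x -> represents (fun e => - g e) (opp x)) &
      (forall x y g h, represents g x -> represents h y ->
         represents (fun e => g e + h e) (add x y))] /\
  topological_group zero opp add.
Proof.
have [zero rzero] : exists x : G, represents (fun=> 0) x.
  by apply: represents_cst; case: ss => -[].
have [add [radd cadd]] := lift_add ss.
have [scale [rscale cscale]] := lift_scale.
have [a ra] := class_of_moderate complex_quasi_seminorms
  (moderate_cst womega _ (Logic.I : setT (-1 : R[i]^o))).
have ropp x g : represents g x -> represents (fun e => - g e) (scale a x).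
  move=> gx; rewrite (_ : (fun e => _) = fun e => (-1 : R[i]) *: g e).
    exact: (rscale a x (fun=> -1) g).
  by apply/funext => e; rewrite scaleN1r.
exists zero, (scale a), add; split=> //; split.
- move=> x y z; have [g gx] := represented ss x; have [h hy] := represented ss y.
  have [k kz] := represented ss z.
  apply: (represents_eq (radd _ _ _ _ gx (radd _ _ _ _ hy kz))
    (radd _ _ _ _ (radd _ _ _ _ gx hy) kz)) => e; exact: addrA.
- move=> x y; have [g gx] := represented ss x; have [h hy] := represented ss y.
  by apply: (represents_eq (radd _ _ _ _ gx hy) (radd _ _ _ _ hy gx)) => e; exact: addrC.
- move=> x; have [g gx] := represented ss x.
  by apply: (represents_eq (radd _ _ _ _ rzero gx) gx) => e; exact: add0r.
- move=> x; have [g gx] := represented ss x.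
  by apply: (represents_eq (radd _ _ _ _ (ropp _ _ gx) gx) rzero) => e; exact: addNr.
by split=> //; exact: (@continuous_slice Ct G G).
Qed.

End Space.

Lemma exists_constants : exists r : ring_ops Ct,
  componentwise_ring r /\ topological_comring r.
Proof.
have ss := complex_quasi_seminorms.
have [zero [opp [add [[rzero ropp radd] tg]]]] := exists_group ss.
have [one rone] := represents_cst ss (v := 1 : R[i]^o) Logic.I.
have [mul [rmul cmul]] : exists F : Ct -> Ct -> Ct,
    (forall a x c g, represents c a -> represents g x ->
       represents (fun e => (c e : R[i]) * g e) (F a x)) /\
    continuous (fun p : Ct * Ct => F p.1 p.2) := lift_scale ss.
exists (RingOps zero one opp add mul); split; first by split.
split=> //; split=> /=.
- move=> x y z; have [g gx] := represented ss x; have [h hy] := represented ss y.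
  have [k kz] := represented ss z.
  by apply: (represents_eq ss (rmul _ _ _ _ gx (rmul _ _ _ _ hy kz))
    (rmul _ _ _ _ (rmul _ _ _ _ gx hy) kz)) => e; exact: mulrA.
- move=> x y; have [g gx] := represented ss x; have [h hy] := represented ss y.
  by apply: (represents_eq ss (rmul _ _ _ _ gx hy) (rmul _ _ _ _ hy gx)) => e; exact: mulrC.
- move=> x; have [g gx] := represented ss x.
  by apply: (represents_eq ss (rmul _ _ _ _ rone gx) gx) => e; exact: mul1r.
- move=> x y z; have [g gx] := represented ss x; have [h hy] := represented ss y.
  have [k kz] := represented ss z.
  by apply: (represents_eq ss (rmul _ _ _ _ (radd _ _ _ _ gx hy) kz)
    (radd _ _ _ _ (rmul _ _ _ _ gx kz) (rmul _ _ _ _ hy kz))) => e; exact: mulrDl.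
- exact: cmul.
Qed.

Section Structures.
Variable r : ring_ops Ct.
Hypothesis cr : componentwise_ring r.
Variables (V : lmodType R[i]) (A : set V) (I : Type) (mu : I -> V -> R).
Hypothesis ss : quasi_seminorms A mu.
Local Notation G := (generalization omega A mu).

Lemma exists_module : exists m : module_ops Ct G,
  componentwise_module m /\ topological_module r m.
Proof.
have ssC := complex_quasi_seminorms.
have [zero [opp [add [[rzero' ropp' radd'] tg]]]] := exists_group ss.
have [scale [rscale cscale]] := lift_scale ss.
case: cr => r0 r1 rN rD rM.
exists (ModuleOps zero opp add scale); split; first by split.
split=> //; split=> /=.
- move=> a b x; have [c ca] := represented ssC a; have [c' cb] := represented ssC b.
  have [g gx] := represented ss x.
  by apply: (represents_eq ss (rscale _ _ _ _ ca (rscale _ _ _ _ cb gx))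
    (rscale _ _ _ _ (rM _ _ _ _ ca cb) gx)) => e; exact: scalerA.
- move=> x; have [g gx] := represented ss x.
  by apply: (represents_eq ss (rscale _ _ _ _ r1 gx) gx) => e; exact: scale1r.
- move=> a x y; have [c ca] := represented ssC a; have [g gx] := represented ss x.
  have [h hy] := represented ss y.
  by apply: (represents_eq ss (rscale _ _ _ _ ca (radd' _ _ _ _ gx hy))
    (radd' _ _ _ _ (rscale _ _ _ _ ca gx) (rscale _ _ _ _ ca hy))) => e; exact: scalerDr.
- move=> a b x; have [c ca] := represented ssC a; have [c' cb] := represented ssC b.
  have [g gx] := represented ss x.
  by apply: (represents_eq ss (rscale _ _ _ _ (rD _ _ _ _ ca cb) gx)
    (radd' _ _ _ _ (rscale _ _ _ _ ca gx) (rscale _ _ _ _ cb gx))) => e; exact: scalerDl.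
- exact: cscale.
Qed.

Variable m : module_ops Ct G.
Hypotheses (cm : componentwise_module m) (tm : topological_module r m).

Lemma exists_algebra (b : V -> V -> V) :
  associative b -> left_distributive b +%R -> right_distributive b +%R ->
  (forall (a : R[i]) x y, a *: b x y = b (a *: x) y /\ a *: b x y = b x (a *: y)) ->
  (forall x y, A x -> A y -> A (b x y)) ->
  (forall i, exists s t C, forall x y, A x -> A y ->
     mu i (b x y) <= C * ((\sum_(j <- s) mu j x) * \sum_(j <- t) mu j y)) ->
  exists mul : G -> G -> G, [/\ componentwise2 b mul, topological_algebra r m mul &
    forall u : V, A u -> (forall x, A x -> b u x = x /\ b x u = x) ->
      exists2 x, represents (fun=> u) x & is_unit_for mul x].
Proof.
move=> bA bDl bDr bZ bin bb; have ssC := complex_quasi_seminorms.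
have [mul [rmul cmul]] : exists F : G -> G -> G,
    (forall x y g h, represents g x -> represents h y ->
       represents (fun e => b (g e) (h e)) (F x y)) /\
    continuous (fun p : G * G => F p.1 p.2) by apply: (lift_bilinear womega ss ss ss); split.
case: cm => m0 mN mD mZ.
exists mul; split=> //.
  split=> //; split=> //.
  - move=> x y z; have [g gx] := represented ss x; have [h hy] := represented ss y.
    have [k kz] := represented ss z.
    by apply: (represents_eq ss (rmul _ _ _ _ gx (rmul _ _ _ _ hy kz))
      (rmul _ _ _ _ (rmul _ _ _ _ gx hy) kz)) => e; exact: bA.
  - move=> x y z; have [g gx] := represented ss x; have [h hy] := represented ss y.
    have [k kz] := represented ss z.
    by apply: (represents_eq ss (rmul _ _ _ _ (mD _ _ _ _ gx hy) kz)
      (mD _ _ _ _ (rmul _ _ _ _ gx kz) (rmul _ _ _ _ hy kz))) => e; exact: bDl.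
  - move=> x y z; have [g gx] := represented ss x; have [h hy] := represented ss y.
    have [k kz] := represented ss z.
    by apply: (represents_eq ss (rmul _ _ _ _ gx (mD _ _ _ _ hy kz))
      (mD _ _ _ _ (rmul _ _ _ _ gx hy) (rmul _ _ _ _ gx kz))) => e; exact: bDr.
  move=> a x y; have [c ca] := represented ssC a; have [g gx] := represented ss x.
  have [h hy] := represented ss y; have cxy := mZ _ _ _ _ ca (rmul _ _ _ _ gx hy).
  split.
    by apply: (represents_eq ss cxy (rmul _ _ _ _ (mZ _ _ _ _ ca gx) hy)) => e;
      have [] := bZ (c e) (g e) (h e).
  by apply: (represents_eq ss cxy (rmul _ _ _ _ gx (mZ _ _ _ _ ca hy))) => e;
    have [] := bZ (c e) (g e) (h e).
move=> u Au hu; have [x ux] := represents_cst ss Au; exists x => //.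
split=> y; have [g gy] := represented ss y; have [Ag _] := represents_moderate gy.
  by apply: (represents_eq ss (rmul _ _ _ _ ux gy) gy) => e; have [] := hu _ (Ag e).
by apply: (represents_eq ss (rmul _ _ _ _ gy ux) gy) => e; have [] := hu _ (Ag e).
Qed.

(** The derivation on classes is the partial map, at the class of 1, of the lift
    of the bilinear map (c, x) |-> c D x. *)
Lemma exists_derivation (b : V -> V -> V) (mul : G -> G -> G) (D : V -> V) :
  componentwise2 b mul ->
  (forall x, A x -> A (D x)) ->
  (forall x y, A x -> A y -> D (x + y) = D x + D y) ->
  (forall (c : R[i]) x, A x -> D (c *: x) = c *: D x) ->
  (forall x y, A x -> A y -> D (b x y) = b (D x) y + b x (D y)) ->
  (forall i, exists s C, forall x, A x -> mu i (D x) <= C * \sum_(j <- s) mu j x) ->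
  exists D' : G -> G, componentwise1 D D' /\ continuous_derivation m mul D'.
Proof.
move=> rmul DA DD DZ DM Db; have ssC := complex_quasi_seminorms.
case: (ss) => -[A0 AD AZ] [_ hZ _].
have [F [rF cF]] : exists F : Ct -> G -> G,
    (forall a x c g, represents c a -> represents g x ->
       represents (fun e => (c e : R[i]) *: D (g e)) (F a x)) /\
    continuous (fun p : Ct * G => F p.1 p.2).
  apply: (lift_bilinear womega (b := fun (c : R[i]^o) v => (c : R[i]) *: D v) ssC ss ss).
  split.
  - by move=> c v _ Av; apply: AZ; exact: DA.
  - by move=> c c' v _ _ _; rewrite scalerDl.
  - by move=> c v v' _ Av Av'; rewrite DD// scalerDr.
  move=> i; have [s [C hC]] := Db i; exists [:: tt], s, C => c v _ Av.
  rewrite big_seq1 mulrCA (le_trans (hZ _ _ _ (DA _ Av)))//.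
  by rewrite ler_wpM2l ?normc_ge0// hC.
have [one rone] := represents_cst ssC (v := 1 : R[i]^o) Logic.I.
have rD : componentwise1 D (F one).
  move=> x g gx; rewrite (_ : (fun e => _) = fun e => (1 : R[i]) *: D (g e)).
    exact: (rF one x (fun=> 1) g).
  by apply/funext => e; rewrite scale1r.
case: cm => m0 mN mD mZ.
exists (F one); split=> //; split.
- move=> x y; have [g gx] := represented ss x; have [h hy] := represented ss y.
  have [Ag _] := represents_moderate gx; have [Ah _] := represents_moderate hy.
  by apply: (represents_eq ss (rD _ _ (mD _ _ _ _ gx hy))
    (mD _ _ _ _ (rD _ _ gx) (rD _ _ hy))) => e; exact: DD.
- move=> a x; have [c ca] := represented ssC a; have [g gx] := represented ss x.
  have [Ag _] := represents_moderate gx.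
  by apply: (represents_eq ss (rD _ _ (mZ _ _ _ _ ca gx))
    (mZ _ _ _ _ ca (rD _ _ gx))) => e; exact: DZ.
- move=> x y; have [g gx] := represented ss x; have [h hy] := represented ss y.
  have [Ag _] := represents_moderate gx; have [Ah _] := represents_moderate hy.
  by apply: (represents_eq ss (rD _ _ (rmul _ _ _ _ gx hy))
    (mD _ _ _ _ (rmul _ _ _ _ (rD _ _ gx) hy) (rmul _ _ _ _ gx (rD _ _ hy)))) => e;
    exact: DM.
exact: (@continuous_slice Ct G G).
Qed.

End Structures.

End Lifts.

(** * Seminormed spaces and algebras *)

Section Seminormed.
Variables (R : realType) (E : topologicalLmodType R[i]) (I : Type) (mu : I -> E -> R).
Hypothesis tE : topologized_by mu.

Lemma seminorm_ge0 i x : 0 <= mu i x.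
Proof.
have [+ _] := tE => /(_ i)[sub hom].
have m0 : mu i 0 = 0 by rewrite -(scale0r 0) hom normc_0 mul0r.
have mN : mu i (- x) = mu i x by rewrite -scaleN1r hom normc_opp normc_1 mul1r.
by have := sub x (- x); rewrite subrr m0 mN -mulr2n pmulrn_lge0.
Qed.

Lemma topologized_quasi_seminorms : quasi_seminorms [set: E] mu.
Proof.
split; first by [].
have [sn _] := tE; split=> [i x _|i c x _|i]; first exact: seminorm_ge0.
  by have [_ ->] := sn i.
exists i, 1 => x y z _ _ _; have [sub _] := sn i.
by rewrite mul1r (le_trans (sub _ _))// lerD2r.
Qed.

Lemma le_pmul_gt (c S M : R) : 0 <= c -> (forall a, S < a -> M <= c * a) -> M <= c * S.
Proof.
rewrite le_eqVlt => /orP[/eqP<- h|c0 h].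
  by have := h (S + 1); rewrite !mul0r; apply; rewrite ltrDl.
apply/ler_addgt0Pr => e e0; have := h (S + e / c).
rewrite mulrDr mulrCA divff ?mulr1 ?gt_eqF//; apply.
by rewrite ltrDl divr_gt0.
Qed.

Lemma sum_seminorm_ge (s : seq I) i x : List.In i s -> mu i x <= \sum_(j <- s) mu j x.
Proof.
elim: s => [//|a s IH] [<-|/IH h]; rewrite big_cons.
  by rewrite lerDl sumr_ge0// => j _; exact: seminorm_ge0.
by rewrite (le_trans h)// lerDr seminorm_ge0.
Qed.

(** Continuity at the origin bounds the product on a polyball.  Rescaling x and y
    into it gives the bound with a and b strictly above the sums of seminorms,
    which then decrease to them. *)
Lemma algebra_product_bound (mul : E -> E -> E) : algebra_product mul ->
  forall i, exists s t C, forall x y,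
    mu i (mul x y) <= C * ((\sum_(j <- s) mu j x) * \sum_(j <- t) mu j y).
Proof.
move=> [_ mDl mDr mZ cm] i; have [sn nb] := tE.
have hom j := (sn j).2.
have m0 : mul 0 0 = 0 by have [+ _] := mZ 0 0 0; rewrite !scale0r.
have nU : nbhs (mul 0 0) [set x | mu i x < 1].
  rewrite m0; apply/nb; exists [set i], 1; split=> //.
  by move=> x; apply.
have [[P Q] /= [/nb[F [r [fF r0 FP]]] /nb[F' [r' [fF' r'0 FQ]]]] PQ] := cm (0, 0) _ nU.
have [s hs] := finite_set_list fF; have [t ht] := finite_set_list fF'.
have ball x y : (forall j, List.In j s -> mu j x < r) ->
    (forall j, List.In j t -> mu j y < r') -> mu i (mul x y) < 1.
  move=> xs yt; apply: (PQ (x, y)); split; [apply: FP|apply: FQ] => j /=.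
    by move/hs; exact: xs.
  by move/ht; exact: yt.
exists s, t, ((r * r')^-1) => x y.
set S := \sum_(j <- s) _; set T := \sum_(j <- t) _.
have S0 : 0 <= S by apply: sumr_ge0 => j _; exact: seminorm_ge0.
have T0 : 0 <= T by apply: sumr_ge0 => j _; exact: seminorm_ge0.
have rr0 : 0 < r * r' by exact: mulr_gt0.
have rr : 0 <= (r * r')^-1 by rewrite invr_ge0 ltW.
rewrite mulrA; apply: le_pmul_gt => [|b Tb]; first exact: mulr_ge0.
have b0 : 0 < b by exact: le_lt_trans Tb.
rewrite mulrAC; apply: le_pmul_gt => [|a Sa]; first by rewrite mulr_ge0// ltW.
have a0 : 0 < a by exact: le_lt_trans Sa.
have shrink (c d S' : R) u z : 0 < c -> 0 < d -> S' < d ->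
    mu u z <= S' -> mu u ((c / d)%:C *: z) < c.
  move=> c0 d0 Sd zS; rewrite hom normc_real gtr0_norm ?divr_gt0//.
  by rewrite mulrAC ltr_pdivrMr// ltr_pM2l// (le_lt_trans zS).
have := ball ((r / a)%:C *: x) ((r' / b)%:C *: y).
have [_ <-] := mZ ((r' / b)%:C) ((r / a)%:C *: x) y.
have [<- _] := mZ ((r / a)%:C) x y.
rewrite !hom !normc_real !gtr0_norm ?divr_gt0// => h.
have {h} : r' / b * (r / a * mu i (mul x y)) < 1.
  by apply: h => j js; apply: shrink (sum_seminorm_ge _ js).
rewrite mulrA (_ : r' / b * (r / a) = (r * r') / (b * a)); last first.
  by field; rewrite !gt_eqF.
rewrite mulrAC ltr_pdivrMr ?mulr_gt0// mul1r => /ltW h.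
by rewrite -mulrA ler_pdivlMl.
Qed.

End Seminormed.

(** * Smooth functions on an open set *)

Section Smooth.
Variables (R : realType) (d : nat) (Omega : set 'rV[R]_d).
Hypothesis oOmega : open Omega.
Local Notation Rd := 'rV[R]_d.
Local Notation smooth := (smooth_on Omega).
Implicit Types (u v : Rd -> R) (x : Rd) (j : 'I_d).

Definition differentiable1 u := forall x, Omega x ->
  {for x, continuous u} /\ forall j, derivable u x (delta_mx 0 j).

(** Smoothness is the greatest property that implies continuity and partial
    derivability and is stable under partial derivatives.  It avoids computing
    iterated derivatives of products. *)
Lemma smooth_coind (S : set (Rd -> R)) :
  (forall u, S u -> differentiable1 u /\ forall j, S (partial j u)) ->
  S `<=` smooth.
Proof.
move=> h u Su s; elim/last_ind: s u Su => [|s j IH] u /h[du Sd]; first exact: du.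
by rewrite foldr_rcons; exact: IH.
Qed.

Lemma smooth_partial j u : smooth u -> smooth (partial j u).
Proof. by move=> su s; have := su (rcons s j); rewrite foldr_rcons. Qed.

(** The algebra generated by the smooth functions, up to equality on Omega.  It is
    stable under partial derivatives by Leibniz' rule. *)
Inductive smooth_algebra : (Rd -> R) -> Prop :=
| sa_smooth u : smooth u -> smooth_algebra u
| sa_add u v : smooth_algebra u -> smooth_algebra v ->
    smooth_algebra (fun x => u x + v x)
| sa_mul u v : smooth_algebra u -> smooth_algebra v ->
    smooth_algebra (fun x => u x * v x)
| sa_eq u v : smooth_algebra u -> (forall x, Omega x -> u x = v x) ->
    smooth_algebra v.

Lemma near_Omega u v x : (forall x, Omega x -> u x = v x) -> Omega x ->
  \near x, u x = v x.
Proof. by move=> uv Ox; apply: filterS (open_nbhs_nbhs (conj oOmega Ox)). Qed.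

Lemma smooth_algebra_smooth : smooth_algebra `<=` smooth.
Proof.
apply: smooth_coind => u; elim=> {u} [u su|u v au [du pu] av [dv pv]
    |u v au [du pu] av [dv pv]|u v au [du pu] uv].
- split=> [x Ox|j]; first exact: (su [::] x Ox).
  by apply: sa_smooth; exact: smooth_partial.
- split=> [x Ox|j].
    have [[cu hu] [cv hv]] := (du _ Ox, dv _ Ox).
    by split=> [|j]; [exact: (@cvgD _ _ _ (nbhs x) (nbhs_filter x) u v)|exact: derivableD].
  apply: (sa_eq (sa_add (pu j) (pv j))) => x Ox.
  have [[_ hu] [_ hv]] := (du _ Ox, dv _ Ox).
  by rewrite /partial -deriveD.
- split=> [x Ox|j].
    have [[cu hu] [cv hv]] := (du _ Ox, dv _ Ox).
    by split=> [|j]; [exact: (@cvgM _ _ (nbhs x) (nbhs_filter x) u v)|exact: derivableM].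
  apply: (sa_eq (sa_add (sa_mul au (pv j)) (sa_mul av (pu j)))) => x Ox.
  have [[_ hu] [_ hv]] := (du _ Ox, dv _ Ox).
  by have := deriveM (hu j) (hv j); rewrite /partial => <-.
split=> [x Ox|j].
  have [cu hu] := du _ Ox; have nuv := near_Omega uv Ox; split=> [|j].
    rewrite /prop_for /continuous_at -(uv x Ox).
    exact: (cvg_trans (near_eq_cvg nuv) cu).
  exact: near_eq_derivable (hu j).
apply: (sa_eq (pu j)) => x Ox; rewrite /partial.
exact: near_eq_derive (near_Omega uv Ox).
Qed.

Lemma smooth_eq u v : smooth u -> (forall x, Omega x -> u x = v x) -> smooth v.
Proof. by move=> su uv; apply: smooth_algebra_smooth; apply: sa_eq uv; exact: sa_smooth. Qed.

Lemma smooth_cst (c : R) : smooth (fun=> c).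
Proof.
apply: (@smooth_coind [set u | exists c : R, u = fun=> c]); last by exists c.
move=> _ [a ->]; split=> [x Ox|j].
  by split=> [|j]; [exact: cst_continuous|exact: derivable_cst].
by exists 0; apply/funext => x; rewrite /partial derive_cst.
Qed.

Lemma smooth_add u v : smooth u -> smooth v -> smooth (fun x => u x + v x).
Proof. by move=> su sv; apply: smooth_algebra_smooth; apply: sa_add; exact: sa_smooth. Qed.

Lemma smooth_mul u v : smooth u -> smooth v -> smooth (fun x => u x * v x).
Proof. by move=> su sv; apply: smooth_algebra_smooth; apply: sa_mul; exact: sa_smooth. Qed.

End Smooth.

(** * Beurling ultradifferentiable functions *)

Section Ultradifferentiable.
Variables (R : realType) (omega : R -> R) (d : nat) (Omega : set 'rV[R]_d).
Hypotheses (womega : weight omega) (oOmega : open Omega).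
Local Notation Rd := 'rV[R]_d.
Local Notation C := (R[i]^o).
Local Notation normc := (@Normc.normc R).
Local Notation wnorm := (@weighted_norm R omega d).
Local Notation test := (@test_function R omega d Omega).
Local Notation UD := (ultradiff omega Omega).
Local Notation smooth := (smooth_on Omega).
Implicit Types (f g h : Rd -> C) (psi chi : Rd -> C) (x : Rd) (j : 'I_d).

Definition csmooth f := smooth (Re_fun f) /\ smooth (Im_fun f).

Lemma csmooth_mul f g : csmooth f -> csmooth g -> csmooth (fun x => f x * g x).
Proof.
move=> [rf If] [rg Ig].
have sN : smooth (fun x => (-1) * (Im_fun f x * Im_fun g x)).
  have s1 : smooth (fun=> -1 : R) by exact: smooth_cst.
  exact: (smooth_mul oOmega s1 (smooth_mul oOmega If Ig)).
split.
  apply: (smooth_eq oOmega (smooth_add oOmega (smooth_mul oOmega rf rg) sN)) => x _.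
  by rewrite /Re_fun ReIm_simp mulN1r.
apply: (smooth_eq oOmega (smooth_add oOmega (smooth_mul oOmega rf Ig)
  (smooth_mul oOmega If rg))) => x _.
by rewrite /Im_fun ReIm_simp.
Qed.

Lemma csmooth_add f g : csmooth f -> csmooth g -> csmooth (fun x => f x + g x).
Proof.
move=> [rf If] [rg Ig]; split.
  by apply: (smooth_eq oOmega (smooth_add oOmega rf rg)) => x _; rewrite /Re_fun ReIm_simp.
by apply: (smooth_eq oOmega (smooth_add oOmega If Ig)) => x _; rewrite /Im_fun ReIm_simp.
Qed.

Lemma csmooth_cst (c : C) : csmooth (fun=> c).
Proof. by split; exact: smooth_cst. Qed.

Lemma csmooth_eq f g : csmooth f -> (forall x, Omega x -> f x = g x) -> csmooth g.
Proof.
by move=> [rf If] fg; split; [apply: (smooth_eq oOmega rf)|apply: (smooth_eq oOmega If)]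
  => x Ox; rewrite /Re_fun /Im_fun fg.
Qed.

Definition cder j f x : C := partial j (Re_fun f) x +i* partial j (Im_fun f) x.

Definition cderivable j f x :=
  derivable (Re_fun f) x (delta_mx 0 j) /\ derivable (Im_fun f) x (delta_mx 0 j).

Lemma csmooth_derivable j f x : csmooth f -> Omega x -> cderivable j f x.
Proof.
by move=> [sr si] Ox; split; [have [_] := sr [::] x Ox|have [_] := si [::] x Ox]; exact.
Qed.

Lemma cderM j f g x : cderivable j f x -> cderivable j g x ->
  cder j (fun x => f x * g x) x = cder j f x * g x + f x * cder j g x.
Proof.
move=> [rf If] [rg Ig]; rewrite /cder /partial.
have -> : Re_fun (fun x => f x * g x) = Re_fun f * Re_fun g - Im_fun f * Im_fun g.
  by apply/funext => y; rewrite /Re_fun ReIm_simp.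
have -> : Im_fun (fun x => f x * g x) = Re_fun f * Im_fun g + Im_fun f * Re_fun g.
  by apply/funext => y; rewrite /Im_fun ReIm_simp.
rewrite (deriveB (derivableM rf rg) (derivableM If Ig)).
rewrite (deriveD (derivableM rf Ig) (derivableM If rg)).
rewrite (deriveM rf rg) (deriveM If Ig) (deriveM rf Ig) (deriveM If rg).
move: (derive (Re_fun f) _ _) (derive (Im_fun f) _ _) => df df'.
move: (derive (Re_fun g) _ _) (derive (Im_fun g) _ _) => dg dg'.
rewrite /Re_fun /Im_fun; move: (f x) (g x) => [a b] [a' b'] /=.
by apply: complex_eqP; rewrite !ReIm_simp /= /GRing.scale /=; ring.
Qed.

Lemma cderD j f g x : cderivable j f x -> cderivable j g x ->
  cder j (fun x => f x + g x) x = cder j f x + cder j g x.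
Proof.
move=> [rf If] [rg Ig]; rewrite /cder /partial.
have -> : Re_fun (fun x => f x + g x) = Re_fun f + Re_fun g.
  by apply/funext => y; rewrite /Re_fun ReIm_simp.
have -> : Im_fun (fun x => f x + g x) = Im_fun f + Im_fun g.
  by apply/funext => y; rewrite /Im_fun ReIm_simp.
by rewrite (deriveD rf rg) (deriveD If Ig).
Qed.

Lemma cder_cst j (c : C) x : cder j (fun=> c) x = 0.
Proof. by rewrite /cder /partial !derive_cst. Qed.

Lemma cder_test j psi x : test psi -> cder j psi x = dtest j psi x.
Proof.
move=> tp; rewrite /cder; have [-> ->] := partial_dtest womega j x tp.
by case: (dtest j psi x).
Qed.

Lemma test_derivable j psi x : test psi -> cderivable j psi x.
Proof. by move=> /(is_derive_dtest womega j x)[[h _] [h' _]]. Qed.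

Lemma test_out psi x : test psi -> ~ Omega x -> psi x = 0.
Proof.
move=> [_ _ sO _] nOx; apply/eqP; apply: contraPT nOx => px.
by apply: contra_notP => _; apply: sO; exact: subset_closure.
Qed.

Lemma ultradiff0 : UD 0.
Proof.
split=> [//||psi tp]; first by split; exact: smooth_cst.
rewrite (_ : (fun x => _) = fun=> 0); first exact: test0.
by apply/funext => x; rewrite mulr0.
Qed.

Lemma ultradiffD f g : UD f -> UD g -> UD (fun x => f x + g x).
Proof.
move=> [f0 sf tf] [g0 sg tg]; split=> [x Ox||psi tp].
- by rewrite f0// g0// addr0.
- exact: (csmooth_add sf sg).
rewrite (_ : (fun x => _) = fun x => psi x * f x + psi x * g x).
  exact: (test_add womega (tf _ tp) (tg _ tp)).
by apply/funext => x; rewrite mulrDr.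
Qed.

Lemma ultradiffM f g : UD f -> UD g -> UD (fun x => f x * g x).
Proof.
move=> [f0 sf tf] [g0 sg tg]; split=> [x Ox||psi tp].
- by rewrite f0// mul0r.
- exact: (csmooth_mul sf sg).
rewrite (_ : (fun x => _) = fun x => (psi x * f x) * g x); last first.
  by apply/funext => x; rewrite mulrA.
exact: (tg _ (tf _ tp)).
Qed.

Lemma ultradiffZ (c : R[i]) f : UD f -> UD (fun x => c * f x).
Proof.
move=> [f0 sf tf]; split=> [x Ox||psi tp].
- by rewrite f0// mulr0.
- exact: (csmooth_mul (csmooth_cst c) sf).
rewrite (_ : (fun x => _) = fun x => c * (psi x * f x)); last first.
  by apply/funext => x; rewrite mulrCA.
exact: (test_scale womega c (tf _ tp)).
Qed.

(** The constant 1 on Omega, extended by 0 as all the elements of [ultradiff]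
    are. *)
Definition ultradiff_one : Rd -> C := fun x => if x \in Omega then 1 else 0.

Lemma ultradiff_one_in : UD ultradiff_one.
Proof.
split=> [x Ox||psi tp].
- by rewrite /ultradiff_one ifN//; apply/negP => /set_mem.
- apply: (csmooth_eq (csmooth_cst 1)) => x Ox; by rewrite /ultradiff_one mem_set.
rewrite (_ : (fun x => _) = psi)//; apply/funext => x; rewrite /ultradiff_one.
have [Ox|nOx] := boolP (x \in Omega); first by rewrite mulr1.
by rewrite mulr0 (test_out tp)// => /mem_set; apply/negP.
Qed.

Lemma cpartialE j f x : Omega x -> cpartial Omega j f x = cder j f x.
Proof. by move=> Ox; rewrite /cpartial mem_set. Qed.

Lemma cpartial_out j f x : ~ Omega x -> cpartial Omega j f x = 0.
Proof. by move=> Ox; rewrite /cpartial ifN//; apply/negP => /set_mem. Qed.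

(** Leibniz' rule, which turns a localized derivative into test functions:
    the derivative of psi f and a multiple of f by another test function. *)
Lemma mul_cpartial j psi f : test psi -> UD f ->
  (fun x => psi x * cpartial Omega j f x) =
  (fun x => dtest j (fun y => psi y * f y) x + (-1) * (dtest j psi x * f x)).
Proof.
move=> tp [f0 sf tf]; apply/funext => x; have tpf := tf _ tp.
have [Ox|nOx] := pselect (Omega x); last first.
  have tdp := test_dtest womega j tpf.
  by rewrite cpartial_out// (test_out tdp)// f0// !mulr0 addr0.
rewrite cpartialE// -(cder_test j x tpf) -(cder_test j x tp).
rewrite cderM; [|exact: test_derivable|exact: csmooth_derivable].
by rewrite mulN1r addrAC subrr add0r.
Qed.

Lemma ultradiff_cpartial j f : UD f -> UD (cpartial Omega j f).
Proof.
move=> uf; have [f0 sf tf] := uf; split=> [x Ox||psi tp].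
- exact: cpartial_out.
- have [sr si] := sf; split.
    apply: (smooth_eq oOmega (smooth_partial j sr)) => x Ox.
    by rewrite /Re_fun cpartialE.
  apply: (smooth_eq oOmega (smooth_partial j si)) => x Ox.
  by rewrite /Im_fun cpartialE.
rewrite (mul_cpartial j tp uf).
exact: (test_add womega (test_dtest womega j (tf _ tp))
  (test_scale womega (-1) (tf _ (test_dtest womega j tp)))).
Qed.

Lemma cpartialD j f g : UD f -> UD g ->
  cpartial Omega j (f + g) = cpartial Omega j f + cpartial Omega j g.
Proof.
move=> [_ sf _] [_ sg _]; apply/funext => x.
rewrite -[RHS]/(cpartial Omega j f x + cpartial Omega j g x).
have [Ox|nOx] := pselect (Omega x); last by rewrite !cpartial_out// addr0.
by rewrite !cpartialE// -cderD//; exact: csmooth_derivable.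
Qed.

Lemma cpartialM j f g : UD f -> UD g ->
  cpartial Omega j (cmul f g) =
  cmul (cpartial Omega j f) g + cmul f (cpartial Omega j g).
Proof.
move=> [_ sf _] [_ sg _]; apply/funext => x.
rewrite -[RHS]/(cpartial Omega j f x * g x + f x * cpartial Omega j g x).
have [Ox|nOx] := pselect (Omega x); last by rewrite !cpartial_out// mul0r mulr0 addr0.
by rewrite !cpartialE// -cderM//; exact: csmooth_derivable.
Qed.

Lemma cpartialZ j (c : R[i]) f : UD f ->
  cpartial Omega j (c *: f) = c *: cpartial Omega j f.
Proof.
move=> [_ sf _]; apply/funext => x.
rewrite -[RHS]/(c * cpartial Omega j f x).
have [Ox|nOx] := pselect (Omega x); last by rewrite !cpartial_out// mulr0.
rewrite !cpartialE// -[c *: f]/(fun x => (fun=> c) x * f x) cderM.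
- by rewrite cder_cst mul0r add0r.
- exact: (csmooth_derivable j (csmooth_cst c) Ox).
- exact: csmooth_derivable.
Qed.

Local Notation unorm := (@ultradiff_norm R omega d Omega).
Local Notation supp psi := (closure [set x | psi x != 0]).
Local Notation idx := (ultradiff_index Omega).
Implicit Types (i : idx).

Definition cutoff (K : set Rd) psi := test psi /\ forall x, K x -> psi x = 1.

Lemma wnorm_fin psi f l : 0 < l -> test psi -> UD f ->
  wnorm l (fun x => psi x * f x) \is a fin_num.
Proof.
move=> l0 tp [_ _ /(_ _ tp)[_ _ _ h]].
by rewrite ge0_fin_numE ?h// wnorm_ge0.
Qed.

Lemma unorm_ge0 i f : 0 <= unorm i f.
Proof.
case: i => -[K l] ?; rewrite /ultradiff_norm /=; apply/fine_ge0/le_ereal_inf_tmp.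
by move=> _ [psi _ <-]; exact: wnorm_ge0.
Qed.

(** One cutoff suffices to make the infimum finite, and then [fine] loses no
    information. *)
Lemma unormE i psi0 f : cutoff (sval i).1 psi0 -> UD f ->
  (unorm i f)%:E = ereal_inf [set wnorm (sval i).2 (fun x => psi x * f x)%R |
    psi in cutoff (sval i).1].
Proof.
case: i => -[K l] [/= cK KO l0] [tp p1] uf; rewrite /ultradiff_norm /=.
rewrite fineK// ge0_fin_numE; last first.
  by apply: le_ereal_inf_tmp => _ [chi _ <-]; exact: wnorm_ge0.
apply: (@le_lt_trans _ _ (wnorm l (fun x => psi0 x * f x)%R)).
  by apply: ereal_inf_lbound; exists psi0.
by rewrite -ge0_fin_numE ?wnorm_ge0//; exact: wnorm_fin.
Qed.

Lemma unorm_le i psi f : cutoff (sval i).1 psi -> UD f ->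
  ((unorm i f)%:E <= wnorm (sval i).2 (fun x => psi x * f x)%R)%E.
Proof.
by move=> cp uf; rewrite (unormE cp uf); apply: ereal_inf_lbound; exists psi.
Qed.

Lemma unorm_ge i (a : R) f psi0 : cutoff (sval i).1 psi0 -> UD f ->
  (forall psi, cutoff (sval i).1 psi ->
     (a%:E <= wnorm (sval i).2 (fun x => psi x * f x)%R)%E) -> a <= unorm i f.
Proof.
move=> cp uf h; rewrite -lee_fin (unormE cp uf).
by apply: le_ereal_inf_tmp => _ [psi hpsi <-]; exact: h.
Qed.

Lemma test_ultradiff_L1 psi f : test psi -> UD f -> L1d (fun x => psi x * f x).
Proof. by move=> tp [_ _ /(_ _ tp)]; exact: test_L1. Qed.

Lemma wnorm0 l : wnorm l (fun=> 0) = 0%E.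
Proof.
have t0 : test (fun=> 0) by exact: test0.
have := wnormZ womega l 0 (test_L1 t0).
rewrite normc_0 mul0e => <-; congr (wnorm l _).
by apply/funext => x; rewrite mul0r.
Qed.

(** Without cutoffs the infimum is +oo, hence the norm 0; for empty K the zero
    function is a cutoff.  In the remaining case a cutoff is nonzero and
    [exists_cutoff] applies. *)
Lemma unorm_dichotomy i : (forall f, UD f -> unorm i f = 0) \/
  exists psi x, cutoff (sval i).1 psi /\ psi x != 0.
Proof.
have [[psi cp]|ncp] := pselect (exists psi, cutoff (sval i).1 psi); last first.
  left=> f _; case: i ncp => -[K l] /= ? ncp; rewrite /ultradiff_norm /=.
  rewrite (_ : [set _ | psi in _] = set0) ?ereal_inf0//.
  by apply/seteqP; split=> // z [psi cp _]; apply: ncp; exists psi.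
have [[x Kx]|K0] := pselect ((sval i).1 !=set0).
  by right; exists psi, x; split=> //; case: cp => _ ->//; exact: oner_neq0.
left=> f uf; apply/eqP; rewrite eq_le unorm_ge0 andbT -lee_fin.
have c0 : cutoff (sval i).1 (fun=> 0).
  split=> [|x Kx]; first exact: test0.
  by case: K0; exists x.
rewrite (le_trans (unorm_le c0 uf))// (_ : (fun x => _) = fun=> 0) ?wnorm0//.
by apply/funext => x; rewrite mul0r.
Qed.

(** If chi is a cutoff of supp psi then psi f = psi (chi f), so the weighted norm
    is at most a constant times the one of chi f; then take the infimum over chi. *)
Lemma cutoff_norm phi y psi l : test phi -> phi y != 0 -> test psi -> 0 < l ->
  exists i (B : R), 0 < B /\ forall f, UD f ->
    (wnorm l (fun x => psi x * f x)%R <= (B * unorm i f)%:E)%E.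
Proof.
move=> tphi phi0 tp l0; have [_ ck sO wp] := tp.
have [chi0 tchi0 chi01] := exists_cutoff womega oOmega tphi phi0 ck sO.
pose i : idx := exist _ (supp psi, l) (And3 ck sO l0).
have wfin : wnorm l psi \is a fin_num by rewrite ge0_fin_numE ?wnorm_ge0 ?wp.
have w0 : 0 <= fine (wnorm l psi) by rewrite fine_ge0// wnorm_ge0.
(* Adding 1 makes the constant positive, so that it can be divided by. *)
pose B := inv2pi R d * fine (wnorm l psi) + 1.
have k0 := inv2pi_gt0 R d.
have B0 : 0 < B by rewrite ltr_wpDl// mulr_ge0// ltW.
exists i, B; split=> // f uf.
have fw := wnorm_fin l0 tp uf; rewrite -(fineK fw) lee_fin -ler_pdivrMl//.
apply: (unorm_ge (psi0 := chi0)) => //= chi [tchi chi1].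
have -> : (fun x => psi x * f x) = (fun x => psi x * (chi x * f x)).
  apply/funext => x; have [->|px] := eqVneq (psi x) 0; first by rewrite !mul0r.
  by rewrite chi1 ?mul1r//; exact: subset_closure.
have tcf : test (fun x => chi x * f x) by case: uf => _ _ /(_ _ tchi).
have [cp _ _] := (testP omega Omega psi).1 tp.
have fwc := wnorm_fin l0 tchi uf.
have wc0 : 0 <= fine (wnorm l (fun x => chi x * f x)) by rewrite fine_ge0// wnorm_ge0.
have := wnorm_mul womega (ltW l0) cp (test_L1ft womega tp) (test_L1 tcf)
  (test_L1ft womega tcf).
have fwpc : wnorm l (fun x => psi x * (chi x * f x)) \is a fin_num.
  rewrite ge0_fin_numE ?wnorm_ge0//.
  by have [_ _ _ /(_ _ l0)] := test_mul womega tp tcf.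
rewrite -(fineK fwpc) -[in leRHS](fineK fwc) -[in leRHS](fineK wfin) -!EFinM.
rewrite -(fineK fwc) !lee_fin => h; rewrite ler_pdivrMl//.
by rewrite (le_trans h)// mulrA /B mulrDl mul1r lerDl.
Qed.

Lemma wnorm_mulD psi f g l : test psi -> UD f -> UD g ->
  (wnorm l (fun x => psi x * (f x + g x))%R <=
   wnorm l (fun x => psi x * f x)%R + wnorm l (fun x => psi x * g x)%R)%E.
Proof.
move=> tp uf ug.
rewrite (_ : (fun x => psi x * (f x + g x)) = (fun x => psi x * f x + psi x * g x)).
  exact: (wnormD womega l (test_ultradiff_L1 tp uf) (test_ultradiff_L1 tp ug)).
by apply/funext => x; rewrite mulrDr.
Qed.

Lemma ultradiff_quasi_seminorms : quasi_seminorms UD unorm.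
Proof.
split; first by split=> [|f g|c f]; [exact: ultradiff0|exact: ultradiffD|exact: ultradiffZ].
split=> [i f _|i c f uf|i]; first exact: unorm_ge0.
- have ucf := ultradiffZ c uf.
  have [z|[psi0 [x [cp px]]]] := unorm_dichotomy i.
    by rewrite (z (c *: f) ucf) (z f uf) mulr0.
  have le psi : cutoff (sval i).1 psi ->
      ((unorm i (c *: f))%:E <= (normc c)%:E * wnorm (sval i).2 (fun x => psi x * f x)%R)%E.
    move=> cps; rewrite (le_trans (unorm_le cps ucf))//.
    rewrite -(wnormZ womega _ c (test_ultradiff_L1 cps.1 uf)).
    rewrite (_ : (fun x => psi x * (c *: f) x) = (fun x => c * (psi x * f x)))//.
    by apply/funext => y; rewrite mulrCA.
  have l0 : 0 < (sval i).2 by case: (i) => ? [].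
  have [c0|c0] := eqVneq (normc c) 0.
    rewrite c0 mul0r -lee_fin (le_trans (le _ cp))// c0 mul0e.
    exact: lexx.
  have cg0 : 0 < normc c by rewrite lt0r c0 normc_ge0.
  rewrite -ler_pdivrMl//; apply: (unorm_ge cp uf) => psi cps.
  have fw := wnorm_fin l0 cps.1 uf.
  have := le _ cps; rewrite -(fineK fw) -EFinM !lee_fin => h.
  by rewrite ler_pdivrMl.
have [z|[psi [x [cp px]]]] := unorm_dichotomy i.
  exists i, 0 => f g h uf ug uh; rewrite mul0r.
  by have -> := z (f + g + h) (ultradiffD (ultradiffD uf ug) uh).
have l0 : 0 < (sval i).2 by case: (i) => ? [].
have [j [B [B0 hB]]] := cutoff_norm cp.1 px cp.1 l0.
exists j, B => f g h uf ug uh; have ufg := ultradiffD uf ug.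
rewrite -lee_fin (le_trans (unorm_le cp (ultradiffD ufg uh)))//.
rewrite (le_trans (wnorm_mulD _ cp.1 ufg uh))// !mulrDr !EFinD.
rewrite (leeD _ (hB _ uh))//.
rewrite (le_trans (wnorm_mulD _ cp.1 uf ug))//.
exact: (leeD (hB _ uf) (hB _ ug)).
Qed.

(** With chi a cutoff of supp psi, psi f g = (psi f) (chi g). *)
Lemma ultradiff_norm_cmul i : exists s t (B : R), forall f g, UD f -> UD g ->
  unorm i (cmul f g) <= B * ((\sum_(j <- s) unorm j f) * \sum_(j <- t) unorm j g).
Proof.
have [z|[psi [x [cp px]]]] := unorm_dichotomy i.
  by exists [::], [::], 0 => f g uf ug; rewrite mul0r (z _ (ultradiffM uf ug)).
have l0 : 0 < (sval i).2 by case: (i) => ? [].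
have [_ ck sO _] := cp.1; have tp := cp.1.
have [chi tchi chi1] := exists_cutoff womega oOmega cp.1 px ck sO.
have [j [B [B0 hB]]] := cutoff_norm tp px tp l0.
have [j' [B' [B'0 hB']]] := cutoff_norm tp px tchi l0.
exists [:: j], [:: j'], (inv2pi R d * (B * B')) => f g uf ug.
rewrite !big_seq1 -lee_fin (le_trans (unorm_le cp (ultradiffM uf ug)))//.
have -> : (fun x => psi x * (f x * g x)) = (fun x => (psi x * f x) * (chi x * g x)).
  apply/funext => y; have [->|py] := eqVneq (psi y) 0; first by rewrite !mul0r.
  by rewrite chi1 ?mul1r ?mulrA//; exact: subset_closure.
have tpf : test (fun x => psi x * f x) by case: uf => _ _ /(_ _ tp).
have tcg : test (fun x => chi x * g x) by case: ug => _ _ /(_ _ tchi).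
have [cpf _ _] := (testP omega Omega _).1 tpf.
have := wnorm_mul womega (ltW l0) cpf (test_L1ft womega tpf) (test_L1 tcg)
  (test_L1ft womega tcg).
move=> /le_trans; apply.
apply: (@le_trans _ _ ((inv2pi R d)%:E *
    ((B * unorm j f)%:E * (B' * unorm j' g)%:E))%E).
  rewrite lee_pmul2l ?lte_fin ?inv2pi_gt0//.
  exact: (lee_pmul (wnorm_ge0 _ _ _) (wnorm_ge0 _ _ _) (hB f uf) (hB' g ug)).
by rewrite -!EFinM lee_fin -[leRHS]mulrA [B * B' * _]mulrACA.
Qed.

(** The two terms of [mul_cpartial] are bounded by [wnorm_dtest], which costs one
    unit of l, and by [cutoff_norm] for the derivative of psi. *)
Lemma ultradiff_norm_cpartial j i : exists s (B : R), forall f, UD f ->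
  unorm i (cpartial Omega j f) <= B * \sum_(k <- s) unorm k f.
Proof.
have [z|[psi [x [cp px]]]] := unorm_dichotomy i.
  by exists [::], 0 => f uf; rewrite mul0r (z _ (ultradiff_cpartial j uf)).
have l0 : 0 < (sval i).2 by case: (i) => ? [].
have l1 : 0 < (sval i).2 + 1 by rewrite addr_gt0.
have tp := cp.1; have tdp := test_dtest womega j tp.
have [k [B [B0 hB]]] := cutoff_norm tp px tp l1.
have [k' [B' [B'0 hB']]] := cutoff_norm tp px tdp l0.
have [A A0 hA] := wnorm_dtest womega Omega j.
exists [:: k; k'], (A * B + B') => f uf.
rewrite big_cons big_seq1 -lee_fin (le_trans (unorm_le cp (ultradiff_cpartial j uf)))//.
rewrite (mul_cpartial j tp uf).
have tpf : test (fun x => psi x * f x) by case: uf => _ _ /(_ _ tp).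
have ldf := test_ultradiff_L1 tdp uf; have ldpf := test_L1 (test_dtest womega j tpf).
have lN : L1d (fun x => (-1) * (dtest j psi x * f x)).
  by case: uf => _ _ /(_ _ tdp)/(test_scale womega (-1))/test_L1.
rewrite (le_trans (wnormD womega _ ldpf lN))//.
rewrite (wnormZ womega _ (-1) ldf) normc_opp normc_1 mul1e.
have h1 := hA _ tpf _ l0; have h2 := hB f uf; have h3 := hB' f uf.
have h4 : (A%:E * wnorm ((sval i).2 + 1) (fun x => psi x * f x)%R <=
    (A * (B * unorm k f))%:E)%E.
  by rewrite EFinM lee_pmul2l ?lte_fin.
rewrite (le_trans (leeD (le_trans h1 h4) h3))// -EFinD lee_fin.
have u1 := unorm_ge0 k f; have u2 := unorm_ge0 k' f.
have AB0 : 0 < A * B by exact: mulr_gt0.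
rewrite mulrDr mulrA lerD//.
  by rewrite ler_wpM2r// lerDl ltW.
by rewrite ler_wpM2r// lerDr ltW.
Qed.

End Ultradifferentiable.

(** * The generalizations as topological modules and algebras *)

Theorem proposition5p2 (R : realType) (omega : R -> R) (womega : weight omega) :
  exists r : ring_ops (generalized_constants omega),
    (componentwise_ring r /\ topological_comring r) /\
    (forall (E : topologicalLmodType R[i]) (I : Type) (mu : I -> E -> R),
       topologized_by mu ->
       sharp_neighbourhoods omega [set: E] mu /\
       exists m : module_ops (generalized_constants omega)
                             (generalization omega [set: E] mu),
         componentwise_module m /\ topological_module r m) /\
    (forall (E : topologicalLmodType R[i]) (I : Type) (mu : I -> E -> R)
            (mulE : E -> E -> E),
       topologized_by mu -> algebra_product mulE ->
       exists (m : module_ops (generalized_constants omega)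
                              (generalization omega [set: E] mu))
              (mul : generalization omega [set: E] mu ->
                     generalization omega [set: E] mu ->
                     generalization omega [set: E] mu),
         [/\ componentwise_module m, componentwise2 mulE mul,
             topological_algebra r m mul &
             forall u : E, is_unit_for mulE u ->
               exists2 x, represents (fun=> u) x & is_unit_for mul x]) /\
    (forall (d : nat) (Omega : set 'rV[R]_d), open Omega ->
       sharp_neighbourhoods omega (ultradiff omega Omega)
         (@ultradiff_norm R omega d Omega) /\
       exists (m : module_ops (generalized_constants omega)
                              (generalized_ultradiff omega Omega))
              (mul : generalized_ultradiff omega Omega ->
                     generalized_ultradiff omega Omega ->
                     generalized_ultradiff omega Omega)
              (D : 'I_d -> generalized_ultradiff omega Omega ->
                     generalized_ultradiff omega Omega),
         [/\ componentwise_module m, componentwise2 (@cmul R d) mul,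
             topological_algebra r m mul,
             (exists one, is_unit_for mul one) &
             forall j, componentwise1 (cpartial Omega j) (D j) /\
                       continuous_derivation m mul (D j)]).
Proof.
have [r [cr tr]] := exists_constants womega.
exists r; split; first by split.
split=> [E I mu tE|].
  have ss := topologized_quasi_seminorms tE.
  by split; [exact: sharp_neighbourhoodsP|exact: (exists_module womega cr ss)].
split=> [E I mu mulE tE aE|d Omega oOmega].
  have ss := topologized_quasi_seminorms tE.
  have [m [cm tm]] := exists_module womega cr ss.
  have [mA mDl mDr mZ _] := aE.
  have bound i : exists s t C, forall x y : E, setT x -> setT y ->
      mu i (mulE x y) <= C * ((\sum_(j <- s) mu j x) * \sum_(j <- t) mu j y).
    by have [s [t [C h]]] := algebra_product_bound tE aE i; exists s, t, C.
  have AT (x y : E) : setT x -> setT y -> setT (mulE x y) by [].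
  have [mul [cmul tmul umul]] :=
    exists_algebra womega ss cm tm mA mDl mDr mZ AT bound.
  exists m, mul; split=> // u [ul ur]; exact: umul.
have ss := ultradiff_quasi_seminorms womega oOmega.
split; first exact: sharp_neighbourhoodsP.
have [m [cm tm]] := exists_module womega cr ss.
have cA : associative (@cmul R d) by move=> f g h; apply/funext => x; exact: mulrA.
have cDl : left_distributive (@cmul R d) +%R.
  by move=> f g h; apply/funext => x; exact: mulrDl.
have cDr : right_distributive (@cmul R d) +%R.
  by move=> f g h; apply/funext => x; exact: mulrDr.
have cZ (a : R[i]) (f g : 'rV[R]_d -> R[i]^o) :
    a *: cmul f g = cmul (a *: f) g /\ a *: cmul f g = cmul f (a *: g).
  by split; apply/funext => x; [exact: mulrA|exact: mulrCA].
have [mul [cmul tmul umul]] := exists_algebra womega ss cm tm cA cDl cDr cZ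
  (ultradiffM (omega := omega) oOmega) (ultradiff_norm_cmul womega oOmega).
have /choice[D hD] : forall j, exists D : generalized_ultradiff omega Omega ->
    generalized_ultradiff omega Omega,
    componentwise1 (cpartial Omega j) D /\ continuous_derivation m mul D.
  move=> j; apply: (exists_derivation womega ss cm cmul).
  - by move=> f; exact: ultradiff_cpartial.
  - by move=> f g; exact: cpartialD.
  - by move=> c f; exact: cpartialZ.
  - by move=> f g; exact: cpartialM.
  - exact: ultradiff_norm_cpartial.
exists m, mul, D; split=> //.
have [||one _ hone] := umul (@ultradiff_one R d Omega).
- exact: ultradiff_one_in.
- move=> f [f0 _ _]; suff h x : f x = f x * ultradiff_one Omega x.
    by split; apply/funext => x; rewrite /Defs.cmul -?h// mulrC -h.
  rewrite /ultradiff_one; case: (boolP (x \in Omega)) => [_|/negP nO]; first by rewrite mulr1.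
  by rewrite mulr0 f0// => /mem_set.
by exists one.
Qed.
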